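(* Let $(p,q)$ be a pair of relatively prime positive integers with $(p,q)\ne(1,1)$, and let $C\subset\mathbb R^4$ be the stationary lagrangian $(p,q)$ cone. Then $C$ does not minimize area among nonorientable lagrangian comparison surfaces. In fact, there exists a nonorientable lagrangian surface $\Sigma$ with $\partial\Sigma=C\cap\partial B_1$ and $A(\Sigma)<A(C\cap B_1)$.
   Context: $\mathbb R^4=\mathbb C^2$ with standard metric and symplectic form; $B_1$ is the unit ball; $A$ is area. $C=\{r\gamma(s):r\ge0\}$ is the cone over $$\gamma(s)=\frac1{\sqrt{p+q}}\Big(\sqrt q\,e^{i\sqrt{p/q}\,s},\ i\sqrt p\,e^{-i\sqrt{q/p}\,s}\Big),\qquad 0\le s\le2\pi\sqrt{pq}.$$ A lagrangian surface here is the image of a compact surface with boundary under a Lipschitz (or $W^{1,2}$) map $\ell$ with $\ell^*\omega=0$ a.e. *)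

(* Defs.v *)
From HB Require Import structures.
From mathcomp Require Import all_boot all_order all_algebra.
From mathcomp Require Import all_classical all_reals all_analysis.
From mathcomp Require Import complex.

Set Implicit Arguments.
Unset Strict Implicit.
Unset Printing Implicit Defensive.

Import Order.TTheory GRing.Theory Num.Theory.
Import numFieldTopology.Exports numFieldNormedType.Exports.

Local Open Scope classical_set_scope.
Local Open Scope ring_scope.

Section Plane.
Context {R : realType}.

Definition half_plane : set (R * R) := [set u | 0 <= u.2].

Definition partial1 (V : normedModType R) (f : R * R -> V) (u : R * R) : V :=
  'D_((1, 0) : R * R) f u.
Definition partial2 (V : normedModType R) (f : R * R -> V) (u : R * R) : V :=
  'D_((0, 1) : R * R) f u.

(* C^infinity near [a]: on a common neighbourhood of [a], every iterated
   directional derivative is Frechet differentiable. *)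
Definition smooth_near (F : R * R -> R * R) (a : R * R) : Prop :=
  \forall u \near a, forall vs : seq (R * R),
    differentiable (foldr (fun v G => 'D_v G) F vs) u.

Definition jacobian_det (F : R * R -> R * R) (u : R * R) : R :=
  (partial1 F u).1 * (partial2 F u).2 - (partial1 F u).2 * (partial2 F u).1.

Definition lebesgue2 : {measure set (measurableTypeR R * measurableTypeR R) -> \bar R} :=
  (@lebesgue_measure R \x @lebesgue_measure R)%E.

End Plane.

(* Smooth surfaces with boundary, given by a finite atlas with values in the
   closed upper half-plane.  Smoothness of a transition map at a point of the
   edge means, as usual, that it extends smoothly across the edge. *)
Record surface (R : realType) := Surface {
  carrier :> topologicalType;
  nchart : nat;
  dom : 'I_nchart -> set carrier;
  chart : 'I_nchart -> carrier -> R * R;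
  param : 'I_nchart -> R * R -> carrier;
  dom_open : forall i, open (dom i);
  dom_cover : forall x, exists i, dom i x;
  chartK : forall i x, dom i x -> param i (chart i x) = x;
  chart_cont : forall i, {within dom i, continuous (chart i)};
  param_cont : forall i, {within chart i @` dom i, continuous (param i)};
  chart_img : forall i, exists2 O : set (R * R),
    open O & chart i @` dom i = O `&` half_plane;
  transition_smooth : forall i j x, dom i x -> dom j x ->
    exists2 F : R * R -> R * R, smooth_near F (chart i x) &
      \forall y \near x, F (chart i y) = chart j y
}.

Section Surface.
Context {R : realType}.
Implicit Type M : surface R.

Definition compact_connected_surface M : Prop :=
  [/\ compact [set: M], hausdorff_space M & connected [set: M]].

Definition boundary M : set M :=
  [set x | exists2 i, dom i x & (chart i x).2 = 0].

(* [o i x] tells whether the [i]-th chart is positive at [x]; at [x] the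
   orientations given by two charts agree exactly when the transition map has
   positive Jacobian determinant there.  All smooth extensions [F] of the
   transition map have the same differential at [chart i x]. *)
Definition is_orientation M (o : 'I_(nchart M) -> M -> bool) : Prop :=
  (forall i x, dom i x -> \forall y \near x, o i y = o i x) /\
  (forall i j x (F : R * R -> R * R), dom i x -> dom j x ->
    smooth_near F (chart i x) ->
    (\forall y \near x, F (chart i y) = chart j y) ->
    (o i x == o j x) = (0 < jacobian_det F (chart i x))).

Definition orientable M : Prop := exists o, @is_orientation M o.

(* Chart coordinates of the points of [A] in [dom i], off the edge of the
   half-plane, which is Lebesgue null. *)
Definition chart_points M (i : 'I_(nchart M)) (A : set M) : set (R * R) :=
  chart i @` (dom i `&` A) `&` [set u | 0 < u.2].

End Surface.

Arguments boundary {R} M.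

Section Lagrangian.
Context {R : realType}.
Implicit Types (z w : 'rV[R]_4) (M : surface R).

(* C^2 is R^4 with coordinates (x1, y1, x2, y2), zk = xk + i yk. *)
Definition of_C2 (a b : R[i]) : 'rV[R]_4 :=
  \row_k [:: complex.Re a; complex.Im a; complex.Re b; complex.Im b]`_k.

Definition dot z w : R := \sum_(k < 4) z 0 k * w 0 k.

(* omega = dx1 /\ dy1 + dx2 /\ dy2 *)
Definition omega z w : R :=
  (z 0 (inord 0) * w 0 (inord 1) - z 0 (inord 1) * w 0 (inord 0))
  + (z 0 (inord 2) * w 0 (inord 3) - z 0 (inord 3) * w 0 (inord 2)).

Definition unit_ball : set 'rV[R]_4 := [set z | dot z z <= 1].
Definition unit_sphere : set 'rV[R]_4 := [set z | dot z z = 1].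

Definition area_density (f : R * R -> 'rV[R]_4) (u : R * R) : R :=
  Num.sqrt (dot (partial1 f u) (partial1 f u) * dot (partial2 f u) (partial2 f u)
            - dot (partial1 f u) (partial2 f u) ^+ 2).

Definition param_area (D : set (R * R)) (f : R * R -> 'rV[R]_4) : \bar R :=
  (\int[lebesgue2]_(u in D) (area_density f u)%:E)%E.

(* On a compact surface this is the Lipschitz condition for the distance of any
   Riemannian metric. *)
Definition lipschitz_map M (l : M -> 'rV[R]_4) : Prop :=
  forall i x, dom i x -> exists k : R, exists2 W : set (R * R),
    nbhs (chart i x) W &
    k.-lipschitz_(W `&` chart i @` dom i) (l \o param i).

(* By Rademacher's theorem the points where a partial derivative fails to exist
   (and the library returns a default value) form a null set. *)
Definition isotropic_ae M (l : M -> 'rV[R]_4) : Prop :=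
  forall i, {ae lebesgue2, forall u, chart_points i [set: M] u ->
    omega (partial1 (l \o param i) u) (partial2 (l \o param i) u) = 0}.

(* The area of the mapped surface, counted with multiplicity, i.e. the integral
   over M of the Jacobian of l.  Each point of M is counted in the first
   chart that contains it. *)
Definition area M (l : M -> 'rV[R]_4) : \bar R :=
  (\sum_(i < nchart M)
     param_area (chart_points i (~` \bigcup_(j in [set j : 'I_(nchart M) | (j < i)%N]) dom j))
                (l \o param i))%E.

Definition lagrangian_surface M (l : M -> 'rV[R]_4) : Prop :=
  [/\ compact_connected_surface M, lipschitz_map l & isotropic_ae l].

(* The boundary of the mapped surface is the set B, traversed once: l maps the
   boundary of M homeomorphically onto B (M being compact).  Equality of sets
   alone would allow l to run back and forth along B with total degree 0. *)
Definition bounds M (l : M -> 'rV[R]_4) (B : set 'rV[R]_4) : Prop :=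
  l @` boundary M = B /\ set_inj (boundary M) l.

Definition nonorientable_comparison (B : set 'rV[R]_4) M (l : M -> 'rV[R]_4) : Prop :=
  [/\ lagrangian_surface l, ~ orientable M & bounds l B].

End Lagrangian.

Section Cone.
Context (R : realType) (p q : nat).

Definition expi (t : R) : R[i] := (cos t +i* sin t)%C.

Definition gamma (s : R) : 'rV[R]_4 :=
  (Num.sqrt (p + q)%:R)^-1 *:
  of_C2 ((Num.sqrt q%:R)%:C%C * expi (Num.sqrt (p%:R / q%:R) * s))
        ('i%C * (Num.sqrt p%:R)%:C%C * expi (- (Num.sqrt (q%:R / p%:R) * s))).

Definition polar (u : R * R) : 'rV[R]_4 := u.1 *: gamma u.2.

Definition polar_dom : set (R * R) :=
  [set u | 0 <= u.1 /\ 0 <= u.2 <= 2 * pi * Num.sqrt (p * q)%:R].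

Definition pq_cone : set 'rV[R]_4 := polar @` polar_dom.

(* The area of C in the unit ball.  For coprime p and q, [polar] is injective
   on [polar_dom] up to a null set. *)
Definition cone_area : \bar R :=
  param_area (polar_dom `&` polar @^-1` unit_ball) polar.

Definition minimizes_among_nonorientable : Prop :=
  forall (M : surface R) (l : M -> 'rV[R]_4),
    nonorientable_comparison (pq_cone `&` unit_sphere) l ->
    (cone_area <= area l)%E.

End Cone.

Arguments expi : clear implicits.
Arguments gamma : clear implicits.
Arguments polar : clear implicits.
Arguments polar_dom : clear implicits.
Arguments pq_cone : clear implicits.
Arguments cone_area : clear implicits.
Arguments minimizes_among_nonorientable : clear implicits.

(* Main.v *)
(* Assume [p < q].  The cone lies on the level 0 of the moment map
   [H = (p |z|^2 - q |w|^2) / 2] of the circle action of weights (p, -q) and is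
   swept out by its orbits.  On a level [H = c > 0] the same orbits sweep out a
   lagrangian annulus which, instead of running to the origin, ends on a short
   orbit in [w = 0]; its area is less than that of the cone by a term of order
   [c log (1 / c)], with the sign of [q - p].  Closing the short orbit by a
   lagrangian Moebius band, and joining the other end of the annulus to the
   boundary of the cone through [N = 1 / c] lagrangian crosscaps of area
   [O (c^2)], costs only [O (c)].  By Stokes' theorem the two curves, lying
   on different levels of [H], bound no orientable lagrangian surface, whence
   the crosscaps. *)

Require Import Defs.
From HB Require Import structures.
From mathcomp Require Import all_boot all_order all_algebra.
From mathcomp Require Import all_classical all_reals all_analysis.
From mathcomp Require Import measurable_realfun complex ring lra.

Set Implicit Arguments.
Unset Strict Implicit.
Unset Printing Implicit Defensive.

Import Order.TTheory GRing.Theory Num.Theory.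
Import numFieldTopology.Exports numFieldNormedType.Exports.

Local Open Scope classical_set_scope.
Local Open Scope ring_scope.

(** * Smooth functions of two variables *)

(** In the coordinates [(H, th, K, psi)] of [action_angle] the symplectic form is
    [dH dth + dK dpsi]. The link of the cone is [H = 0], [K = 1/2], [psi = 0], and the annulus
    starts on [H = c], [K = 1/2], [psi = 0]. The strip between these curves has symplectic area
    [2 pi c]. Cut it into [N] rectangles of sides [c] and [2 pi c]. In each, the boundary loop
    shrinks to the centre like a sine while a circle of radius [c] in the [(K, psi)] plane, run
    through twice, grows like a cosine. Twice the area of that circle is [2 pi c^2], the area of the
    rectangle, so the area enclosed by the loop stays constant and the swept surface is isotropic.
    The last loop is a circle run through twice; identifying its opposite points closes the hole by
    a crosscap. All of this happens at scale [c], whence the area of order [c^2]. The pieces of the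
    map fit together only continuously. This suffices, since the map has to be Lipschitz and the
    lines along which pieces meet are null; only the abstract surface has to be smooth. *)

Lemma near_eq_differentiable (K : realFieldType) (V W : normedModType K)
    (f g : V -> W) (x : V) :
  (\forall w \near x, f w = g w) -> differentiable f x -> differentiable g x.
Proof.
move=> fg df.
have cvx : (fun y : V => y + x) @ (0 : V) --> x.
  by rewrite -[X in _ --> X]add0r; apply: cvgD; [exact: cvg_id | exact: cvg_cst].
have gE : g \o shift x = cst (g x) + 'd f x +o_ 0 id.
  apply/eqaddoP => e e0.
  have H1 : \forall y \near (0 : V), f (y + x) = g (y + x) := cvx _ fg.
  have H2 := (eqaddoP _ _ _ _).1 (diff_locally df) e e0.
  apply: filter_app H2; apply: filter_app H1; near=> y => e1.
  by rewrite !fctE /= e1 (nbhs_singleton fg).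
have dg := diff_unique (diff_continuous df) gE.
by apply/diff_locallyP; split; [rewrite dg; exact: diff_continuous | rewrite dg].
Unshelve. all: by end_near. Qed.

Section Smooth.
Context {R : realType}.
Implicit Types (U : set (R * R)) (f g : R * R -> R).

(** Recursion on the order, over all directions at once, turns the Leibniz and quotient rules into
    inductions on [n]. All orders together give [smooth_near]. *)
Fixpoint Cn (V : normedModType R) (n : nat) U (f : R * R -> V) : Prop :=
  if n is k.+1 then
    (forall u, U u -> differentiable f u) /\ forall v, Cn k U ('D_v f)
  else True.

Definition Cinf (V : normedModType R) U (f : R * R -> V) := forall n, Cn n U f.

Lemma Cn_ext (V : normedModType R) n U (f g : R * R -> V) : open U ->
  (forall u, U u -> f u = g u) -> Cn n U f -> Cn n U g.
Proof.
move=> oU; elim: n f g => [//|n IHn] f g fg /= [df Df].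
have nfg u : U u -> \forall w \near u, f w = g w.
  by move=> Uu; apply: filterS (open_nbhs_nbhs (conj oU Uu)) => w /fg.
split=> [u Uu|v]; first exact: near_eq_differentiable (nfg u Uu) (df u Uu).
by apply: IHn (Df v) => u Uu; apply: near_eq_derive (nfg u Uu).
Qed.

Lemma CnW (V : normedModType R) n U (f : R * R -> V) : Cn n.+1 U f -> Cn n U f.
Proof.
elim: n f => [//|n IHn] f [df Df]; split=> // v; exact/IHn/(Df v).
Qed.

Lemma Cn_cst (V : normedModType R) n U (a : V) : open U -> Cn n U (cst a).
Proof.
move=> oU; elim: n a => [//|n IHn] a; split=> [u _|v].
  exact: differentiable_cst.
by apply: (@Cn_ext _ _ _ (cst 0)) => // u _; rewrite derive_cst.
Qed.

Lemma CnD (V : normedModType R) n U (f g : R * R -> V) : open U ->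
  Cn n U f -> Cn n U g -> Cn n U (fun u => f u + g u).
Proof.
move=> oU; elim: n f g => [//|n IHn] f g [df Df] [dg Dg]; split=> [u Uu|v].
  by apply: differentiableD; [exact: df | exact: dg].
apply: (Cn_ext oU _ (IHn _ _ (Df v) (Dg v))) => // u Uu.
by rewrite deriveD //; apply: diff_derivable; [exact: df | exact: dg].
Qed.

Lemma CnM n U f g : open U ->
  Cn n U f -> Cn n U g -> Cn n U (fun u => f u * g u).
Proof.
move=> oU; elim: n f g => [//|n IHn] f g cf cg.
have [df Df] := cf; have [dg Dg] := cg; split=> [u Uu|v].
  by apply: differentiableM; [exact: df | exact: dg].
apply: (Cn_ext oU _ (CnD oU (IHn _ _ (CnW cf) (Dg v)) (IHn _ _ (CnW cg) (Df v)))) => //.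
by move=> u Uu; rewrite deriveM //; apply: diff_derivable; [exact: df | exact: dg].
Qed.

Lemma CnV n U f : open U -> (forall u, U u -> f u != 0) ->
  Cn n U f -> Cn n U (fun u => (f u)^-1).
Proof.
move=> oU f0; elim: n => [//|n IHn] cf; have [df Df] := cf; split=> [u Uu|v].
  by apply: differentiableV; [exact: df | exact: f0].
have cV := IHn (CnW cf).
have cN : Cn n U (cst (-1 : R)) by exact: Cn_cst.
have C := CnM oU (CnM oU cN (CnM oU cV cV)) (Df v).
apply: (Cn_ext oU _ C).
move=> u Uu; rewrite deriveV ?f0 //; last exact/diff_derivable/df.
by rewrite /GRing.scale /= mulN1r -invfM expr2.
Qed.

Lemma Cn_pair n U f g : open U ->
  Cn n U f -> Cn n U g -> Cn n U (fun u => (f u, g u)).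
Proof.
move=> oU; elim: n f g => [//|n IHn] f g [df Df] [dg Dg]; split=> [u Uu|v].
  by apply: differentiable_pair; [exact: df | exact: dg].
apply: (Cn_ext oU _ (IHn _ _ (Df v) (Dg v))) => // u Uu.
have [hf hg] := (df u Uu, dg u Uu).
by rewrite (deriveE v hf) (deriveE v hg) (deriveE v (differentiable_pair hf hg)) diff_pair.
Qed.

Lemma Cn_fst n U : open U -> Cn n U fst.
Proof.
move=> oU; case: n => [//|n]; split=> [u Uu|v].
  by apply: linear_differentiable => w; exact: cvg_fst.
have cC : Cn n U (cst v.1) by exact: Cn_cst.
have ck : continuous (fst : R * R -> R) by move=> w; exact: cvg_fst.
apply: (Cn_ext oU _ cC) => u Uu.
by rewrite deriveE ?diff_lin //; exact: linear_differentiable.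
Qed.

Lemma Cn_snd n U : open U -> Cn n U snd.
Proof.
move=> oU; case: n => [//|n]; split=> [u Uu|v].
  by apply: linear_differentiable => w; exact: cvg_snd.
have cC : Cn n U (cst v.2) by exact: Cn_cst.
have ck : continuous (snd : R * R -> R) by move=> w; exact: cvg_snd.
apply: (Cn_ext oU _ cC) => u Uu.
by rewrite deriveE ?diff_lin //; exact: linear_differentiable.
Qed.

Lemma Cinf_smooth_near U (F : R * R -> R * R) a : open U -> U a ->
  Cinf U F -> smooth_near F a.
Proof.
move=> oU Ua cF; apply: filterS (open_nbhs_nbhs (conj oU Ua)) => u Uu vs.
suff /(_ 1%N)[dF _] : Cinf U (foldr (fun v G => 'D_v G) F vs) by exact: dF.
by elim: vs => [|v vs IH] //= n; have [_ D] := IH n.+1; exact: D.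
Qed.

End Smooth.

(** * Gluing charts *)

(** A surface presented by parametrizations into a mere set: chart points are glued exactly when
    their images in [point] agree, so that no quotient has to be formed. [apar_trans] provides a
    smooth local extension [F] of each transition map, which near [u] carries the first chart domain
    into the second. *)
Record atlas (R : realType) := Atlas {
  point : Type;
  size_atlas : nat;
  adom : nat -> set (R * R);
  apar : nat -> R * R -> point;
  base_point : R * R;
  size_atlas_gt0 : (0 < size_atlas)%N;
  adom_base : adom 0 base_point;
  adom_half : forall i, exists2 O : set (R * R),
    open O & adom i = O `&` half_plane;
  apar_inj : forall i u v, adom i u -> adom i v -> apar i u = apar i v -> u = v;
  apar_trans : forall i j u v, (i < size_atlas)%N -> (j < size_atlas)%N ->
    adom i u -> adom j v -> apar i u = apar j v ->
    exists F : R * R -> R * R, [/\ smooth_near F u, F u = v &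
      \forall w \near u, adom i w -> adom j (F w) /\ apar j (F w) = apar i w]
}.

Section Gluing.
Context {R : realType}.
Variable a : atlas R.

Definition covered (x : point a) :=
  exists2 i, (i < size_atlas a)%N & exists2 u, adom a i u & apar a i u = x.

Definition glued := {x : point a | covered x}.

HB.instance Definition _ := gen_eqMixin glued.
HB.instance Definition _ := gen_choiceMixin glued.

Let glued_base : glued.
Proof.
exists (apar a 0 (base_point a)).
by exists 0%N; [exact: size_atlas_gt0 | exists (base_point a) => //; exact: adom_base].
Defined.

Definition gpar (i : nat) (u : R * R) : glued :=
  xget glued_base [set x | sval x = apar a i u].

Definition gchart (i : nat) (x : glued) : R * R :=
  xget (0, 0) [set u | adom a i u /\ apar a i u = sval x].

Definition gdom (i : nat) : set glued := gpar i @` adom a i.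

Lemma sval_gpar i u : (i < size_atlas a)%N -> adom a i u ->
  sval (gpar i u) = apar a i u.
Proof.
move=> ia du; rewrite /gpar; case: xgetP => [x _ //|].
have cu : covered (apar a i u) by exists i => //; exists u.
by move=> /(_ (exist _ _ cu)) /=.
Qed.

Lemma gpar_eq i j u v : (i < size_atlas a)%N -> (j < size_atlas a)%N ->
  adom a i u -> adom a j v -> (gpar i u = gpar j v) <-> (apar a i u = apar a j v).
Proof.
move=> ia ja du dv; rewrite -(sval_gpar ia du) -(sval_gpar ja dv).
by split=> [->//|]; exact: eq_sig_hprop.
Qed.

Lemma glued_cover x : exists2 i, (i < size_atlas a)%N &
  exists2 u, adom a i u & gpar i u = x.
Proof.
have [i ia [u du ux]] := svalP x; exists i => //; exists u => //.
by apply: eq_sig_hprop => [? ? ?|]; [exact: Prop_irrelevance | rewrite sval_gpar].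
Qed.

Lemma gchartK i u : (i < size_atlas a)%N -> adom a i u -> gchart i (gpar i u) = u.
Proof.
move=> ia du; rewrite /gchart; case: xgetP => [v _ [dv]|/(_ u)].
  by rewrite sval_gpar // => /(apar_inj dv du).
by rewrite /= sval_gpar // => -[].
Qed.

(** The final topology of the parametrizations. *)
Let op (A : set glued) := forall i u, (i < size_atlas a)%N ->
  adom a i u -> A (gpar i u) -> \forall w \near u, adom a i w -> A (gpar i w).

Let opT : op setT.
Proof. by move=> i u _ _ _; near=> w. Unshelve. all: by end_near. Qed.

Let opI : setI_closed op.
Proof.
move=> A B oA oB i u ia du [Au Bu].
by apply: filterS2 (oA i u ia du Au) (oB i u ia du Bu) => w Aw Bw dw; split; auto.
Qed.

Let op_bigU (I : Type) (f : I -> set glued) :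
  (forall i, op (f i)) -> op (\bigcup_i f i).
Proof.
move=> of_ i u ia du [k _ fku].
by apply: filterS (of_ k i u ia du fku) => w fw dw; exists k; auto.
Qed.

HB.instance Definition _ := isOpenTopological.Build glued opT opI op_bigU.

Lemma glued_openP (A : set glued) : open A <->
  forall i u, (i < size_atlas a)%N -> adom a i u -> A (gpar i u) ->
    \forall w \near u, adom a i w -> A (gpar i w).
Proof. by []. Qed.

Lemma gpar_open i (V : set (R * R)) : (i < size_atlas a)%N -> open V ->
  open (gpar i @` (adom a i `&` V)).
Proof.
move=> ia oV; apply/glued_openP => j v ja dv [u [du Vu] /(gpar_eq ia ja du dv) uv].
have [F [Fs Fv nF]] := apar_trans ja ia dv du (esym uv).
have Fc : {for v, continuous F}.
  by have /nbhs_singleton/(_ [::])/differentiable_continuous := Fs.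
have nV : \forall w \near v, V (F w).
  by apply: Fc; rewrite Fv; exact: open_nbhs_nbhs.
apply: filterS2 nF nV => w {}nF VF.
move=> dw; have [dF eF] := nF dw.
by exists (F w); [split=> //; exact: VF | exact/gpar_eq].
Unshelve. all: by end_near. Qed.

Lemma gdom_open i : (i < size_atlas a)%N -> open (gdom i).
Proof. by move=> ia; have := gpar_open ia openT; rewrite setIT. Qed.

Lemma gpar_cont i : (i < size_atlas a)%N -> {within adom a i, continuous (gpar i)}.
Proof.
move=> ia; apply/subspace_continuousP => u du A.
rewrite nbhsE => -[B [oB Bu] BA].
have /glued_openP/(_ i u ia du Bu) := oB.
by rewrite /= /within /=; apply: filterS => w Bw dw; apply: BA; exact: Bw.
Qed.

Lemma gchart_image i : (i < size_atlas a)%N -> gchart i @` gdom i = adom a i.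
Proof.
move=> ia; apply/seteqP; split=> [_ [_ [u du <-] <-]|u du]; first by rewrite gchartK.
by exists (gpar i u); [exists u | rewrite gchartK].
Qed.

Lemma gchart_cont i : (i < size_atlas a)%N -> {within gdom i, continuous (gchart i)}.
Proof.
move=> ia; apply/subspace_continuousP => _ [u du <-]; rewrite /from_subspace gchartK // => A.
rewrite nbhsE => -[B [oB Bu] BA].
have : nbhs (gpar i u) (gpar i @` (adom a i `&` B)).
  by apply: open_nbhs_nbhs; split; [exact: gpar_open | exists u].
rewrite /= /within /=; apply: filterS => _ [w [dw Bw] <-] _ /=.
by rewrite gchartK //; exact: BA.
Qed.

Lemma gtransition i j x : (i < size_atlas a)%N -> (j < size_atlas a)%N ->
  gdom i x -> gdom j x ->
  exists2 F : R * R -> R * R, smooth_near F (gchart i x) &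
    \forall y \near x, F (gchart i y) = gchart j y.
Proof.
move=> ia ja [u du <-] [v dv vu]; rewrite gchartK //.
have /(apar_trans ia ja du dv)[F [Fs Fu nF]] : apar a i u = apar a j v.
  exact/gpar_eq.
exists F => //; move: nF; rewrite /prop_near1 nbhsE => -[B [oB Bu] BF].
have : nbhs (gpar i u) (gpar i @` (adom a i `&` B)).
  by apply: open_nbhs_nbhs; split; [exact: gpar_open | exists u].
apply: filterS => _ [w [dw Bw] <-] /=; rewrite gchartK //.
have [dF eF] := BF w Bw dw.
by have -> : gpar i w = gpar j (F w); [exact/gpar_eq | rewrite gchartK].
Qed.

Lemma gdom_cover x : exists i : 'I_(size_atlas a), gdom i x.
Proof. by have [i ia [u du <-]] := glued_cover x; exists (Ordinal ia), u. Qed.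

Definition glued_surface : surface R.
Proof.
refine (@Surface R glued (size_atlas a) (fun i => gdom i) (fun i => gchart i)
  (fun i => gpar i) _ gdom_cover _ _ _ _ _).
- by move=> i; exact: gdom_open.
- by move=> i _ [u du <-]; rewrite gchartK.
- by move=> i; exact: gchart_cont.
- by move=> i; rewrite gchart_image //; exact: gpar_cont.
- by move=> i; rewrite gchart_image //; exact: adom_half.
- by move=> i j x; exact: gtransition.
Defined.

Lemma gpar_separated i u v : (i < size_atlas a)%N -> adom a i u -> adom a i v ->
  u <> v -> exists2 AB : set glued * set glued, AB.1 (gpar i u) /\ AB.2 (gpar i v) &
    [/\ open AB.1, open AB.2 & AB.1 `&` AB.2 = set0].
Proof.
move=> ia du dv /eqP uv.
have := @norm_hausdorff R (R * R)%type; rewrite open_hausdorff => /(_ u v uv).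
move=> [[A B] /= [/set_mem Au /set_mem Bv] [oA oB /eqP AB]].
exists (gpar i @` (adom a i `&` A), gpar i @` (adom a i `&` B)) => /=.
  by split; [exists u | exists v].
split; [exact: gpar_open | exact: gpar_open |].
apply/seteqP; split=> // _ [[s [ds As] <-] [t [dt Bt] /(gpar_eq ia ia dt ds)]].
move=> /(apar_inj dt ds) ts; suff : (A `&` B) s by rewrite AB.
by split=> //; rewrite -ts.
Qed.

Lemma glued_lipschitz (l : glued -> 'rV[R]_4) (L : nat -> R * R -> 'rV[R]_4) :
  (forall i u, (i < size_atlas a)%N -> adom a i u -> l (gpar i u) = L i u) ->
  (forall i u, (i < size_atlas a)%N -> adom a i u -> exists k : R,
    exists2 W : set (R * R), nbhs u W & k.-lipschitz_(W `&` adom a i) (L i)) ->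
  @lipschitz_map R glued_surface l.
Proof.
move=> lL LL i _ [u du <-] /=.
have [k [W Wu kW]] := LL i u (ltn_ord i) du.
exists k; exists W; first by rewrite gchartK.
rewrite gchart_image // => -[s t] [/= [Ws ds] [Wt dt]].
by rewrite !lL //; apply: (kW (s, t)).
Qed.

End Gluing.

(** * Sine and cosine at integer multiples of pi *)

Section Trig.
Context {R : realType}.
Implicit Types (x y : R) (k : int).

Lemma sin_intpi k : sin (k%:~R * pi) = 0 :> R.
Proof.
have H (n : nat) : sin (n%:R * pi) = 0 :> R.
  by elim: n => [|n IH]; rewrite ?mul0r ?sin0// -natr1 mulrDl mul1r sinDpi IH oppr0.
by case: k => n; rewrite ?NegzE ?mulrNz ?mulNr ?sinN H ?oppr0.
Qed.

Lemma cos_intpi_sqr k : cos (k%:~R * pi) ^+ 2 = 1 :> R.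
Proof. by rewrite cos2sin2 sin_intpi expr0n subr0. Qed.

Lemma cos_intpi k : cos (k%:~R * pi) = 1 :> R \/ cos (k%:~R * pi) = -1 :> R.
Proof.
have /eqP := cos_intpi_sqr k; rewrite sqrf_eq1 => /orP[]/eqP ->; by [left|right].
Qed.

Lemma cosDintpi x k : cos (x + k%:~R * pi) = cos x * cos (k%:~R * pi) :> R.
Proof. by rewrite cosD sin_intpi mulr0 subr0. Qed.

Lemma sinDintpi x k : sin (x + k%:~R * pi) = sin x * cos (k%:~R * pi) :> R.
Proof. by rewrite sinD sin_intpi mulr0 addr0. Qed.

Lemma cos_int2pi k : cos (k%:~R * (2 * pi)) = 1 :> R.
Proof.
by rewrite mulrCA mulr_natl cos_mulr2n cos_intpi_sqr mulr2n addrK.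
Qed.

Lemma sin_int2pi k : sin (k%:~R * (2 * pi)) = 0 :> R.
Proof. by rewrite mulrCA mulr_natl sin_mulr2n sin_intpi mulr0 mul0rn. Qed.

Lemma cosDint2pi x k : cos (x + k%:~R * (2 * pi)) = cos x :> R.
Proof. by rewrite cosD sin_int2pi cos_int2pi mulr0 mulr1 subr0. Qed.

Lemma sinDint2pi x k : sin (x + k%:~R * (2 * pi)) = sin x :> R.
Proof. by rewrite sinD sin_int2pi cos_int2pi mulr0 mulr1 addr0. Qed.

Lemma cos_sin_eq x y : cos x = cos y -> sin x = sin y ->
  exists k, y = x + k%:~R * (2 * pi).
Proof.
move=> cxy sxy.
have pi0 : 0 < (pi : R) := pi_gt0 R.
pose d := y - x.
have cd : cos d = 1 by rewrite cosB -cxy -sxy -!expr2 cos2Dsin2.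
pose k := Num.floor (d / (2 * pi)); exists k.
have dk : cos (d - k%:~R * (2 * pi)) = 1 by rewrite -mulNr -mulrNz cosDint2pi.
have [k1 k2] : k%:~R * (2 * pi) <= d /\ d < k%:~R * (2 * pi) + 2 * pi.
  have p2 : 0 < 2 * pi :> R by rewrite mulr_gt0.
  rewrite -ler_pdivlMr // -[X in _ + X]mul1r -mulrDl -ltr_pdivrMr //.
  by split; [exact: floor_le | rewrite -[1]/(1%:~R) -intrD floorD1_gt].
set d0 := d - _ in dk.
suff d00 : d0 = 0 by rewrite -[LHS](subrK x) -/d -[d](subrK (k%:~R * (2 * pi))) -/d0 d00 add0r addrC.
have d0ge : 0 <= d0 by rewrite subr_ge0.
have d0lt : d0 < 2 * pi by rewrite /d0 ltrBlDr addrC.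
have [le|lt] := lerP d0 pi.
  by apply: cos_inj; rewrite ?cos0 //= in_itv /= ?lexx ?d0ge ?le ?ltW.
(* If the remainder exceeded [pi], then [2 pi - d0] would lie in [[0, pi]] with cosine 1, hence be
   0, against [d0 < 2 pi]. *)
suff : 2 * pi - d0 = 0 by move=> h; move: d0lt; rewrite -subr_gt0 h ltxx.
have c1 : cos (2 * pi - d0) = 1.
  by rewrite addrC -[2 * pi]mul1r -[1 * _]/(1%:~R * _) cosDint2pi cosN.
apply: cos_inj; last by rewrite c1 cos0.
  by rewrite in_itv /=; apply/andP; split; lra.
by rewrite in_itv /= lexx pi_ge0.
Qed.

End Trig.

(** * The Moebius band with crosscaps *)

Lemma open_ltf (R : realType) (T : topologicalType) (f g : T -> R) :
  continuous f -> continuous g -> open [set x | f x < g x].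
Proof.
move=> cf cg.
have -> : [set x | f x < g x] = (fun x => g x - f x) @^-1` [set y | 0 < y].
  by apply/seteqP; split=> x /=; rewrite subr_gt0.
apply: open_comp; last exact: open_gt.
by move=> x _; apply: cvgB; [exact: cg | exact: cf].
Qed.

Lemma intr_small (R : realType) (k : int) (r : R) :
  0 < r -> `|k%:~R * r| < r -> k = 0.
Proof.
move=> r0; rewrite normrM (gtr0_norm r0) -[X in _ < X]mul1r ltr_pM2r // => k1.
apply/eqP; apply: contraT => k0; move: k1; rewrite ltNge => /negP[].
by rewrite -intr_norm ler1z -gtz0_ge1 normr_gt0.
Qed.

(* The strip [R x [0, 8]] modulo [deck 1 : (s, y) |-> (s + N, 8 - y)] is a
   Moebius band with boundary circle [y = 0] and core [y = 4]; the surface is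
   its blow-up at the orbits of the [N] points [(2 k + 1, 1)].  Near such a
   point the blow-up has coordinates (slope, 1 + x) and (1 / slope, 1 + y),
   the shift by 1 keeping them off the edge of the half-plane. *)
Section Crosscaps.
Context {R : realType}.
Variable N : nat.
Hypothesis N0 : (0 < N)%N.
Let n : R := N%:R.

Let n0 : 0 < n. Proof. by rewrite ltr0n. Qed.

(** [cos (k%:~R * pi)] is the sign [(-1)^k], written so that the addition formulas apply to it and
    negative [k] needs no case of its own. *)
Definition deck (k : int) (P : R * R) : R * R :=
  (P.1 + k%:~R * n, 4 + cos (k%:~R * pi) * (P.2 - 4)).

Definition ang (P : R * R) : R := pi / n * P.1.

(** A complete invariant of the deck group, which realizes the quotient inside [R^4]. A generator
    adds [pi] to [ang], so the doubled angle is unchanged, while [4 - y] and the unit vector of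
    angle [ang] change sign together. This is the Moebius band as a line bundle over the circle, its
    zero section being the core. *)
Definition orbit_inv (P : R * R) : (R * R) * (R * R) :=
  ((cos (2 * ang P), sin (2 * ang P)),
   ((4 - P.2) * cos (ang P), (4 - P.2) * sin (ang P))).

Lemma ang_deck k P : ang (deck k P) = ang P + k%:~R * pi.
Proof.
by rewrite /ang /= mulrDr; congr (_ + _); rewrite mulrCA divfK ?gt_eqF.
Qed.

Lemma orbit_inv_deck k P : orbit_inv (deck k P) = orbit_inv P.
Proof.
have e := cos_intpi_sqr (R := R) k.
rewrite /orbit_inv ang_deck.
have -> : 2 * (ang P + k%:~R * pi) = 2 * ang P + k%:~R * (2 * pi) by ring.
rewrite cosDint2pi sinDint2pi cosDintpi sinDintpi /=.
congr (_, (_, _)); rewrite expr2 in e.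
- set E := cos (k%:~R * pi) in e *.
  by transitivity ((4 - P.2) * cos (ang P) * (E * E)); [ring | rewrite e mulr1].
- set E := cos (k%:~R * pi) in e *.
  by transitivity ((4 - P.2) * sin (ang P) * (E * E)); [ring | rewrite e mulr1].
Qed.

Lemma orbit_inv_inj P Q : orbit_inv P = orbit_inv Q -> exists k, Q = deck k P.
Proof.
move=> [cc ss c s]; have [k kE] := cos_sin_eq cc ss; exists k.
have aE : ang Q = ang P + k%:~R * pi.
  by apply: (mulfI (_ : (2 : R) != 0)); rewrite ?pnatr_eq0 // kE; ring.
have Q1 : Q.1 = P.1 + k%:~R * n.
  apply: (mulfI (_ : pi / n != 0)); first by rewrite mulf_neq0 ?invr_eq0 ?gt_eqF ?pi_gt0.
  by rewrite -[LHS]/(ang Q) -[RHS]/(ang (deck k P)) ang_deck.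
rewrite aE cosDintpi in c; rewrite aE sinDintpi in s.
rewrite [LHS]surjective_pairing /deck Q1; congr pair.
have e := cos_intpi_sqr (R := R) k.
have t := cos2Dsin2 (ang P).
set E := cos (k%:~R * pi) in c s e *; set C := cos _ in c t; set S := sin _ in s t.
suff h : 4 - P.2 = (4 - Q.2) * E.
  have -> : P.2 - 4 = - (4 - P.2) by ring.
  rewrite h; transitivity (4 - (4 - Q.2) * (E ^+ 2)); [by rewrite e; ring | ring].
(* The inner product of the second pair with the unit vector [(C, S)] isolates [4 - P.2], also on
   the core, where that pair vanishes. *)
transitivity ((4 - P.2) * C * C + (4 - P.2) * S * S).
  by rewrite -!mulrA -mulrDr -!expr2 t mulr1.
transitivity ((4 - Q.2) * E * (C ^+ 2 + S ^+ 2)); last by rewrite t mulr1.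
by transitivity ((4 - Q.2) * (C * E) * C + (4 - Q.2) * (S * E) * S);
  [rewrite c s | ring].
Qed.

Definition off (b : bool) (u : R * R) : R * R :=
  if b then (u.1 * (u.2 - 1), u.2 - 1) else (u.2 - 1, u.1 * (u.2 - 1)).

Definition center (k : nat) : R * R := ((k.*2.+1)%:R, 1).

(** Charts 0 to 3 cover the punctured strip; charts [4 + 2 k] and [5 + 2 k] are the slope and the
    reciprocal slope chart of the [k]-th crosscap, so that parity tells them apart. *)
Definition cap (i : nat) : nat := (i - 4)./2.

(** On a crosscap chart this is the blow-down, which collapses the line [u.2 = 1] to the centre. *)
Definition lft (i : nat) (u : R * R) : R * R :=
  if (i < 4)%N then u
  else ((center (cap i)).1 + (off (odd i) u).1, (center (cap i)).2 + (off (odd i) u).2).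

Definition exc (i : nat) (u : R * R) : bool := (4 <= i)%N && (u.2 == 1).

(* The direction of a point of the [cap i]-th crosscap, [Some None] being the
   vertical one; [None] off the crosscaps. *)
Definition tag (i : nat) (u : R * R) : option (option R) :=
  if exc i u then
    Some (if odd i then if u.1 == 0 then None else Some (u.1)^-1 else Some u.1)
  else None.

(** Among points with [y < 4] only even deck transformations act, as translations by multiples of
    [2 n], so the first two windows may have width [2 n]. Around the core the odd ones act as well,
    and the last two windows have width [n]. The lower bound [-1] leaves the edge [y = 0] inside the
    first two windows. *)
Definition lo (i : nat) : R := nth 0 [:: 0; - n; 0; - (n / 2)] i.
Definition hi (i : nat) : R := nth 0 [:: 2 * n; n; n; n / 2] i.
Definition ylo (i : nat) : R := nth 0 [:: -1; -1; 3; 3] i.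
Definition yhi (i : nat) : R := nth 0 [:: 4; 4; 5; 5] i.

(** A smooth function, periodic in [u.1], which vanishes exactly at height 1 over the odd integers,
    the points that are blown up; its positivity punctures the strip charts there. *)
Definition cdist (u : R * R) : R := (u.2 - 1) ^+ 2 + cos (pi / 2 * u.1) ^+ 2.

Definition dom_open_part (i : nat) : set (R * R) :=
  if (i < 4)%N then
    [set u | (lo i < u.1 /\ u.1 < hi i) /\ (ylo i < u.2 /\ u.2 < yhi i) /\ 0 < cdist u]
  else
    [set u | `|u.2 - 1| < 1 / 2 /\ `|u.1 * (u.2 - 1)| < 1 / 2].

Definition cdom (i : nat) : set (R * R) := dom_open_part i `&` half_plane.

Definition cpar (i : nat) (u : R * R) : (R * R) * (R * R) * option (option R) :=
  (orbit_inv (lft i u), tag i u).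

Let cfst : continuous (fst : R * R -> R). Proof. by move=> u; exact: cvg_fst. Qed.
Let csnd : continuous (snd : R * R -> R). Proof. by move=> u; exact: cvg_snd. Qed.
Let ccst (c : R) : continuous (fun _ : R * R => c).
Proof. by move=> u; exact: cvg_cst. Qed.

Lemma cdist_cont : continuous cdist.
Proof.
move=> u; apply: cvgD.
  by rewrite expr2; under eq_fun do rewrite expr2; apply: cvgM; apply: cvgB;
    [exact: csnd | exact: cvg_cst | exact: csnd | exact: cvg_cst].
have c : (fun v : R * R => cos (pi / 2 * v.1)) v @[v --> u] --> cos (pi / 2 * u.1).
  apply: (continuous_comp (f := fun v : R * R => pi / 2 * v.1)).
    by apply: cvgM; [exact: cvg_cst | exact: cfst].
  exact: continuous_cos.
by rewrite expr2; under eq_fun do rewrite expr2; apply: cvgM.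
Qed.

Lemma dom_open_part_open i : open (dom_open_part i).
Proof.
have oI (P Q : R * R -> Prop) : open [set u | P u] -> open [set u | Q u] ->
  open [set u | P u /\ Q u] by exact: openI.
rewrite /dom_open_part; case: ifP => _.
  apply: (oI _ _); first by apply: (oI _ _); exact: open_ltf.
  apply: (oI _ _); first by apply: (oI _ _); exact: open_ltf.
  by apply: open_ltf => //; exact: cdist_cont.
have c1 : continuous (fun u : R * R => u.2 - 1).
  by move=> u; apply: cvgB; [exact: csnd | exact: cvg_cst].
apply: (oI _ _); apply: open_ltf => // u; apply: cvg_norm; first exact: c1.
by apply: cvgM; [exact: cfst | exact: c1].
Qed.

End Crosscaps.

(** * Injectivity and transition maps of the charts *)

Section CrosscapAtlas.
Context {R : realType}.
Variable N : nat.
Hypothesis N0 : (0 < N)%N.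
Let n : R := N%:R.
Let n0 : 0 < n. Proof. by rewrite ltr0n. Qed.
Let n1 : 1 <= n. Proof. by rewrite -[1]/(1%:R) ler_nat. Qed.
Implicit Types (u v w P Q : R * R) (i j : nat).

Lemma deck0 P : deck N 0 P = P.
Proof. by case: P => x y; rewrite /deck !mul0r cos0 addr0 mul1r /= addrC subrK. Qed.

Lemma cos_pm1 (k : int) : `|k| < 2 -> k != 0 -> cos (k%:~R * pi) = -1 :> R.
Proof.
case: k => [[|[|k]]|[|k]] // _ _; first by rewrite mul1r cospi.
by rewrite NegzE mulrNz mulNr cosN mul1r cospi.
Qed.

Lemma lft_range i u : cdom N i u -> 0 <= (lft i u).2 /\ (lft i u).2 < 5.
Proof.
move=> [+ h]; rewrite /dom_open_part /lft; case: ifP => i4.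
  move=> [_ [[_ y2] _]]; split=> //; apply: lt_le_trans y2 _; rewrite /yhi.
  by case: i i4 => [|[|[|[]]]] //= _; rewrite ler_nat.
move=> /= [h1 h2]; rewrite /off; case: ifP => _ /=; move: h1 h2; rewrite !ltr_norml;
  by move=> /andP[? ?] /andP[? ?]; split; lra.
Qed.

Lemma win_hi_lo i : (i < 4)%N -> hi N i - lo N i <= (if (i < 2)%N then 2 * n else n).
Proof. by case: i => [|[|[|[|i]]]] // _; rewrite /hi /lo /= -/n; lra. Qed.

Lemma cpar_inj i u v : cdom N i u -> cdom N i v -> cpar N i u = cpar N i v -> u = v.
Proof.
move=> du dv /pair_equal_spec[/(orbit_inv_inj N0)[k kE]].
have [[Ou hu] [Ov hv]] := (du, dv).
move: Ou Ov kE; rewrite /dom_open_part /lft /tag /exc.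
have [i4|i4] /= := ltnP i 4 => Ou Ov.
  move=> vE _; move: Ou Ov; rewrite vE => -[[a1 a2] [[a3 a4] a5]] [[b1 b2] [[b3 b4] b5]].
  suff -> : k = 0 by rewrite deck0.
  have hl := win_hi_lo i4.
  have kn : `|k%:~R * n| < hi N i - lo N i.
    by rewrite ltr_norml; move: b1 b2 => /=; rewrite -/n => b1 b2; apply/andP; split; lra.
  have [i2|i2] := ltnP i 2; last first.
    by apply: (intr_small n0); rewrite ltnNge i2 /= in hl; exact: lt_le_trans hl.
  (* A window of width [2 n] still allows [k = 1] and [k = -1], but these reflect [y] across the
     core, out of [y < 4]. *)
  apply/eqP; apply: contraT => k0.
  have k2 : `|k| < 2.
    rewrite -(ltr_int R) intr_norm -(ltr_pM2r n0) -{1}(gtr0_norm n0) -normrM.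
    by rewrite i2 in hl; exact: lt_le_trans hl.
  move: b4; rewrite /= (cos_pm1 k2 k0) => b4.
  have y4 : yhi i = 4 :> R by case: i i2 {i4 a1 a2 a3 a4 a5 b1 b2 b3 b4 hl kn du dv} => [|[]].
  rewrite y4 in a4 b4; clear vE; suff : False by []; lra.
case: u du hu Ou => a b /= du hu [Ou1 Ou2]; case: v dv hv Ov => c d /= dv hv [Ov1 Ov2].
have [->|b1] := eqVneq b 1; have [->|d1] := eqVneq d 1 => //.
  move=> _ [] /=; case: ifP => _; last by move=> [->].
  case: eqVneq => [->|a0]; case: eqVneq => [->|c0] //; by move=> [] /invr_inj ->.
move=> E _.
(* Both points lie within [1 / 2] of the same centre, so the translation [k n] is smaller than
   [1 <= n]. *)
have k0 : k = 0.
  move: E; rewrite /deck /off /=; case: ifP => _ [E1 _];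
  move: Ou1 Ou2 Ov1 Ov2; rewrite !ltr_norml => /andP[? ?] /andP[? ?] /andP[? ?] /andP[? ?];
  apply: (intr_small n0); (apply: lt_le_trans n1; rewrite ltr_norml -/n; rewrite -/n in E1;
  apply/andP; split; lra).
move: E; rewrite k0 deck0 => -[] /addrI E1 /addrI E2.
move: E1 E2; rewrite /off; case: ifP => _ /=.
  move=> E1 /addIr db; rewrite db in E1 *; congr (_, _).
  by apply: (mulIf (_ : b - 1 != 0)); rewrite ?subr_eq0.
move=> /addIr db E1; rewrite db in E1 *; congr (_, _).
by apply: (mulIf (_ : b - 1 != 0)); rewrite ?subr_eq0.
Qed.

Lemma lft_Cinf i (U : set (R * R)) : open U ->
  Cinf U (fun u => (lft i u).1) /\ Cinf U (fun u => (lft i u).2).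
Proof.
move=> oU.
have c1 m : Cn m U (fst : R * R -> R) by exact: Cn_fst.
have c2 m : Cn m U (snd : R * R -> R) by exact: Cn_snd.
have cc (c : R) m : Cn m U (fun _ : R * R => c) by exact: Cn_cst.
have cx m : Cn m U (fun u : R * R => u.2 - 1) by apply: (CnD oU); [exact: c2 | exact: cc].
have cy m : Cn m U (fun u : R * R => u.1 * (u.2 - 1)) by apply: (CnM oU).
by rewrite /lft /off; case: (i < 4)%N; [split | case: (odd i); split] => m //=;
  (exact: c1 || exact: c2 || apply: (CnD oU)).
Qed.

Lemma deck_lft_Cinf k i (U : set (R * R)) : open U ->
  Cinf U (fun u => (deck N k (lft i u)).1) /\ Cinf U (fun u => (deck N k (lft i u)).2).
Proof.
move=> oU; have [c1 c2] := lft_Cinf i oU.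
have cc (c : R) m : Cn m U (fun _ : R * R => c) by exact: Cn_cst.
split=> m; first by apply: (CnD oU) => //; exact: c1.
apply: (CnD oU) => //; apply: (CnM oU) => //; apply: (CnD oU) => //; exact: c2.
Qed.

Definition slope_den j P : R :=
  if (j < 4)%N then 1 else if odd j then P.2 - 1 else P.1 - (center (cap j)).1.

(** The inverse of the blow-down [lft j] where [slope_den j] does not vanish. Off the crosscaps,
    every transition map is a deck transformation between a blow-down and such an inverse. *)
Definition slope_chart j P : R * R :=
  if (j < 4)%N then P
  else if odd j then ((P.1 - (center (cap j)).1) / (P.2 - 1), P.2 - 1 + 1)
  else ((P.2 - 1) / (P.1 - (center (cap j)).1), P.1 - (center (cap j)).1 + 1).

Lemma slope_chartK j P : slope_den j P != 0 -> lft j (slope_chart j P) = P.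
Proof.
rewrite /slope_den /slope_chart /lft /off; case: ifP => // _.
by case: ifP => o /= d0; rewrite !addrK divfK //= !subrKC; case: P {d0}.
Qed.

Lemma slope_den_exc j P : slope_den j P != 0 -> exc j (slope_chart j P) = false.
Proof.
rewrite /slope_den /slope_chart /exc; case: (ltnP j 4) => //= _.
by case: ifP => o /= d0; rewrite -subr_eq0 addrK; exact: negbTE.
Qed.

Lemma lft_slope j v : exc j v = false ->
  slope_den j (lft j v) != 0 /\ slope_chart j (lft j v) = v.
Proof.
rewrite /slope_den /slope_chart /lft /exc /off; case: (ltnP j 4) => [_ _|_] /=.
  by rewrite oner_eq0.
move=> /negbT v1; have v0 : v.2 - 1 != 0 by rewrite subr_eq0.
have E (c x : R) : c + x - c = x by ring.
by case: ifP => o /=; rewrite !E; (split; first by rewrite o);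
  rewrite mulfK // subrK; case: v {v1 v0}.
Qed.

Lemma slope_chart_Cinf k i j (U : set (R * R)) : open U ->
  (forall u, U u -> slope_den j (deck N k (lft i u)) != 0) ->
  Cinf U (fun u => slope_chart j (deck N k (lft i u))).
Proof.
move=> oU; rewrite /slope_den /slope_chart; have [c1 c2] := deck_lft_Cinf k i oU.
have cc (c : R) m : Cn m U (fun _ : R * R => c) by exact: Cn_cst.
have cx c m : Cn m U (fun u => (deck N k (lft i u)).1 - c).
  by apply: (CnD oU) => //; exact: c1.
have cy c m : Cn m U (fun u => (deck N k (lft i u)).2 - c).
  by apply: (CnD oU) => //; exact: c2.
case: (j < 4)%N => [_ m|].
  apply: (Cn_ext oU (f := fun u => ((deck N k (lft i u)).1, (deck N k (lft i u)).2))) => //.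
  by apply: (Cn_pair oU); [exact: c1 | exact: c2].
by case: (odd j) => h m; apply: (Cn_pair oU); do ?[apply: (CnD oU) => //];
  apply: (CnM oU) => //; apply: (CnV oU).
Qed.

Lemma cdom_snd j v : cdom N j v -> 0 < v.2 \/ (j < 4)%N /\ v.2 = 0.
Proof.
move=> [+ h]; rewrite /dom_open_part; case: ifP => j4.
  by move: h; rewrite /half_plane /= le_eqVlt => /orP[/eqP e|v0]; [right; rewrite -e | left].
by move=> [+ _]; rewrite ltr_norml => /andP[? _]; left; lra.
Qed.

Lemma near_exc i u : exc i u = false -> \forall w \near u, exc i w = false.
Proof.
rewrite /exc; have [i4 /= u1|i4 _] := leqP 4 i; last first.
  by apply: filterE => w.
have o : open [set w : R * R | w.2 != 1].
  apply: (open_comp (f := snd) (D := [set y : R | y != 1])); last exact: open_neq.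
  by move=> w _; exact: cvg_snd.
have : nbhs u [set w : R * R | w.2 != 1].
  by apply: open_nbhs_nbhs; split=> //=; rewrite u1.
by apply: filterS => w /negbTE.
Qed.

Lemma cpar_trans_regular i j u v : cdom N i u -> cdom N j v ->
  exc i u = false -> exc j v = false -> cpar N i u = cpar N j v ->
  exists F : R * R -> R * R, [/\ smooth_near F u, F u = v &
    \forall w \near u, cdom N i w -> cdom N j (F w) /\ cpar N j (F w) = cpar N i w].
Proof.
move=> du dv eu ev /pair_equal_spec[/(orbit_inv_inj N0)[k kE] _].
have [den0 chv] := lft_slope ev.
pose F w := slope_chart j (deck N k (lft i w)).
have Fu : F u = v by rewrite /F -kE.
pose U := [set w | slope_den j (deck N k (lft i w)) != 0].
have Uu : U u by rewrite /U /= -kE.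
have oT : open [set: R * R] := openT.
have [c1 c2] := deck_lft_Cinf k i oT.
have cont f : Cinf setT f -> continuous (f : R * R -> R).
  by move=> cf w; have [df _] := cf 1%N; exact/differentiable_continuous/df.
have oU : open U.
  apply: (open_comp (f := fun w => slope_den j (deck N k (lft i w)))
    (D := [set y : R | y != 0])); last exact: open_neq.
  move=> w _; rewrite /slope_den; case: (j < 4)%N; first exact: cvg_cst.
  by case: (odd j); apply: cvgB; [exact: (cont _ c2)|exact: cvg_cst|exact: (cont _ c1)|exact: cvg_cst].
have sF : smooth_near F u.
  by apply: (Cinf_smooth_near oU Uu); exact: (slope_chart_Cinf oU).
have Fc : {for u, continuous F}.
  by have /nbhs_singleton/(_ [::])/differentiable_continuous := sF.
have Uw : \forall w \near u, U w by exact: open_nbhs_nbhs.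
have Ow : \forall w \near u, dom_open_part N j (F w).
  by apply: Fc; rewrite Fu; apply: open_nbhs_nbhs; split;
    [exact: dom_open_part_open | case: dv].
(* The transition map respects the half-plane. At an interior value this is continuity. At a value
   on the edge, [k] must be even, because an odd one sends [y < 5] to [8 - y > 3]; and an even one
   does not change [y]. *)
have Hw : \forall w \near u, cdom N i w -> half_plane (F w).
  have [v2|[j4 v2]] := cdom_snd dv.
    have oP : open [set w : R * R | 0 < w.2].
      by apply: open_ltf => w; [exact: cvg_cst | exact: cvg_snd].
    have nP : nbhs (F u) [set w | 0 < w.2].
      by rewrite Fu; exact: (open_nbhs_nbhs (conj oP v2)).
    have : \forall w \near u, 0 < (F w).2 := Fc _ nP.
    by apply: filterS => w wF _; exact: ltW.
  apply: filterE => w dw; have [w0 w5] := lft_range dw.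
  rewrite /half_plane /F /slope_chart j4 /=.
  have [u0 u5] := lft_range du.
  have lv : lft j v = v by rewrite /lft j4.
  have [-> | e] := cos_intpi (R := R) k; first lra.
  by move: v2; rewrite -lv kE /= e; lra.
exists F; split=> //.
apply: filterS (filterI (filterI Uw Ow) (filterI Hw (near_exc eu))).
move=> w [[Uw' Ow'] [Hw' ew]] dw; split; first by split=> //; exact: Hw'.
rewrite /cpar /tag (slope_den_exc Uw') ew.
by rewrite /F (slope_chartK Uw') orbit_inv_deck.
Qed.

End CrosscapAtlas.

Section CrosscapSurface.
Context {R : realType}.
Variable N : nat.
Hypothesis N0 : (0 < N)%N.
Let n : R := N%:R.
Let n0 : 0 < n. Proof. by rewrite ltr0n. Qed.
Implicit Types (u v w P Q : R * R) (i j : nat).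

Definition ncharts := (4 + N.*2)%N.

Definition cap_chart (k : nat) (b : bool) : nat := (4 + (b + k.*2))%N.

Lemma cap_chart_cap k b : cap (cap_chart k b) = k.
Proof. by rewrite /cap /cap_chart addKn half_bit_double. Qed.

Lemma cap_chart_odd k b : odd (cap_chart k b) = b.
Proof. by rewrite /cap_chart !oddD odd_double addbF /= oddb. Qed.

Lemma cap_chart_lt k b : (k < N)%N -> (cap_chart k b < ncharts)%N.
Proof.
move=> kN; rewrite /ncharts /cap_chart ltn_add2l.
by apply: (@leq_trans k.+1.*2); rewrite ?leq_double // doubleS; case: b.
Qed.

Lemma cap_lt i : (4 <= i)%N -> (i < ncharts)%N -> (cap i < N)%N.
Proof. by move=> i4 iN; rewrite /cap ltn_half_double ltn_subLR. Qed.

Lemma lft_exc i u : exc i u -> lft i u = center (cap i).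
Proof.
move=> /andP[i4 /eqP u1]; rewrite /lft ltnNge i4 /off u1 subrr mulr0.
by case: ifP => _ /=; rewrite !addr0 /center.
Qed.

Lemma center_orbit k l : (k < N)%N -> (l < N)%N ->
  orbit_inv N (center k) = orbit_inv N (center l) :> (R * R) * (R * R) -> k = l.
Proof.
move=> kN lN /(orbit_inv_inj N0)[d]; rewrite /deck /center /= -/n => -[e1 e2].
have d2 : `|d| < 2.
  rewrite -(ltr_int R) intr_norm -(ltr_pM2r n0) -{1}(gtr0_norm n0) -normrM.
  have -> : d%:~R * n = (l.*2.+1)%:R - (k.*2.+1)%:R by rewrite e1; ring.
  have h m : (m < N)%N -> (m.*2.+1)%:R < 2 * n :> R /\ 0 < (m.*2.+1)%:R :> R.
    move=> mN; rewrite ltr0n; split=> //; rewrite -natrM ltr_nat mul2n.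
    by rewrite (@leq_trans m.+1.*2) ?leq_double // doubleS.
  have [h1 h2] := h _ kN; have [h3 h4] := h _ lN.
  by rewrite ltr_norml; apply/andP; split; lra.
have [d0|d0] := eqVneq d 0.
  move: e1; rewrite d0 mul0r addr0 => /eqP; rewrite eqr_nat eqSS => /eqP h.
  by rewrite -[k]doubleK -[l]doubleK h.
(* The remaining values of [d] would reflect the height 1 to 7. *)
by exfalso; move: e2; rewrite (cos_pm1 d2 d0) => e2; lra.
Qed.

Lemma cpar_exc i j u v : cpar N i u = cpar N j v -> exc i u = exc j v.
Proof. by move=> /pair_equal_spec[_]; rewrite /tag; case: (exc i u); case: (exc j v). Qed.

Lemma slope_swap_Cinf (U : set (R * R)) : open U -> (forall u, U u -> u.1 != 0) ->
  Cinf U (fun u => ((u.1)^-1, u.1 * (u.2 - 1) + 1)).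
Proof.
move=> oU U0 m.
have c1 : Cn m U (fst : R * R -> R) by exact: Cn_fst.
have c2 : Cn m U (snd : R * R -> R) by exact: Cn_snd.
have cc (c : R) : Cn m U (fun _ : R * R => c) by exact: Cn_cst.
apply: (Cn_pair oU); first exact: (CnV oU).
by apply: (CnD oU) => //; apply: (CnM oU) => //; apply: (CnD oU).
Qed.

Lemma cpar_trans i j u v : (i < ncharts)%N -> (j < ncharts)%N ->
  cdom N i u -> cdom N j v -> cpar N i u = cpar N j v ->
  exists F : R * R -> R * R, [/\ smooth_near F u, F u = v &
    \forall w \near u, cdom N i w -> cdom N j (F w) /\ cpar N j (F w) = cpar N i w].
Proof.
move=> iN jN du dv uv; have euv := cpar_exc uv.
have [eu|eu] := boolP (exc i u); last first.
  by apply: cpar_trans_regular => //; [exact: negbTE | rewrite -euv; exact: negbTE].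
have ev : exc j v by rewrite -euv.
have [/andP[i4 /eqP u1] /andP[j4 /eqP v1]] := (eu, ev).
have ij : cap i = cap j.
  move: uv => /pair_equal_spec[+ _]; rewrite (lft_exc eu) (lft_exc ev).
  by apply: center_orbit; exact: cap_lt.
move: (uv) => /pair_equal_spec[_]; rewrite /tag eu ev.
have [oij|oij] := eqVneq (odd i) (odd j).
  have iEj : i = j.
    rewrite -(subnK i4) -(subnK j4) -(odd_double_half (i - 4)) -(odd_double_half (j - 4)).
    by rewrite !oddB // oij -/(cap i) -/(cap j) ij.
  move: uv; rewrite iEj => /(cpar_inj N0) uv _; rewrite iEj in du.
  exists id; split; [|exact: uv|].
    apply: (Cinf_smooth_near openT) => // m.
    by apply: (Cn_ext openT (f := fun u => (u.1, u.2))) => [[]//|];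
      apply: (Cn_pair openT); [exact: (Cn_fst _ openT) | exact: (Cn_snd _ openT)].
  by apply: filterE.
(* The change of affine charts of a blow-up: the slope is inverted, and slope times one displacement
   is the other displacement. *)
pose F w := ((w.1)^-1, w.1 * (w.2 - 1) + 1).
move=> tE.
have [u0 Fu] : u.1 != 0 /\ F u = v.
  rewrite /F u1 subrr mulr0 add0r; case: v v1 {dv uv euv ev} tE => v1 v2 /= -> tE.
  move: tE oij; case: (odd i); case: (odd j) => //= -[] h _; move: h.
    by case: eqVneq => // u0 [->].
  by case: eqVneq => // v0 [->]; rewrite invr_neq0 ?invrK.
have oU : open [set w : R * R | w.1 != 0].
  apply: (open_comp (f := fst) (D := [set y : R | y != 0])); last exact: open_neq.
  by move=> w _; exact: cvg_fst.
have sF : smooth_near F u by apply: (Cinf_smooth_near oU) => //; exact: slope_swap_Cinf.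
have Fc : {for u, continuous F}.
  by have /nbhs_singleton/(_ [::])/differentiable_continuous := sF.
have nP : nbhs (F u) (dom_open_part N j).
  rewrite Fu; apply: open_nbhs_nbhs; split; [exact: dom_open_part_open | by case: dv].
have Ow : \forall w \near u, dom_open_part N j (F w) := Fc _ nP.
have Uw : \forall w \near u, w.1 != 0 by exact: (open_nbhs_nbhs (conj oU u0)).
exists F; split=> //; apply: filterS (filterI Uw Ow) => w [w0 Oj] dw.
have dF : cdom N j (F w).
  split=> //; move: Oj; rewrite /dom_open_part ltnNge j4 /= addrK => -[+ _].
  by rewrite ltr_norml /half_plane /= => /andP[? _]; lra.
split=> //; congr pair.
  congr (orbit_inv N _); rewrite /lft [(j < 4)%N]ltnNge [(i < 4)%N]ltnNge i4 j4 /= ij /off addrK.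
  by move: oij; case: (odd i); case: (odd j) => //= _; rewrite mulrA mulVf // mul1r.
rewrite /tag /exc i4 j4 /= -subr_eq0 addrK mulf_eq0 (negbTE w0) subr_eq0 /=.
case: eqP => // _.
by move: oij; case: (odd i); case: (odd j) => //= _; rewrite ?invr_eq0 (negbTE w0) ?invrK.
Qed.

Definition crosscap_atlas : atlas R.
Proof.
refine (@Atlas R _ ncharts (cdom N) (cpar N) (n, 0) isT _ _ _ _).
- split; last exact: lexx.
  rewrite /dom_open_part /lo /hi /ylo /yhi /cdist /= -/n; have := n0; do ?split; try lra.
  by rewrite sub0r sqrrN expr1n; have := sqr_ge0 (cos (pi / 2 * n)); lra.
- by move=> i; exists (dom_open_part N i) => //; exact: dom_open_part_open.
- exact: (cpar_inj N0).
- exact: cpar_trans.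
Defined.

End CrosscapSurface.

(** * How the charts overlap *)

Section CrosscapTopology.
Context {R : realType}.
Variable N : nat.
Hypothesis N0 : (0 < N)%N.
Let n : R := N%:R.
Let n0 : 0 < n. Proof. by rewrite ltr0n. Qed.
Let n1 : 1 <= n. Proof. by rewrite -[1]/(1%:R) ler_nat. Qed.
Implicit Types (u v w P Q : R * R) (i j : nat).

Local Notation a := (@crosscap_atlas R N N0).
Local Notation par := (gpar a).

Lemma small_ncharts i : (i < 4)%N -> (i < ncharts N)%N.
Proof. by move=> i4; exact: ltn_addr. Qed.

Lemma par_eq i j u v : (i < ncharts N)%N -> (j < ncharts N)%N ->
  cdom N i u -> cdom N j v -> (par i u = par j v) <-> (cpar N i u = cpar N j v).
Proof. exact: (@gpar_eq R a). Qed.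

Lemma par_deck k i j u v : (i < ncharts N)%N -> (j < ncharts N)%N ->
  cdom N i u -> cdom N j v -> exc i u = false -> exc j v = false ->
  lft j v = deck N k (lft i u) -> par i u = par j v.
Proof.
move=> iN jN du dv eu ev e; apply/par_eq => //.
by rewrite /cpar /tag eu ev e orbit_inv_deck.
Qed.

Lemma par_deck_reg k i j u : (i < 4)%N -> (j < 4)%N -> cdom N i u ->
  cdom N j (deck N k u) -> par j (deck N k u) = par i u.
Proof.
move=> i4 j4 du dv; apply: esym.
have ei : exc i u = false by rewrite /exc leqNgt i4.
have ej : exc j (deck N k u) = false by rewrite /exc leqNgt j4.
apply: (par_deck (small_ncharts i4) (small_ncharts j4) du dv ei ej (k := k)).
by rewrite /lft i4 j4.
Qed.

Lemma par_shift i j s t (y : R) : (i < 4)%N -> (j < 4)%N -> cdom N i (s, y) ->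
  cdom N j (t, y) -> t = s \/ t = s + 2 * n \/ t = s - 2 * n ->
  par j (t, y) = par i (s, y).
Proof.
move=> i4 j4 du dv h.
have [k kE] : exists k, (t, y) = deck N k (s, y).
  case: h => [->|[->|->]].
  - by exists 0; rewrite deck0.
  - exists 2; rewrite /deck /= -/n; congr pair.
    by rewrite -[2%:~R]/(2%:R) mulr_natl cos2pi mul1r addrC subrK.
  - exists (-2); rewrite /deck /= -/n; congr pair; first by ring.
    by rewrite mulrNz mulNr cosN -[2%:~R]/(2%:R) mulr_natl cos2pi mul1r addrC subrK.
by move: dv; rewrite kE; exact: par_deck_reg.
Qed.

Lemma par_flip i j s t (y : R) : (i < 4)%N -> (j < 4)%N -> cdom N i (s, y) ->
  cdom N j (t, 8 - y) -> t = s + n \/ t = s - n ->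
  par j (t, 8 - y) = par i (s, y).
Proof.
move=> i4 j4 du dv h.
have [k kE] : exists k, (t, 8 - y) = deck N k (s, y).
  case: h => [->|->].
  - by exists 1; rewrite /deck /= -/n !mul1r cospi; congr pair; ring.
  - by exists (-1); rewrite /deck /= -/n !mulrN1z !mulN1r cosN cospi; congr pair; ring.
by move: dv; rewrite kE; exact: par_deck_reg.
Qed.

Lemma cdist_far (s y : R) : y != 1 -> 0 < cdist (s, y).
Proof.
move=> y1; rewrite /cdist /=; apply: ltr_wpDr; first exact: sqr_ge0.
by rewrite lt_def sqr_ge0 sqrf_eq0 subr_eq0 y1.
Qed.

Lemma odd_natr k : (k.*2.+1)%:R = 2 * k%:R + 1 :> R.
Proof. by rewrite -natr1 -mul2n natrM. Qed.

Lemma cdist_cell k (x y : R) : cdist (k.*2.+1%:R + x, y) = (y - 1) ^+ 2 + sin (pi / 2 * x) ^+ 2.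
Proof.
rewrite /cdist /=; congr (_ + _).
have -> : pi / 2 * (k.*2.+1%:R + x) = (pi / 2 * x + pi / 2) + (k : int)%:~R * pi.
  rewrite odd_natr -[(k : int)%:~R]/(k%:R : R).
  by field.
by rewrite cosDintpi cosDpihalf exprMn cos_intpi_sqr mulr1 sqrrN.
Qed.

Lemma cdist_in_cell k (x y : R) : `|x| <= 1 -> (x, y) <> (0, 1) ->
  0 < cdist (k.*2.+1%:R + x, y).
Proof.
move=> x1 xy; have [y1|y1] := eqVneq y 1; last exact: cdist_far.
have x0 : x != 0 by apply/eqP => x0; apply: xy; rewrite x0 y1.
rewrite cdist_cell y1 subrr expr0n add0r lt_def sqr_ge0 sqrf_eq0 andbT.
have pi0 : 0 < (pi : R) := pi_gt0 R.
have [xp|xn] := ltP 0 x.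
  rewrite gt_eqF //; apply: sin_gt0_pi; rewrite !mulr_gt0 ?invr_gt0 //=.
  by move: x1; rewrite ler_norml => /andP[_ x1]; nra.
rewrite -oppr_eq0 -sinN -mulrN gt_eqF //; apply: sin_gt0_pi.
have xn' : 0 < - x by rewrite oppr_gt0 lt_neqAle x0.
rewrite !mulr_gt0 ?invr_gt0 //=.
by move: x1; rewrite ler_norml => /andP[x1 _]; nra.
Qed.

Lemma cdom0P s (y : R) : 0 < s < 2 * n -> 0 <= y < 4 -> 0 < cdist (s, y) ->
  cdom N 0 (s, y).
Proof.
move=> /andP[s0 s2] /andP[y0 y4] d; split=> //.
by rewrite /dom_open_part /= /lo /hi /ylo /yhi /= -/n; do !split => //; lra.
Qed.

Lemma cdom1P s (y : R) : - n < s < n -> 0 <= y < 4 -> 0 < cdist (s, y) ->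
  cdom N 1 (s, y).
Proof.
move=> /andP[s0 s2] /andP[y0 y4] d; split=> //.
by rewrite /dom_open_part /= /lo /hi /ylo /yhi /= -/n; do !split => //; lra.
Qed.

Lemma cdom2P s (y : R) : 0 < s < n -> 3 < y < 5 -> cdom N 2 (s, y).
Proof.
move=> /andP[s0 s2] /andP[y3 y5]; have d : 0 < cdist (s, y).
  by apply: cdist_far; apply/eqP => y1; move: y3; rewrite y1; lra.
split; last by rewrite /half_plane /=; lra.
by rewrite /dom_open_part /= /lo /hi /ylo /yhi /= -/n; do !split => //; lra.
Qed.

Lemma cdom3P s (y : R) : - (n / 2) < s < n / 2 -> 3 < y < 5 -> cdom N 3 (s, y).
Proof.
move=> /andP[s0 s2] /andP[y3 y5]; have d : 0 < cdist (s, y).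
  by apply: cdist_far; apply/eqP => y1; move: y3; rewrite y1; lra.
split; last by rewrite /half_plane /=; lra.
by rewrite /dom_open_part /= /lo /hi /ylo /yhi /= -/n; do !split => //; lra.
Qed.

Lemma cdom_capP k b (c x : R) : `|x| < 1 / 2 -> `|c * x| < 1 / 2 ->
  cdom N (cap_chart k b) (c, x + 1).
Proof.
move=> x2 cx2; split.
  by rewrite /dom_open_part /cap_chart ltnNge leq_addr /= addrK.
by move: x2; rewrite ltr_norml /half_plane /= => /andP[? _]; lra.
Qed.

Lemma cap_chart_ge4 k b : (cap_chart k b < 4)%N = false.
Proof. by rewrite ltnNge leq_addr. Qed.

Lemma lft_cap k b u :
  lft (cap_chart k b) u = ((k.*2.+1)%:R + (off b u).1, 1 + (off b u).2).
Proof. by rewrite /lft cap_chart_ge4 cap_chart_odd cap_chart_cap. Qed.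

Lemma cap_par0 k b (c x : R) : (k < N)%N -> x != 0 ->
  `|x| < 1 / 2 -> `|c * x| < 1 / 2 ->
  let P := lft (cap_chart k b) (c, x + 1) in
  cdom N 0 P /\ par (cap_chart k b) (c, x + 1) = par 0 P.
Proof.
move=> kN x0 x2 cx2 P.
have dP : cdom N 0 P.
  have [y [x' [PE y2 x2' yx0]]] : exists y x', [/\ P = (k.*2.+1%:R + x', 1 + y),
      `|y| < 1 / 2, `|x'| < 1 / 2 & (x', 1 + y) <> (0, 1)].
    rewrite /P lft_cap /off /= addrK {P}.
    have ne (z : R) : 1 + z = 1 -> z = 0 by move=> h; lra.
    case: b; [exists x, (c * x) | exists (c * x), x]; split=> //.
      by move=> [_ /ne] /eqP; rewrite (negbTE x0).
    by move=> [/eqP]; rewrite (negbTE x0).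
  rewrite PE; have k1 : (k.*2.+1)%:R + 1 <= 2 * n :> R.
    by rewrite natr1 -natrM ler_nat mul2n -doubleS leq_double.
  have k0 : 1 <= (k.*2.+1)%:R :> R by rewrite -[1]/(1%:R) ler_nat.
  move: y2 (x2'); rewrite !ltr_norml => /andP[? ?] /andP[? ?].
  apply: cdom0P; [apply/andP; split; lra | apply/andP; split; lra |].
  by apply: cdist_in_cell => //; apply: ltW; apply: lt_trans x2' _; lra.
split=> //; apply: (@par_deck 0) => //.
- exact: cap_chart_lt.
- exact: cdom_capP.
- have e1 : (x + 1 == 1) = false by rewrite -subr_eq0 addrK (negbTE x0).
  by rewrite /exc [_.2]/(x + 1) e1 andbF.
- by rewrite deck0.
Qed.

(** Chart 0 contains everything except a few lines. The topological arguments start from this case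
    distinction, and it also reduces the area of the surface to that of chart 0. *)
Lemma chart_cases i u : (i < ncharts N)%N -> cdom N i u ->
  [\/ exists2 v, cdom N 0 v & par i u = par 0 v,
      [/\ u.1 = 0, 0 <= u.2 < 4 & par i u = par 1 (0, u.2)],
      ((i == 2) || (i == 3)) /\ u.2 = 4 |
      (4 <= i)%N /\ u.2 = 1].
Proof.
case: u => s y iN du; have [i4|i4] := ltnP i 4; last first.
  have iE : i = cap_chart (cap i) (odd i).
    rewrite /cap_chart -{1}(subnKC i4) -{1}(odd_double_half (i - 4)).
    by rewrite oddB // addbF.
  have [y1|y1] := eqVneq y 1; first by apply: Or44.
  apply: Or41; have kN := cap_lt i4 iN.
  move: du => [+ _]; rewrite {1}iE /dom_open_part {1}/cap_chart ltnNge leq_addr /= => -[h1 h2].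
  have y0 : y - 1 != 0 by rewrite subr_eq0.
  have [dP e] := cap_par0 (odd i) kN y0 h1 h2; rewrite subrK in e dP.
  by exists (lft (cap_chart (cap i) (odd i)) (s, y)) => //; rewrite {1}iE.
have d0 : 0 <= y by case: du.
have d1 : (lo N i < s /\ s < hi N i) /\ (ylo i < y /\ y < yhi i) /\ 0 < cdist (s, y).
  by case: du => + _; rewrite /dom_open_part i4.
have sh t : (i == 1) || (i == 3) -> y < 4 -> 0 < cdist (t, y) -> s < 0 -> - n < s -> t = s + 2 * n ->
    exists2 v, cdom N 0 v & par i (s, y) = par 0 v.
  move=> i13 y4 cd s0 s1 tE; have d : cdom N 0 (t, y).
    by apply: cdom0P; [rewrite tE; apply/andP; split; lra | rewrite d0 |].
  by exists (t, y) => //; apply: par_shift => //; right; right; rewrite tE; ring.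
have st : y < 4 -> 0 < s < 2 * n -> 0 < cdist (s, y) -> exists2 v, cdom N 0 v & par i (s, y) = par 0 v.
  move=> y4 sn cd; have d : cdom N 0 (s, y) by apply: cdom0P => //; rewrite d0.
  by exists (s, y) => //; apply: par_shift => //; left.
have fl : 4 < y < 5 -> - n < s < n -> exists2 v, cdom N 0 v & par i (s, y) = par 0 v.
  move=> /andP[y4 y5] /andP[s0 s1]; have d : cdom N 0 (s + n, 8 - y).
    apply: cdom0P; [apply/andP; split; lra | apply/andP; split; lra |].
    by apply: cdist_far; apply/eqP => e; lra.
  by exists (s + n, 8 - y) => //; rewrite (par_flip (i := i) (s := s)) //; left.
case: i i4 iN du d1 sh st fl => [|[|[|[|//]]]] _ iN du;
  rewrite /lo /hi /ylo /yhi /= -/n => -[[s0 s1] [[y0 y4] cd]] sh st fl.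
- by apply: Or41; exists (s, y).
- have [sn|sp|se] := ltgtP s 0.
  + apply: Or41; apply: (sh (s + 2 * n)) => //.
    rewrite /cdist /=; have -> : pi / 2 * (s + 2 * n) = pi / 2 * s + (N : int)%:~R * pi.
      by rewrite -[(N : int)%:~R]/n; field.
    by rewrite cosDintpi exprMn cos_intpi_sqr mulr1.
  + by apply: Or41; apply: st => //; apply/andP; split; lra.
  + by apply: Or42; rewrite /= d0 se.
- have [yl|yg|ye] := ltgtP y 4; last by apply: Or43.
  + by apply: Or41; apply: st => //; apply/andP; split; lra.
  + by apply: Or41; apply: fl; apply/andP; split; lra.
- have [yl|yg|ye] := ltgtP y 4; last by apply: Or43.
  + have [sn|sp|se] := ltgtP s 0.
    * apply: Or41; apply: (sh (s + 2 * n)) => //; last by lra.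
      by apply: cdist_far; apply/eqP => e; lra.
    * by apply: Or41; apply: st => //; apply/andP; split; lra.
    * apply: Or42; split; rewrite /= ?d0 //.
      apply: par_shift => //; last by left.
      apply: cdom1P; [apply/andP; split; lra | by rewrite d0 |].
      by apply: cdist_far; apply/eqP => e; lra.
  + by apply: Or41; apply: fl; apply/andP; split; lra.
Qed.

Lemma glued_cases (x : glued a) :
  [\/ exists2 u, cdom N 0 u & x = par 0 u,
      exists2 y, 0 <= y < 4 & x = par 1 (0, y),
      exists i s, [/\ (i == 2) || (i == 3), cdom N i (s, 4) & x = par i (s, 4)] |
      exists k b c, (k < N)%N /\ x = par (cap_chart k b) (c, 1)].
Proof.
have [i iN [[s y] du <-]] := glued_cover x.
case: (chart_cases iN du) => [h|[/= s0 y4 h]|[i23 /= y4]|[i4 /= y1]].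
- exact: Or41.
- by apply: Or42; exists y.
- by apply: Or43; exists i, s; rewrite y4 in du *.
- apply: Or44; exists (cap i), (odd i), s; split; first exact: cap_lt.
  rewrite y1; congr par; rewrite /cap_chart -{1}(subnKC i4) -{1}(odd_double_half (i - 4)).
  by rewrite oddB // addbF.
Qed.

End CrosscapTopology.

Lemma le_or_lt (R : realDomainType) (x y : R) : x <= y \/ y < x.
Proof. by case: leP; [left|right]. Qed.

(** * Compactness of the surface *)

Section CrosscapCompact.
Context {R : realType}.
Variable N : nat.
Hypothesis N0 : (0 < N)%N.
Let n : R := N%:R.
Let n0 : 0 < n. Proof. by rewrite ltr0n. Qed.
Let n1 : 1 <= n. Proof. by rewrite -[1]/(1%:R) ler_nat. Qed.
Implicit Types (u v w P Q : R * R) (i j : nat).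

Local Notation a := (@crosscap_atlas R N N0).
Local Notation par := (gpar a).

Lemma par_compact i (K : set (R * R)) : (i < ncharts N)%N -> compact K ->
  K `<=` cdom N i -> compact (par i @` K).
Proof.
move=> iN cK Kd; apply: continuous_compact => //.
exact: (continuous_subspaceW Kd (@gpar_cont R a i iN)).
Qed.

Lemma exists_cell m (s : R) : (0 < m)%N -> 0 <= s <= 2 * m%:R ->
  exists2 k, (k < m)%N & 2 * k%:R <= s <= 2 * k%:R + 2.
Proof.
elim: m => // m IH _ /andP[s0 sm].
have [m0|m0] := posnP m.
  by exists 0%N => //; move: sm; rewrite m0 mulr0 s0 mulr1 add0r.
have [sm'|sm'] := leP s (2 * m%:R).
  by have [|k km ks] := IH m0; [rewrite s0|exists k => //; exact: ltnW].
have e : m.+1%:R = m%:R + 1 :> R by rewrite -natr1.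
by exists m => //; rewrite e in sm; rewrite -/n; apply/andP; split; lra.
Qed.

Definition rect (x0 x1 y0 y1 : R) : set (R * R) := `[x0, x1] `*` `[y0, y1].

Lemma rect_compact x0 x1 y0 y1 : compact (rect x0 x1 y0 y1).
Proof. by apply: compact_setX; exact: segment_compact. Qed.

(** A compact part of a cell inside [cdom N 0]. The open square around the blown-up point is left to
    the crosscap charts, the margins of width [1 / 2] at both ends of the window to chart 1, and the
    heights above [7 / 2] to charts 2 and 3. *)
Definition cell_piece (k : nat) : set (R * R) :=
  rect (Num.max (2 * k%:R) (1 / 2)) (Num.min (2 * k%:R + 2) (2 * n - 1 / 2)) 0 (7 / 2)
  `&` ~` [set u | `|u.1 - (k.*2.+1)%:R| < 1 / 4 /\ `|u.2 - 1| < 1 / 4].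

Lemma cell_piece_compact k : compact (cell_piece k).
Proof.
apply: compact_closedI; first exact: rect_compact.
have o1 : open [set u : R * R | `|u.1 - (k.*2.+1)%:R| < 1 / 4].
  apply: open_ltf => u; last exact: cvg_cst.
  by apply: cvg_norm; apply: cvgB; [exact: cvg_fst | exact: cvg_cst].
have o2 : open [set u : R * R | `|u.2 - 1| < 1 / 4].
  apply: open_ltf => u; last exact: cvg_cst.
  by apply: cvg_norm; apply: cvgB; [exact: cvg_snd | exact: cvg_cst].
exact: open_closedC (openI o1 o2).
Qed.

Lemma cell_piece_sub k : (k < N)%N -> cell_piece k `<=` cdom N 0.
Proof.
have n1' : 1 <= n := n1.
move=> kN [s y] [[/=]]; rewrite !in_itv /= ge_max le_min.
move=> /andP[/andP[s1 s2] /andP[s3 s4]] /andP[y0 y1] far.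
apply: cdom0P; [rewrite -/n; apply/andP; split; lra | rewrite -/n; apply/andP; split; lra |].
rewrite -[s](subrK (k.*2.+1)%:R) addrC; apply: cdist_in_cell.
  by rewrite odd_natr ler_norml; rewrite -/n; apply/andP; split; lra.
move=> [e1 e2]; apply: far; rewrite e1 e2 subrr normr0; split; lra.
Qed.

Lemma cap_rect_sub k b : rect (-1) 1 (3 / 4) (5 / 4) `<=` cdom N (cap_chart k b).
Proof.
move=> [c y] [/=]; rewrite !in_itv /= => /andP[c0 c1] /andP[y0 y1].
rewrite -[y](subrK 1).
have h : `|y - 1| <= 1 / 4 by rewrite ler_norml; rewrite -/n; apply/andP; split; lra.
apply: cdom_capP; first by apply: le_lt_trans h _; lra.
have c1' : `|c| <= 1 by rewrite ler_norml c0 c1.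
by rewrite normrM; apply: le_lt_trans (ler_pM _ _ c1' h) _ => //; lra.
Qed.

Lemma exc_flip k b (c : R) : (k < N)%N -> c != 0 ->
  par (cap_chart k b) (c, 1) = par (cap_chart k (~~ b)) (c^-1, 1).
Proof.
move=> kN c0.
have d b' c' : cdom N (cap_chart k b') (c', 1).
  by rewrite -[1](add0r 1); apply: cdom_capP; rewrite ?mulr0 normr0; lra.
apply/par_eq => //; try exact: cap_chart_lt; try exact: d.
have ex b' c' : exc (cap_chart k b') (c', 1 : R) by rewrite /exc leq_addr /= eqxx.
rewrite /cpar !lft_exc // !cap_chart_cap; congr pair.
rewrite /tag !ex !cap_chart_odd /=; case: b => /=; first by rewrite (negbTE c0).
by rewrite invr_eq0 (negbTE c0) invrK.
Qed.

Lemma crosscap_compact : compact [set: glued a].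
Proof.
have n1' : 1 <= n := n1.
pose F k := par 0 @` cell_piece k `|`
  (par (cap_chart k false) @` rect (-1) 1 (3 / 4) (5 / 4) `|`
   par (cap_chart k true) @` rect (-1) 1 (3 / 4) (5 / 4)).
(* Around the core the abscissa counts modulo [n], and the rectangles of charts 2 and 3 take half of
   its period each. *)
pose S := par 1 @` rect (- (1 / 2)) (1 / 2) 0 (7 / 2) `|`
  (par 2 @` rect (n / 4) (3 * n / 4) (7 / 2) (9 / 2) `|`
   (par 3 @` rect (- (n / 4)) (n / 4) (7 / 2) (9 / 2) `|` \bigcup_(k < N) F k)).
have itv (x y z : R) : (x \in `[y, z]) = (y <= x <= z) by rewrite in_itv.
have inS x : S x.
  have [[[s y] du ->]|[y y4 ->]|[i [s [i23 ds ->]]]|[k [b [c [kN ->]]]]] := glued_cases x.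
  - move: (du) => [[[+ +] [[_ +] cd]] +].
    rewrite /lo /hi /yhi /half_plane /= -/n => s0 s1 y4 y0.
    have [yl|yh] := le_or_lt y (7 / 2).
      have [sl|sh] := le_or_lt s (1 / 2).
        left; exists (s, y); first by split; rewrite /= itv; rewrite -/n; apply/andP; split; lra.
        apply: par_shift => //; last by left.
        by apply: cdom1P => //; rewrite -/n; apply/andP; split; lra.
      have [sr|sr] := le_or_lt (2 * n - 1 / 2) s.
        left; exists (s - 2 * n, y); first by split; rewrite /= itv; rewrite -/n; apply/andP; split; lra.
        apply: par_shift => //; last by right; right.
        apply: cdom1P => //; [rewrite -/n; apply/andP; split; lra | rewrite -/n; apply/andP; split; lra |].
        rewrite /cdist /=; have -> : pi / 2 * (s - 2 * n) = pi / 2 * s + (- (N : int))%:~R * pi.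
          by rewrite mulrNz -[(N : int)%:~R]/n; field.
        by rewrite cosDintpi exprMn cos_intpi_sqr mulr1.
      right; right; right.
      have [|k kN /andP[ks1 ks2]] := @exists_cell N s N0; first by rewrite -/n; apply/andP; split; lra.
      exists k => //.
      have [near_|far] := pselect (`|s - (k.*2.+1)%:R| < 1 / 4 /\ `|y - 1| < 1 / 4); last first.
        left; exists (s, y) => //; split=> //; split; rewrite /= itv.
          by rewrite ge_max le_min; apply/andP; split; rewrite -/n; apply/andP; split; lra.
        by rewrite -/n; apply/andP; split; lra.
      right; set X := s - _ in near_; set Y := y - 1 in near_; have [X4 Y4] := near_.
      have sE : s = (k.*2.+1)%:R + X by rewrite /X addrC subrK.
      have yE : y = 1 + Y by rewrite /Y addrC subrK.
      have cell (b : bool) (c z : R) : `|c| <= 1 -> `|z| < 1 / 4 -> z != 0 ->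
          (if b then X = c * z /\ Y = z else X = z /\ Y = c * z) ->
          (par (cap_chart k b) @` rect (-1) 1 (3 / 4) (5 / 4)) (par 0 (s, y)).
        move=> c1 z4 z0 XY; exists (c, z + 1).
          split; rewrite /= itv -?ler_norml //.
          by move: z4; rewrite ltr_norml => /andP[? ?]; rewrite -/n; apply/andP; split; lra.
        have z2 : `|z| < 1 / 2 by apply: lt_trans z4 _; lra.
        have cz2 : `|c * z| < 1 / 2.
          by rewrite normrM; apply: le_lt_trans z2; rewrite -[leRHS]mul1r ler_wpM2r.
        have [_ ->] := cap_par0 N0 b kN z0 z2 cz2; congr (par 0 _).
        rewrite lft_cap /off /= addrK sE yE.
        by case: b XY => -[-> ->].
      (* Of the two crosscap charts, the one is used whose slope coordinate is at most 1 in absolute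
         value. *)
      have [YX|XY] := le_or_lt `|Y| `|X|.
        have X0 : X != 0.
          apply/eqP => X0; move: YX; rewrite X0 normr0 normr_le0 => /eqP Y0.
          move: cd; rewrite sE yE cdist_cell X0 Y0 addr0 subrr mulr0 sin0 expr0n addr0.
          by rewrite ltxx.
        left; apply: (cell false (Y / X) X) => //; last by rewrite divfK.
        by rewrite normrM normfV ler_pdivrMr ?normr_gt0 // mul1r.
      have Y0 : Y != 0 by rewrite -normr_gt0; apply: le_lt_trans XY.
      right; apply: (cell true (X / Y) Y) => //; last by rewrite divfK.
      by rewrite normrM normfV ler_pdivrMr ?normr_gt0 // mul1r ltW.
    have [s1'|s1'] := le_or_lt s (n / 4).
      right; right; left; exists (s, y); first by split; rewrite /= itv; rewrite -/n; apply/andP; split; lra.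
      apply: par_shift => //; last by left.
      by apply: cdom3P => //; rewrite -/n; apply/andP; split; lra.
    have [s2|s2] := le_or_lt s (3 * n / 4).
      right; left; exists (s, y); first by split; rewrite /= itv; rewrite -/n; apply/andP; split; lra.
      apply: par_shift => //; last by left.
      by apply: cdom2P => //; rewrite -/n; apply/andP; split; lra.
    have [s3|s3] := le_or_lt s (5 * n / 4).
      right; right; left; exists (s - n, 8 - y); first by split; rewrite /= itv; rewrite -/n; apply/andP; split; lra.
      apply: par_flip => //; last by right.
      by apply: cdom3P => //; rewrite -/n; apply/andP; split; lra.
    have [s4|s4] := le_or_lt s (7 * n / 4).
      right; left; exists (s - n, 8 - y); first by split; rewrite /= itv; rewrite -/n; apply/andP; split; lra.
      apply: par_flip => //; last by right.
      by apply: cdom2P => //; rewrite -/n; apply/andP; split; lra.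
    right; right; left; exists (s - 2 * n, y); first by split; rewrite /= itv; rewrite -/n; apply/andP; split; lra.
    apply: par_shift => //; last by right; right.
    by apply: cdom3P => //; rewrite -/n; apply/andP; split; lra.
  - have /andP[y0 y4'] := y4; have [yl|yh] := le_or_lt y (7 / 2).
      by left; exists (0, y) => //; split; rewrite /= itv; rewrite -/n; apply/andP; split; lra.
    right; right; left; exists (0, y); first by split; rewrite /= itv; rewrite -/n; apply/andP; split; lra.
    apply: par_shift => //; last by left.
      apply: cdom1P; [rewrite -/n; apply/andP; split; lra | exact: y4|].
      by apply: cdist_far; apply/eqP => e; lra.
    by apply: cdom3P => //; rewrite -/n; apply/andP; split; lra.
  - case/orP: i23 ds => /eqP -> [[[]]]; rewrite /lo /hi /= -/n => s0 s1 _ _.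
      have d : cdom N 2 (s, 4) by apply: cdom2P; rewrite -/n; apply/andP; split; lra.
      have [sl|sr] := le_or_lt s (n / 4).
        right; right; left; exists (s, 4); first by split; rewrite /= itv; rewrite -/n; apply/andP; split; lra.
        by apply: par_shift => //; [apply: cdom3P; rewrite -/n; apply/andP; split; lra | left].
      have [sl'|sr'] := le_or_lt s (3 * n / 4).
        by right; left; exists (s, 4) => //; split; rewrite /= itv; rewrite -/n; apply/andP; split; lra.
      right; right; left; exists (s - n, 8 - 4); first by split; rewrite /= itv; rewrite -/n; apply/andP; split; lra.
      by apply: par_flip => //; [apply: cdom3P; rewrite -/n; apply/andP; split; lra | right].
    have d : cdom N 3 (s, 4) by apply: cdom3P; rewrite -/n; apply/andP; split; lra.
    have [sl|sr] := le_or_lt s (- (n / 4)).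
      right; left; exists (s + n, 8 - 4); first by split; rewrite /= itv; rewrite -/n; apply/andP; split; lra.
      by apply: par_flip => //; [apply: cdom2P; rewrite -/n; apply/andP; split; lra | left].
    have [sl'|sr'] := le_or_lt s (n / 4).
      by right; right; left; exists (s, 4) => //; split; rewrite /= itv; rewrite -/n; apply/andP; split; lra.
    right; left; exists (s, 4); first by split; rewrite /= itv; rewrite -/n; apply/andP; split; lra.
    by apply: par_shift => //; [apply: cdom2P; rewrite -/n; apply/andP; split; lra | left].
  - right; right; right; exists k => //; right.
    have [c1|c1] := le_or_lt `|c| 1.
      by case: b; [right|left]; exists (c, 1) => //; split; rewrite /= itv -?ler_norml //;
        rewrite -/n; apply/andP; split; lra.
    have c0 : c != 0 by rewrite -normr_gt0 (lt_trans _ c1).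
    have h : rect (-1) 1 (3 / 4) (5 / 4) (c^-1, 1).
      split; rewrite /= itv; last by rewrite -/n; apply/andP; split; lra.
      by rewrite -ler_norml normfV invf_le1 ?normr_gt0 // ltW.
    by rewrite exc_flip //; case: b; [left|right]; exists (c^-1, 1).
have -> : [set: glued a] = S by apply/seteqP; split=> // x _; exact: inS.
rewrite /S bigcup_mkord.
apply: compactU; first apply: par_compact => //; first exact: rect_compact.
  move=> [s y] [/=]; rewrite !itv => /andP[s0 s1] /andP[y0 y1].
  apply: cdom1P; [rewrite -/n; apply/andP; split; lra | rewrite -/n; apply/andP; split; lra |].
  rewrite /cdist /=; apply: ltr_wpDl; first exact: sqr_ge0.
  rewrite exprn_gt0 //; apply: cos_gt0_pihalf; have := pi_gt0 R => pi0.
  by apply/andP; split; nra.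
apply: compactU; first apply: par_compact => //; first exact: rect_compact.
  move=> [s y] [/=]; rewrite !itv => /andP[s0 s1] /andP[y0 y1].
  by apply: cdom2P; rewrite -/n; apply/andP; split; lra.
apply: compactU; first apply: par_compact => //; first exact: rect_compact.
  move=> [s y] [/=]; rewrite !itv => /andP[s0 s1] /andP[y0 y1].
  by apply: cdom3P; rewrite -/n; apply/andP; split; lra.
apply: bigsetU_compact => -[k kN] _ /=.
apply: compactU; first apply: par_compact => //.
- exact: cell_piece_compact.
- exact: cell_piece_sub.
apply: compactU; apply: par_compact => //; try exact: cap_chart_lt;
  try exact: rect_compact; exact: cap_rect_sub.
Qed.

End CrosscapCompact.

Lemma continuous_pair (X Y Z : topologicalType) (f : X -> Y) (g : X -> Z) :
  continuous f -> continuous g -> continuous (fun x => (f x, g x)).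
Proof.
move=> cf cg x; apply: (@cvg_pair _ _ _ (nbhs x) (nbhs (f x)) (nbhs (g x))).
  exact: cf.
exact: cg.
Qed.

(** * Separation of points *)

Section CrosscapHausdorff.
Context {R : realType}.
Variable N : nat.
Hypothesis N0 : (0 < N)%N.
Let n : R := N%:R.
Let n0 : 0 < n. Proof. by rewrite ltr0n. Qed.
Let n1 : 1 <= n. Proof. by rewrite -[1]/(1%:R) ler_nat. Qed.
Implicit Types (u v w P Q : R * R) (i j : nat).

Local Notation a := (@crosscap_atlas R N N0).
Local Notation par := (gpar a).

Lemma lft_cont i : continuous (@lft R i).
Proof.
have oT : open [set: R * R] := openT.
have [c1 c2] := lft_Cinf i oT.
have cont (f : R * R -> R) : Cinf setT f -> continuous f.
  by move=> cf w; have [df _] := cf 1%N; exact/differentiable_continuous/df.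
have -> : @lft R i = fun v => ((lft i v).1, (lft i v).2).
  by apply/funext => v; rewrite -surjective_pairing.
by apply: continuous_pair; exact: cont.
Qed.

Lemma orbit_inv_cont : continuous (@orbit_inv R N).
Proof.
have ca : continuous (fun v : R * R => ang N v).
  by move=> u; apply: cvgM; [exact: cvg_cst | exact: cvg_fst].
have ca2 : continuous (fun v : R * R => 2 * ang N v).
  by move=> u; apply: cvgM; [exact: cvg_cst | exact: ca].
have cy : continuous (fun v : R * R => 4 - v.2).
  by move=> u; apply: cvgB; [exact: cvg_cst | exact: cvg_snd].
have cc f : continuous f -> continuous (fun v : R * R => cos (f v : R)).
  by move=> cf u; apply: (cvg_comp _ _ (cf u)); exact: continuous_cos.
have cs f : continuous f -> continuous (fun v : R * R => sin (f v : R)).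
  by move=> cf u; apply: (cvg_comp _ _ (cf u)); exact: continuous_sin.
apply: continuous_pair; apply: continuous_pair.
- exact: cc.
- exact: cs.
- by move=> u; apply: cvgM; [exact: cy | exact: cc].
- by move=> u; apply: cvgM; [exact: cy | exact: cs].
Qed.

(** The global blow-down, a continuous map into [R^4]. It separates any two points that do not lie
    on a common crosscap. *)
Definition orbit_of (x : glued a) : (R * R) * (R * R) := (sval x).1.

Lemma orbit_of_par i u : (i < ncharts N)%N -> cdom N i u ->
  orbit_of (par i u) = orbit_inv N (lft i u).
Proof. by move=> iN du; rewrite /orbit_of (sval_gpar (a := a)). Qed.

Lemma orbit_of_open (B : set ((R * R) * (R * R))) : open B -> open (orbit_of @^-1` B).
Proof.
move=> oB; apply/glued_openP => i u iN du.
rewrite /preimage /= orbit_of_par // => Bu.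
have c : {for u, continuous (orbit_inv N \o @lft R i)}.
  by apply: continuous_comp; [exact: lft_cont | exact: orbit_inv_cont].
have : \forall w \near u, B (orbit_inv N (lft i w)).
  by apply: c; exact: (open_nbhs_nbhs (conj oB Bu)).
by apply: filterS => w Bw dw; rewrite orbit_of_par.
Qed.

Lemma cap_dom_center k b (c : R) : cdom N (cap_chart k b) (c, 1).
Proof. by rewrite -[1](add0r 1); apply: cdom_capP; rewrite ?mulr0 normr0; lra. Qed.

Lemma regular_orbit_neq_center i u k : (i < 4)%N -> cdom N i u ->
  orbit_inv N u <> orbit_inv N (center k).
Proof.
move=> i4 du /esym /(orbit_inv_inj N0)[d uE].
have [_ u5] := lft_range du; rewrite /lft i4 in u5.
have : 0 < cdist u by case: du; rewrite /dom_open_part i4 => -[_ []].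
rewrite uE /cdist /deck /center /= -/n.
(* An odd [d] would put the centre at height 7, outside the strip charts. An even one keeps the
   height 1 and moves the abscissa by an even integer, so [cdist] vanishes at the image. *)
have [e1|e1] := cos_intpi (R := R) d; last by move: u5; rewrite uE /= e1; lra.
have [j jE] : exists j : int, d%:~R * pi = 0 + j%:~R * (2 * pi) :> R.
  by apply: cos_sin_eq; rewrite ?cos0 ?sin0 ?e1 ?sin_intpi.
have dE : d%:~R = 2 * j%:~R :> R.
  by apply: (mulIf (_ : pi != 0 :> R)); rewrite ?gt_eqF ?pi_gt0 // jE; ring.
rewrite e1 dE; have -> : 4 + 1 * (1 - 4) - 1 = 0 :> R by ring.
have -> : pi / 2 * ((k.*2.+1)%:R + 2 * j%:~R * n) = pi / 2 * ((k.*2.+1)%:R + 0) + (j * (N : int))%:~R * pi :> R.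
  by rewrite intrM -[(N : int)%:~R]/n; field.
rewrite cosDintpi exprMn cos_intpi_sqr mulr1.
have := cdist_cell k (0 : R) 1; rewrite /cdist /= => h.
by rewrite expr0n; move: h; rewrite subrr expr0n !add0r mulr0 sin0 expr0n => ->; rewrite ltxx.
Qed.

Lemma regular_or_exc (x : glued a) :
  (exists i u, [/\ (i < 4)%N, cdom N i u & x = par i u]) \/
  exists k b c, (k < N)%N /\ x = par (cap_chart k b) (c, 1).
Proof.
have n0' := n0.
have [[u du ->]|[y y4 ->]|[i [s [i23 ds ->]]]|] := glued_cases x; [left|left|left|by right].
- by exists 0%N, u.
- have [y1|y1] := eqVneq y 1.
    exists 1%N, (0, y); split=> //; apply: cdom1P => //; first by rewrite -/n; apply/andP; split; lra.
    by rewrite /cdist /= mulr0 cos0 expr1n; apply: ltr_wpDl => //; exact: sqr_ge0.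
  exists 1%N, (0, y); split=> //; apply: cdom1P => //; last exact: cdist_far.
  by rewrite -/n; apply/andP; split; lra.
- by exists i, (s, 4); split=> //; case/orP: i23 => /eqP ->.
Qed.

Lemma crosscap_hausdorff : hausdorff_space (glued a).
Proof.
suff H (x y : glued a) : x <> y ->
    exists2 AB : set (glued a) * set (glued a), AB.1 x /\ AB.2 y &
      [/\ open AB.1, open AB.2 & AB.1 `&` AB.2 = set0].
  rewrite open_hausdorff => x y /eqP/H[AB [Ax By] [oA oB AB0]].
  by exists AB; [rewrite !inE | split=> //; apply/eqP].
move=> xy; have [E|/eqP E] := pselect (orbit_of x = orbit_of y); last first.
  have := @norm_hausdorff R ((R * R) * (R * R))%type; rewrite open_hausdorff => /(_ _ _ E).
  move=> [[A B] /= [/set_mem Ax /set_mem By] [oA oB /eqP AB]].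
  exists (orbit_of @^-1` A, orbit_of @^-1` B) => //=.
  by split; [exact: orbit_of_open | exact: orbit_of_open | rewrite -preimage_setI AB preimage_set0].
have lc k b (c : R) : lft (cap_chart k b) (c, 1) = center k.
  by rewrite lft_exc ?cap_chart_cap // /exc leq_addr /= eqxx.
have sm i : (i < 4)%N -> (i < ncharts N)%N := @small_ncharts N i.
case: (regular_or_exc x) (regular_or_exc y) xy E
    => [[i [u [i4 du ->]]]|[k [b [c [kN ->]]]]] [[j [v [j4 dv ->]]]|[l [b' [c' [lN ->]]]]] xy.
- move=> E; exfalso; apply: xy; apply/par_eq; rewrite ?sm //.
  move: E; rewrite !orbit_of_par ?sm // => E.
  by rewrite /cpar E /tag /exc [(4 <= i)%N]leqNgt i4 [(4 <= j)%N]leqNgt j4.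
- rewrite (orbit_of_par (sm _ i4) du) orbit_of_par ?cap_chart_lt //; last exact: cap_dom_center.
  by rewrite lc /lft i4 => /(regular_orbit_neq_center i4 du).
- rewrite (orbit_of_par (sm _ j4) dv) orbit_of_par ?cap_chart_lt //; last exact: cap_dom_center.
  by rewrite lc /lft j4 => /esym /(regular_orbit_neq_center j4 dv).
rewrite !orbit_of_par ?cap_chart_lt //; try exact: cap_dom_center.
rewrite !lc => /(center_orbit N0 kN lN) kl; rewrite -kl in xy *.
have same d (e e' : R) : par (cap_chart k d) (e, 1) <> par (cap_chart k d) (e', 1) ->
    exists2 AB : set (glued a) * set (glued a),
      AB.1 (par (cap_chart k d) (e, 1)) /\ AB.2 (par (cap_chart k d) (e', 1)) &
      [/\ open AB.1, open AB.2 & AB.1 `&` AB.2 = set0].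
  move=> ee; apply: (@gpar_separated R a); [exact: cap_chart_lt|exact: cap_dom_center|exact: cap_dom_center|].
  by move=> h; apply: ee; rewrite h.
have [bb|bb] := eqVneq b b'; first by rewrite bb in xy *; exact: same.
have b'E : b' = ~~ b by move: bb; clear; case: b; case: b'.
have [c0|c0] := eqVneq c 0; last first.
  by move: xy; rewrite exc_flip // b'E; exact: same.
have [c'0|c'0] := eqVneq c' 0; last first.
  by move: xy; rewrite [par (cap_chart k b') _]exc_flip // b'E negbK; exact: same.
have oV : open [set u : R * R | `|u.1| < 1].
  by apply: open_ltf => u; [apply: cvg_norm; exact: cvg_fst | exact: cvg_cst].
have iN d : (cap_chart k d < ncharts N)%N by exact: cap_chart_lt.
(* What remains are the directions of the two axes, each with slope coordinate 0 in its own chart.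
   The parts of the two charts with slope coordinate below 1 in absolute value are disjoint, because
   at a common point these coordinates would be inverse to each other. *)
exists (par (cap_chart k b) @` (cdom N (cap_chart k b) `&` [set u | `|u.1| < 1]),
        par (cap_chart k b') @` (cdom N (cap_chart k b') `&` [set u | `|u.1| < 1])) => /=.
  split; [exists (c, 1) | exists (c', 1)] => //; split; try exact: cap_dom_center.
  - by rewrite /= c0 normr0.
  - by rewrite /= c'0 normr0.
split; [exact: (@gpar_open R a) | exact: (@gpar_open R a) |].
apply/seteqP; split=> // _ [[[e z] [de e1] <-] [[e' z'] [de' e'1]]].
rewrite /= in e1 e'1.
move=> /(par_eq N0 (iN b') (iN b) de' de) E; have X := cpar_exc E.
have ee : e * e' <> 1.
  move=> h; have : `|e * e'| < 1.
    by rewrite normrM; apply: mulr_ilt1.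
  by rewrite h normr1 ltxx.
have [z1|z1] := boolP (exc (cap_chart k b) (e, z)); last first.
  have z'1 : ~~ exc (cap_chart k b') (e', z') by rewrite X.
  move: z1 z'1; rewrite /exc !leq_addr /= => z1 z'1.
  have cz (f w : R) d : cdom N (cap_chart k d) (f, w) -> `|w - 1| < 1 / 2 /\ `|f * (w - 1)| < 1 / 2.
    by move=> [+ _]; rewrite /dom_open_part cap_chart_ge4.
  rewrite -subr_eq0 in z1; rewrite -subr_eq0 in z'1.
  have [h1 h2] := cz _ _ _ de; have [h3 h4] := cz _ _ _ de'.
  have [dP E1] := cap_par0 N0 b kN z1 h1 h2.
  have [dP' E2] := cap_par0 N0 b' kN z'1 h3 h4.
  rewrite subrK in dP E1; rewrite subrK in dP' E2.
  move/(par_eq N0 (iN b') (iN b) de' de): E; rewrite E1 E2.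
  move=> /(par_eq N0 (sm 0%N isT) (sm 0%N isT) dP' dP) /(cpar_inj N0 dP' dP).
  have assoc : e * e' * (z - 1) = e' * (e * (z - 1)) by ring.
  rewrite !lft_cap b'E /off /=; case: (b) => /= -[/addrI p /addrI q].
    by apply: ee; apply: (mulIf z1); rewrite mul1r assoc -p q.
  by apply: ee; apply: (mulIf z1); rewrite mul1r assoc -q p.
move: E => /pair_equal_spec[_]; rewrite /tag X z1 !cap_chart_odd b'E /=.
case: (b) => /= -[].
  by case: eqVneq => // e0 [h]; apply: ee; rewrite h mulfV.
by case: eqVneq => // e0 [h]; apply: ee; rewrite -h mulVf.
Qed.

End CrosscapHausdorff.

Lemma locally_constant_connected (T : topologicalType) (D C : set T) (o : T -> bool) :
  open D -> (forall x, D x -> \forall y \near x, o y = o x) ->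
  connected C -> C `<=` D -> forall x y, C x -> C y -> o x = o y.
Proof.
move=> oD lo cC CD x y Cx Cy.
have oc b : open [set z | D z /\ o z = b].
  rewrite openE => z [Dz ozb]; rewrite /interior.
  apply: filterS2 (open_nbhs_nbhs (conj oD Dz)) (lo z Dz) => w Dw ow.
  by split=> //; rewrite ow.
have E : C `&` [set z | D z /\ o z = o x] = C.
  apply: cC.
  - by exists x; split=> //; split=> //; exact: CD.
  - by exists [set z | D z /\ o z = o x].
  exists (~` [set z | D z /\ o z = ~~ o x]); first by apply: open_closedC.
  apply/seteqP; split=> z [Cz].
    by move=> [_ oz]; split=> // -[_]; rewrite oz; case: (o x).
  move=> h; split=> //; split; first exact: CD.
  by apply/eqP; apply: contraT => /eqP ne; exfalso; apply: h; split;
    [exact: CD | move: ne; case: (o z); case: (o x)].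
by have [_ [_ ->]] : (C `&` [set z | D z /\ o z = o x]) y by rewrite E.
Qed.

(** * Connectedness of the surface *)

Section CrosscapConnected.
Context {R : realType}.
Variable N : nat.
Hypothesis N0 : (0 < N)%N.
Let n : R := N%:R.
Let n0 : 0 < n. Proof. by rewrite ltr0n. Qed.
Let n1 : 1 <= n. Proof. by rewrite -[1]/(1%:R) ler_nat. Qed.
Implicit Types (u v w P Q : R * R) (i j : nat).

Local Notation a := (@crosscap_atlas R N N0).
Local Notation par := (gpar a).

Lemma path_connected i (f : R -> R * R) (x y : R) : (i < ncharts N)%N ->
  continuous f -> (forall t, x <= t <= y -> cdom N i (f t)) ->
  connected ((par i \o f) @` `[x, y]).
Proof.
move=> iN cf fd; rewrite -image_comp; apply: connected_continuous_connected.
  apply: connected_continuous_connected; first exact: segment_connected.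
  exact: continuous_subspaceT.
apply: (@continuous_subspaceW _ _ _ (cdom N i)).
  by move=> _ [t + <-]; rewrite /= in_itv => /fd.
exact: (@gpar_cont R a).
Qed.

Let cc (x y : glued a) := connected_component setT x y.

Let path_cc i (f : R -> R * R) (x y : R) : (i < ncharts N)%N -> x <= y ->
  continuous f -> (forall t, x <= t <= y -> cdom N i (f t)) ->
  cc (par i (f x)) (par i (f y)).
Proof.
move=> iN xy cf fd; have cP := path_connected iN cf fd.
have inx : ((par i \o f) @` `[x, y]) (par i (f x)) by exists x; rewrite //= in_itv /= lexx.
by apply: (connected_component_max inx _ cP) => //; exists y; rewrite //= in_itv /= lexx xy.
Qed.

Let hor i (s t y : R) : (i < ncharts N)%N ->
  (forall r, Num.min s t <= r <= Num.max s t -> cdom N i (r, y)) ->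
  cc (par i (s, y)) (par i (t, y)).
Proof.
move=> iN; have cf : continuous (fun r : R => (r, y)).
  by apply: continuous_pair => r; [exact: cvg_id | exact: cvg_cst].
have [st|ts] := leP s t => h; first exact: (path_cc iN st cf).
by apply: connected_component_sym; exact: (path_cc iN (ltW ts) cf).
Qed.

Let ver i (s y z : R) : (i < ncharts N)%N ->
  (forall r, Num.min y z <= r <= Num.max y z -> cdom N i (s, r)) ->
  cc (par i (s, y)) (par i (s, z)).
Proof.
move=> iN; have cf : continuous (fun r : R => (s, r)).
  by apply: continuous_pair => r; [exact: cvg_cst | exact: cvg_id].
have [st|ts] := leP y z => h; first exact: (path_cc iN st cf).
by apply: connected_component_sym; exact: (path_cc iN (ltW ts) cf).
Qed.

Let ic i : (i < 4)%N -> (i < ncharts N)%N := @small_ncharts N i.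

Let base := par 0 (n, 3).

Lemma crosscap_connected_base (x : glued a) : cc x base.
Proof.
have n0' := n0; have n1' := n1.
have trans (y z t : glued a) : cc y z -> cc z t -> cc y t := @connected_component_trans _ _ z y t.
have b0 (s y : R) : cdom N 0 (s, y) -> cc (par 0 (s, y)) base.
  move=> d.
  have H3 (r : R) : 0 < r < 2 * n -> cdom N 0 (r, 3).
    by move=> r0; apply: cdom0P => //; [apply/andP; split; lra | apply: cdist_far; apply/eqP => e; lra].
  have hor3 (r : R) : 0 < r < 2 * n -> cc (par 0 (r, 3)) base.
    move=> /andP[r0 r2]; apply: hor; first exact: ic.
    move=> t /andP[t1 t2]; apply: H3; apply/andP; split.
      by apply: lt_le_trans t1; rewrite lt_min r0 n0.
    by apply: le_lt_trans t2 _; rewrite gt_max r2 /=; lra.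
  move: (d) => [[[+ +] [[_ +] cd]] +].
  rewrite /lo /hi /yhi /half_plane /= -/n => s0 s2 y4 y0.
  have vert (t z : R) : 0 < t < 2 * n -> 0 <= z < 4 ->
      (1 < z \/ cos (pi / 2 * t) != 0) -> cc (par 0 (t, z)) base.
    move=> t0 z0 zt; apply: (trans _ (par 0 (t, 3))); last exact: hor3.
    apply: ver; first exact: ic.
    move=> r /andP[r1 r2]; have /andP[z00 z04] := z0; apply: cdom0P => //.
      apply/andP; split; first by apply: le_trans r1; rewrite le_min z00; lra.
      by apply: le_lt_trans r2 _; rewrite gt_max z04; lra.
    case: zt => [z1|c0].
      apply: cdist_far; rewrite gt_eqF //; apply: lt_le_trans r1.
      by rewrite lt_min z1; lra.
    rewrite /cdist /=; apply: ltr_wpDl; first exact: sqr_ge0.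
    by rewrite lt_def sqr_ge0 sqrf_eq0 c0.
  (* A vertical segment that starts below a blown-up point would run into the puncture; such a point
     is first moved sideways along its own height. *)
  have [c0|c0] := eqVneq (cos (pi / 2 * s)) 0; last first.
    by apply: vert; [rewrite s0 | rewrite y0 | right].
  have [y1|y1] := ltP 1 y; first by apply: vert; [rewrite s0 | rewrite y0 | left].
  have y1' : y != 1.
    by apply: contraTneq cd => ->; rewrite /cdist /= c0 subrr expr0n addr0 ltxx.
  have far (r : R) : 0 < cdist (r, y) by exact: cdist_far.
  have [t [t0 t1 ct]] : exists t : R, [/\ 0 < t, t < 2 * n & cos (pi / 2 * t) != 0].
    have := pihalf_02 R => /andP[p0 p2]; exists (1 / 2); split; [lra|lra|].
    have := pi_gt0 R => pi0.
    rewrite gt_eqF //; apply: cos_gt0_pihalf.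
    by apply/andP; split; nra.
  apply: (trans _ (par 0 (t, y))).
    apply: hor; first exact: ic.
    move=> r /andP[r1 r2]; apply: cdom0P => //; last by rewrite y0.
    apply/andP; split; first by apply: lt_le_trans r1; rewrite lt_min s0 t0.
    by apply: le_lt_trans r2 _; rewrite gt_max s2 t1.
  by apply: vert; [rewrite t0 | rewrite y0 | right].
have [[[s y] du ->]|[y y4 ->]|[i [s [i23 ds ->]]]|[k [b [c [kN ->]]]]] := glued_cases x.
- exact: b0.
- have /andP[y0 y4'] := y4.
  have far s : `|s| < 1 -> 0 < cdist (s, y).
    rewrite ltr_norml => /andP[s0 s1].
    rewrite /cdist /=; apply: ltr_wpDl; first exact: sqr_ge0.
    rewrite exprn_gt0 //; apply: cos_gt0_pihalf; have := pi_gt0 R => pi0.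
    by apply/andP; split; nra.
  have d1 (s : R) : 0 <= s <= 1 / 2 -> cdom N 1 (s, y).
    move=> /andP[s0 s1]; apply: cdom1P => //; first by rewrite -/n; apply/andP; split; lra.
    by apply: far; rewrite ger0_norm //; lra.
  apply: (trans _ (par 1 (1 / 2, y))).
    apply: hor; first exact: ic.
    move=> r; rewrite (min_idPl _) ?(max_idPr _); [exact: d1|lra|lra].
  have d0 : cdom N 0 (1 / 2, y).
    by apply: cdom0P => //; [rewrite -/n; apply/andP; split; lra | apply: far; rewrite ger0_norm; lra].
  rewrite -(par_shift N0 (i := 1) (j := 0) (s := 1 / 2) (t := 1 / 2)) //; first exact: b0.
    by apply: d1; apply/andP; split; lra.
  by left.
- have dE (r : R) : cdom N i (s, r) -> 3 < r < 5.
    by case/orP: i23 => /eqP -> [[_ [/andP]]].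
  have dI (r : R) : 3 < r < 5 -> cdom N i (s, r).
    by case/orP: i23 ds => /eqP -> [[/andP sb _] _]; [apply: cdom2P | apply: cdom3P].
  apply: (trans _ (par i (s, 7 / 2))).
    apply: ver; first by case/orP: i23 => /eqP ->; exact: ic.
    move=> r; rewrite min_r ?max_l; try lra.
    by move=> /andP[r1 r2]; apply: dI; apply/andP; split; lra.
  have i4 : (i < 4)%N by case/orP: i23 => /eqP ->.
  have d7 : cdom N i (s, 7 / 2) by apply: dI; apply/andP; split; lra.
  have far t : 0 < cdist (t, 7 / 2 : R) by apply: cdist_far; apply/eqP => e; lra.
  have sb : - (n / 2) < s < n.
    by case/orP: i23 ds => /eqP -> [[[]]]; rewrite /lo /hi /= -/n => s0 s1 _ _; apply/andP; split; lra.
  have /andP[sb1 sb2] := sb.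
  have [sn|sp] := ltP s (1 / 2); last first.
    rewrite -(par_shift N0 (i := i) (j := 0) (s := s) (t := s)) //; last by left.
      by apply: b0; apply: cdom0P => //; rewrite -/n; apply/andP; split; lra.
    by apply: cdom0P => //; rewrite -/n; apply/andP; split; lra.
  have d1 (t : R) : - (n / 2) < t < n -> cdom N 1 (t, 7 / 2).
    by move=> /andP[t0 t1]; apply: cdom1P => //; rewrite -/n; apply/andP; split; lra.
  have half0 : cdom N 0 (1 / 2 : R, 7 / 2).
    by apply: cdom0P => //; rewrite -/n; apply/andP; split; lra.
  rewrite -(par_shift N0 (i := i) (j := 1) (s := s) (t := s)) //; [|exact: d1|by left].
  apply: (trans _ (par 1 (1 / 2, 7 / 2))).
    apply: hor; first exact: ic.
    move=> r; rewrite min_l ?max_r; try lra.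
    by move=> /andP[r1 r2]; apply: d1; apply/andP; split; lra.
  rewrite -(par_shift N0 (i := 1) (j := 0) (s := 1 / 2) (t := 1 / 2)) //; [exact: b0| |by left].
  by apply: d1; apply/andP; split; lra.
(* A point of a crosscap is joined to chart 0 along its own direction [c]; [e] is short enough for
   both displacements to stay below [1 / 2]. *)
have [e e0 [e1 ce]] : exists2 e : R, 0 < e & e < 1 / 2 /\ `|c| * e < 1 / 2.
  exists (4^-1 / (1 + `|c|)).
    by rewrite divr_gt0 ?invr_gt0 //; have := normr_ge0 c; lra.
  have c0 : 0 < 1 + `|c| by have := normr_ge0 c; lra.
  split; first by rewrite ltr_pdivrMr //; have := normr_ge0 c; lra.
  by rewrite mulrA ltr_pdivrMr //; have := normr_ge0 c; lra.
have de (r : R) : 0 <= r <= e -> cdom N (cap_chart k b) (c, r + 1).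
  move=> /andP[r0 re]; apply: cdom_capP; first by rewrite ger0_norm //; lra.
  by rewrite normrM (ger0_norm r0); apply: le_lt_trans ce; exact: ler_wpM2l.
apply: (trans _ (par (cap_chart k b) (c, e + 1))).
  apply: ver; first exact: cap_chart_lt.
  move=> r; rewrite min_l ?max_r; try lra.
  by move=> /andP[r1 r2]; rewrite -[r](subrK 1); apply: de; apply/andP; split; lra.
have e00 : e != 0 by rewrite gt_eqF.
have en : `|e| < 1 / 2 by rewrite gtr0_norm.
have cen : `|c * e| < 1 / 2 by rewrite normrM (gtr0_norm e0).
have [dP ->] := cap_par0 N0 b kN e00 en cen.
by move: dP; case: (lft _ _) => s y; exact: b0.
Qed.

Lemma crosscap_connected : connected [set: glued a].
Proof.
have -> : [set: glued a] = connected_component setT base.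
  apply/seteqP; split=> // x _; exact/connected_component_sym/crosscap_connected_base.
exact: component_connected.
Qed.

End CrosscapConnected.

Lemma derive_affine (R : realType) (V W : normedModType R) (f : V -> W) (u v : V) (w : W) :
  (forall h : R, f (h *: v + u) - f u = h *: w) -> 'D_v f u = w.
Proof.
move=> fw; rewrite /derive; apply: cvg_lim => //.
apply: (@cvg_trans _ (cst w @ (0 : R)^')); last exact: cvg_cst.
apply: near_eq_cvg; near=> h.
rewrite /cst /= fw scalerA mulVf ?scale1r //.
by near: h; exact: nbhs_dnbhs_neq.
Unshelve. all: by end_near. Qed.

(** * Nonorientability and the boundary *)

Section CrosscapSurfaceFacts.
Context {R : realType}.
Variable N : nat.
Hypothesis N0 : (0 < N)%N.
Let n : R := N%:R.
Let n0 : 0 < n. Proof. by rewrite ltr0n. Qed.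
Implicit Types (u v w P Q : R * R) (i j : nat).

Local Notation a := (@crosscap_atlas R N N0).
Local Notation par := (gpar a).

Definition crosscap_surface : surface R := glued_surface a.

Lemma near_par i u (P : glued a -> Prop) : (i < ncharts N)%N -> cdom N i u ->
  (\forall w \near u, cdom N i w -> P (par i w)) -> \forall y \near par i u, P y.
Proof.
move=> iN du; rewrite /prop_near1 nbhsE => -[B [oB Bu] BP].
have : nbhs (par i u) (par i @` (cdom N i `&` B)).
  by apply: open_nbhs_nbhs; split; [exact: (@gpar_open R a) | exists u].
by apply: filterS => _ [w [dw Bw] <-]; exact: BP.
Qed.

Lemma affine_smooth (e c d : R) u : smooth_near (fun w => (w.1 + c, e * w.2 + d)) u.
Proof.
apply: (Cinf_smooth_near openT) => // m.
have cc (b : R) : Cn m setT (fun _ : R * R => b) by apply: Cn_cst; exact: openT.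
have c1 : Cn m setT (fst : R * R -> R) by apply: Cn_fst; exact: openT.
have c2 : Cn m setT (snd : R * R -> R) by apply: Cn_snd; exact: openT.
apply: (Cn_pair openT); first exact: (CnD openT).
by apply: (CnD openT) => //; exact: (CnM openT).
Qed.

Lemma affine_jacobian (e c d : R) u :
  jacobian_det (fun w : R * R => (w.1 + c, e * w.2 + d)) u = e.
Proof.
rewrite /jacobian_det /partial1 /partial2.
rewrite (derive_affine (w := (1, 0) : R * R)) ?(derive_affine (w := (0, e) : R * R)) /=.
- by rewrite mul1r mul0r subr0.
- by move=> h; congr pair; rewrite /= /GRing.scale /=; ring.
- by move=> h; congr pair; rewrite /= /GRing.scale /=; ring.
Qed.

(** Charts 2 and 3 cover the core circle and overlap at two places. At [x] the transition map is the
    identity; at [y] it is [(s, y) -> (s - n, 8 - y)], with determinant [-1]. An orientation would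
    be constant along the core within each chart, so the two comparisons contradict each other. *)
Lemma crosscap_nonorientable : ~ orientable crosscap_surface.
Proof.
have n0' := n0.
case=> o [lo tr].
pose i2 : 'I_(ncharts N) := Ordinal (small_ncharts N (isT : (2 < 4)%N)).
pose i3 : 'I_(ncharts N) := Ordinal (small_ncharts N (isT : (3 < 4)%N)).
have cf : continuous (fun t : R => (t, 4 : R)).
  by apply: continuous_pair => t; [exact: cvg_id | exact: cvg_cst].
have d2 (t : R) : n / 4 <= t <= 3 * n / 4 -> cdom N 2 (t, 4).
  by move=> /andP[t0 t1]; apply: cdom2P; rewrite -/n; apply/andP; split; lra.
have d3 (t : R) : - (n / 4) <= t <= n / 4 -> cdom N 3 (t, 4).
  by move=> /andP[t0 t1]; apply: cdom3P; rewrite -/n; apply/andP; split; lra.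
pose x := par 2 (n / 4, 4); pose y := par 2 (3 * n / 4, 4).
have x2 : cdom N 2 (n / 4, 4) by apply: d2; apply/andP; split; lra.
have x3 : cdom N 3 (n / 4, 4) by apply: d3; apply/andP; split; lra.
have y2 : cdom N 2 (3 * n / 4, 4) by apply: d2; apply/andP; split; lra.
have y3 : cdom N 3 (- (n / 4), 4) by apply: d3; apply/andP; split; lra.
have xE : par 3 (n / 4, 4) = x by apply: par_shift => //; left.
have e48 : 8 - 4 = 4 :> R by ring.
have yE : par 3 (- (n / 4), 4) = y.
  rewrite -[4]e48; apply: par_flip => //; last by right; field.
  by rewrite e48.
have o2 : o i2 x = o i2 y.
  have cP := path_connected (N0 := N0) (small_ncharts N (isT : (2 < 4)%N)) cf d2.
  apply: (locally_constant_connected _ (lo i2) cP).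
  - exact: (@gdom_open R a).
  - by move=> _ [t + <-]; rewrite /= in_itv => /d2 dt; exists (t, 4).
  - by exists (n / 4) => //; rewrite /= in_itv /=; apply/andP; split; lra.
  - by exists (3 * n / 4) => //; rewrite /= in_itv /=; apply/andP; split; lra.
have o3 : o i3 x = o i3 y.
  have cP := path_connected (N0 := N0) (small_ncharts N (isT : (3 < 4)%N)) cf d3.
  apply: (locally_constant_connected _ (lo i3) cP).
  - exact: (@gdom_open R a).
  - by move=> _ [t + <-]; rewrite /= in_itv => /d3 dt; exists (t, 4).
  - by exists (n / 4); rewrite ?/comp ?xE //= in_itv /=; apply/andP; split; lra.
  - by exists (- (n / 4)); rewrite ?/comp ?yE //= in_itv /=; apply/andP; split; lra.
have dx2 : gdom (a := a) 2 x by exists (n / 4, 4).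
have dx3 : gdom (a := a) 3 x by exists (n / 4, 4).
have dy2 : gdom (a := a) 2 y by exists (3 * n / 4, 4).
have dy3 : gdom (a := a) 3 y by exists (- (n / 4), 4).
have iN2 := small_ncharts N (isT : (2 < 4)%N).
have iN3 := small_ncharts N (isT : (3 < 4)%N).
have ob u (s0 s1 : R) : s0 < u.1 < s1 -> 3 < u.2 < 5 ->
    \forall w \near u, (s0 < w.1 < s1) && (3 < w.2 < 5).
  move=> /andP[a1 a2] /andP[a3 a4].
  have O : open [set w : R * R | (s0 < w.1 /\ w.1 < s1) /\ (3 < w.2 /\ w.2 < 5)].
    have oI (P Q : R * R -> Prop) : open [set u | P u] -> open [set u | Q u] ->
      open [set u | P u /\ Q u] by exact: openI.
    by apply: (oI _ _); apply: (oI _ _); apply: open_ltf => w;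
      try exact: cvg_cst; try exact: cvg_fst; exact: cvg_snd.
  have h := open_nbhs_nbhs (conj O (conj (conj a1 a2) (conj a3 a4))).
  by apply: filterS h => w [[-> ->] [-> ->]].
have ox : o i2 x = o i3 x.
  have := tr i2 i3 x (fun w => (w.1 + 0, 1 * w.2 + 0)) dx2 dx3 (affine_smooth _ _ _ _).
  rewrite affine_jacobian ltr01 => H; apply/eqP; apply: H.
  apply: (near_par iN2 x2); have := ob (n / 4, 4) 0 (n / 2).
  rewrite /= => /(_ _ _) Ob; apply: filterS (Ob _ _); try by apply/andP; split; lra.
  move=> [s z] /= /andP[/andP[s0 s1] z35] dw.
  have d : cdom N 3 (s, z) by apply: cdom3P => //; rewrite -/n; apply/andP; split; lra.
  rewrite /= (gchartK (a := a) iN2 dw) addr0 mul1r addr0.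
  have -> : par 2 (s, z) = par 3 (s, z) by apply: par_shift => //; left.
  by rewrite (gchartK (a := a) iN3 d).
have oy : (o i2 y == o i3 y) = false.
  rewrite (tr i2 i3 y (fun w => (w.1 + (- n), - 1 * w.2 + 8)) dy2 dy3 (affine_smooth _ _ _ _)).
    by rewrite affine_jacobian ltr0N1.
  apply: (near_par iN2 y2); have := ob (3 * n / 4, 4) (n / 2) n.
  rewrite /= => /(_ _ _) Ob; apply: filterS (Ob _ _); try by apply/andP; split; lra.
  move=> [s z] /= /andP[/andP[s0 s1] z35] dw.
  have d : cdom N 3 (s - n, 8 - z).
    by move/andP: z35 => [z3 z5]; apply: cdom3P => //; rewrite -/n; apply/andP; split; lra.
  rewrite /= (gchartK (a := a) iN2 dw) /=.
  have -> : par 2 (s, z) = par 3 (s - n, 8 - z) by apply/esym/par_flip => //; right.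
  by rewrite (gchartK (a := a) iN3 d); congr pair; ring.
by move: oy; rewrite -o2 -o3 ox eqxx.
Qed.

Lemma crosscap_compact_connected : compact_connected_surface crosscap_surface.
Proof.
by split; [exact: crosscap_compact | exact: crosscap_hausdorff | exact: crosscap_connected].
Qed.

Lemma crosscap_boundary (x : crosscap_surface) : boundary crosscap_surface x <->
  exists i s, [/\ (i < 2)%N, cdom N i (s, 0) & x = par i (s, 0)].
Proof.
split=> [[i [[s y] du <-]]|[i [s [i2 du ->]]]]; last first.
  have iN : (i < ncharts N)%N by apply: small_ncharts; exact: ltn_trans i2 _.
  exists (Ordinal iN); first by exists (s, 0).
  by rewrite /= (gchartK (a := a) iN du).
rewrite /= (gchartK (a := a) (ltn_ord i) du) /= => y0; rewrite y0 in du *.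
have [i2|i2] := ltnP i 2; first by exists i, s.
exfalso; have [|[]] := cdom_snd du; first by rewrite /= ltxx.
move=> i4 _; case: du; rewrite /dom_open_part i4 => -[_ [[+ _] _]] _.
move: i2 i4; case: (nat_of_ord i) => [|[|[|[|//]]]] // _ _; rewrite /ylo /=; lra.
Qed.

End CrosscapSurfaceFacts.

(** * Partial derivatives in polar coordinates *)

Section Gradient.
Context {R : realType}.
Implicit Types (u v : R * R).

Definition grad (f : R * R -> R) u (f1 f2 : R) : Prop :=
  differentiable f u /\ forall v, 'd f u v = v.1 * f1 + v.2 * f2.

Lemma grad_eq f u f1 f2 g1 g2 : grad f u f1 f2 -> f1 = g1 -> f2 = g2 -> grad f u g1 g2.
Proof. by move=> ? <- <-. Qed.

Lemma grad_near f g u f1 f2 : (\forall w \near u, f w = g w) ->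
  grad f u f1 f2 -> grad g u f1 f2.
Proof.
move=> fg [df Df]; have dg := near_eq_differentiable fg df; split; [exact: dg | move=> v].
by rewrite -Df -!deriveE //; apply: esym; exact: near_eq_derive.
Qed.

Lemma grad_cst (c : R) u : grad (fun=> c) u 0 0.
Proof.
split=> [|v]; first exact: differentiable_cst.
by rewrite (diff_cst c u) !mulr0 addr0.
Qed.

Lemma grad_fst u : grad fst u 1 0.
Proof.
have ck : continuous (fst : R * R -> R) by move=> w; exact: cvg_fst.
split=> [|v]; first exact: linear_differentiable.
by rewrite diff_lin //= mulr1 mulr0 addr0.
Qed.

Lemma grad_snd u : grad snd u 0 1.
Proof.
have ck : continuous (snd : R * R -> R) by move=> w; exact: cvg_snd.
split=> [|v]; first exact: linear_differentiable.
by rewrite diff_lin //= mulr1 mulr0 add0r.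
Qed.

Lemma gradD f g u f1 f2 g1 g2 : grad f u f1 f2 -> grad g u g1 g2 ->
  grad (fun w => f w + g w) u (f1 + g1) (f2 + g2).
Proof.
move=> [df Df] [dg Dg]; split=> [|v]; first exact: differentiableD.
by rewrite (diffD df dg) /= Df Dg; ring.
Qed.

Lemma gradN f u f1 f2 : grad f u f1 f2 -> grad (fun w => - f w) u (- f1) (- f2).
Proof.
move=> [df Df]; split=> [|v]; first exact: differentiableN.
by rewrite (diffN df) -[LHS]/(- 'd f u v) Df; ring.
Qed.

Lemma gradB f g u f1 f2 g1 g2 : grad f u f1 f2 -> grad g u g1 g2 ->
  grad (fun w => f w - g w) u (f1 - g1) (f2 - g2).
Proof. by move=> Df Dg; apply: gradD => //; exact: gradN. Qed.

Lemma gradM f g u f1 f2 g1 g2 : grad f u f1 f2 -> grad g u g1 g2 ->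
  grad (fun w => f w * g w) u (f1 * g u + f u * g1) (f2 * g u + f u * g2).
Proof.
move=> [df Df] [dg Dg]; split=> [|v]; first exact: differentiableM.
by rewrite (diffM df dg) -[LHS]/(f u * 'd g u v + g u * 'd f u v) Df Dg; ring.
Qed.

Lemma gradZ (c : R) f u f1 f2 : grad f u f1 f2 ->
  grad (fun w => c * f w) u (c * f1) (c * f2).
Proof.
by move=> Df; apply: grad_eq (gradM (grad_cst c u) Df) _ _; rewrite mul0r add0r.
Qed.

Lemma grad_comp1 (phi : R -> R) (f : R * R -> R) u f1 f2 (d : R) :
  is_derive (f u) (1 : R) phi d -> grad f u f1 f2 ->
  grad (fun w => phi (f w)) u (d * f1) (d * f2).
Proof.
move=> [dphi Dphi] [df Df]; have dp := (derivable1_diffP _ _).1 dphi.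
split=> [|v]; first exact: (differentiable_comp df dp).
rewrite (diff_comp df dp) /= Df deriv1E // derive1E Dphi /GRing.scale /=; ring.
Qed.

Lemma grad_comp2 g p q u g1 g2 p1 p2 q1 q2 :
  grad g (p u, q u) g1 g2 -> grad p u p1 p2 -> grad q u q1 q2 ->
  grad (fun w => g (p w, q w)) u (g1 * p1 + g2 * q1) (g1 * p2 + g2 * q2).
Proof.
move=> [dg Dg] [dp Dp] [dq Dq]; have dpq := differentiable_pair dp dq.
split=> [|v]; first exact: (differentiable_comp dpq dg).
rewrite (diff_comp (f := fun w => (p w, q w)) dpq dg) /= Dg.
by rewrite (diff_pair dp dq) /= Dp Dq; ring.
Qed.

Lemma gradV (f : R * R -> R) u f1 f2 : f u != 0 -> grad f u f1 f2 ->
  grad (fun w => (f w)^-1) u (- (f u) ^- 2 * f1) (- (f u) ^- 2 * f2).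
Proof.
move=> f0 Df; apply: (grad_comp1 (phi := GRing.inv)) => //.
have di : derivable (id : R -> R) (f u) 1 by exact: derivable_id.
apply: DeriveDef; first exact: (derivableV (f := id) f0 di).
by rewrite (deriveV (f := id) f0 di) derive_id /GRing.scale /= mulr1.
Qed.

Lemma grad_cos f u f1 f2 : grad f u f1 f2 ->
  grad (fun w => cos (f w)) u (- sin (f u) * f1) (- sin (f u) * f2).
Proof. by apply: grad_comp1; exact: is_derive_cos. Qed.

Lemma grad_sin f u f1 f2 : grad f u f1 f2 ->
  grad (fun w => sin (f w)) u (cos (f u) * f1) (cos (f u) * f2).
Proof. by apply: grad_comp1; exact: is_derive_sin. Qed.

Lemma grad_sqrt (f : R * R -> R) u f1 f2 : 0 < f u -> grad f u f1 f2 ->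
  grad (fun w => Num.sqrt (f w)) u
    (f1 / (2 * Num.sqrt (f u))) (f2 / (2 * Num.sqrt (f u))).
Proof.
move=> f0 Df; apply: grad_eq (grad_comp1 (is_derive1_sqrt f0) Df) _ _; exact: mulrC.
Qed.

Lemma grad_derive f u f1 f2 v : grad f u f1 f2 ->
  derivable f u v /\ 'D_v f u = v.1 * f1 + v.2 * f2.
Proof. by move=> [df Df]; split; [exact: diff_derivable | rewrite deriveE]. Qed.

End Gradient.

Section PolarCoordinates.
Context {R : realType}.
Implicit Types (u v : R * R).

Definition pol (a al b be : R) : 'rV[R]_4 :=
  \row_k [:: a * cos al; a * sin al; b * cos be; b * sin be]`_k.

(* [(i a e^(i al), b e^(i be))] up to the order of the coordinates and the
   position of the factor [i]: the former covers [p < q], the latter [q < p]. *)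
Definition polf (f : bool) (a al b be : R) : 'rV[R]_4 :=
  if f then pol a al b (be + pi / 2) else pol b be a (al + pi / 2).

Definition dpol (a al b be da dal db dbe : R) : 'rV[R]_4 :=
  \row_k [:: da * cos al - a * sin al * dal; da * sin al + a * cos al * dal;
             db * cos be - b * sin be * dbe; db * sin be + b * cos be * dbe]`_k.

Lemma pol_partials (a al b be : R * R -> R) u a1 a2 al1 al2 b1 b2 be1 be2 :
  grad a u a1 a2 -> grad al u al1 al2 -> grad b u b1 b2 -> grad be u be1 be2 ->
  partial1 (fun w => pol (a w) (al w) (b w) (be w)) u =
    dpol (a u) (al u) (b u) (be u) a1 al1 b1 be1 /\
  partial2 (fun w => pol (a w) (al w) (b w) (be w)) u =
    dpol (a u) (al u) (b u) (be u) a2 al2 b2 be2.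
Proof.
move=> ga gal gb gbe.
have g0 := gradM ga (grad_cos gal); have g1 := gradM ga (grad_sin gal).
have g2 := gradM gb (grad_cos gbe); have g3 := gradM gb (grad_sin gbe).
have D v : derivable (fun w => pol (a w) (al w) (b w) (be w)) u v.
  apply/derivable_mxP => i k.
  case: k => -[|[|[|[|//]]]] ?;
  [have [d _] := grad_derive v g0|have [d _] := grad_derive v g1
  |have [d _] := grad_derive v g2|have [d _] := grad_derive v g3];
  by apply: near_eq_derivable d; apply: filterE => w; rewrite !mxE.
have key v : 'D_v (fun w => pol (a w) (al w) (b w) (be w)) u =
    dpol (a u) (al u) (b u) (be u) (v.1 * a1 + v.2 * a2) (v.1 * al1 + v.2 * al2)
      (v.1 * b1 + v.2 * b2) (v.1 * be1 + v.2 * be2).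
  rewrite derive_mx //; apply/matrixP => i k; rewrite ord1 !mxE /=.
  have E (f g : R * R -> R) : f = g -> 'D_v f u = 'D_v g u by move=> ->.
  case: k => -[|[|[|[|//]]]] ? /=.
  - rewrite (E _ (fun w => a w * cos (al w))); last by apply/funext => w; rewrite mxE.
    by rewrite (grad_derive _ g0).2; ring.
  - rewrite (E _ (fun w => a w * sin (al w))); last by apply/funext => w; rewrite mxE.
    by rewrite (grad_derive _ g1).2; ring.
  - rewrite (E _ (fun w => b w * cos (be w))); last by apply/funext => w; rewrite mxE.
    by rewrite (grad_derive _ g2).2; ring.
  - rewrite (E _ (fun w => b w * sin (be w))); last by apply/funext => w; rewrite mxE.
    by rewrite (grad_derive _ g3).2; ring.
by rewrite /partial1 /partial2 !key /= !mul1r !mul0r !addr0 !add0r.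
Qed.

Lemma dot_dpol (a al b be a1 al1 b1 be1 a2 al2 b2 be2 : R) :
  dot (dpol a al b be a1 al1 b1 be1) (dpol a al b be a2 al2 b2 be2) =
  a1 * a2 + a ^+ 2 * al1 * al2 + b1 * b2 + b ^+ 2 * be1 * be2.
Proof.
rewrite /dot !big_ord_recl big_ord0 !mxE /= addr0.
have h1 := cos2Dsin2 al; have h2 := cos2Dsin2 be.
transitivity ((a1 * a2 + a ^+ 2 * al1 * al2) * (cos al ^+ 2 + sin al ^+ 2) +
  (b1 * b2 + b ^+ 2 * be1 * be2) * (cos be ^+ 2 + sin be ^+ 2)); first ring.
by rewrite h1 h2 !mulr1; ring.
Qed.

Lemma omega_dpol (a al b be a1 al1 b1 be1 a2 al2 b2 be2 : R) :
  omega (dpol a al b be a1 al1 b1 be1) (dpol a al b be a2 al2 b2 be2) =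
  a * (a1 * al2 - a2 * al1) + b * (b1 * be2 - b2 * be1).
Proof.
rewrite /omega !mxE !inordK //=.
have h1 := cos2Dsin2 al; have h2 := cos2Dsin2 be.
transitivity (a * (a1 * al2 - a2 * al1) * (cos al ^+ 2 + sin al ^+ 2) +
  b * (b1 * be2 - b2 * be1) * (cos be ^+ 2 + sin be ^+ 2)); first ring.
by rewrite h1 h2 !mulr1.
Qed.

(** The euclidean metric [da^2 + a^2 dal^2 + db^2 + b^2 dbe^2] in polar coordinates, on two tangent
    vectors. *)
Definition Qform (a b a1 al1 b1 be1 a2 al2 b2 be2 : R) : R :=
  a1 * a2 + a ^+ 2 * al1 * al2 + b1 * b2 + b ^+ 2 * be1 * be2.

(** Exchanging the complex coordinates and turning one of them by a right angle are symplectic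
    isometries, so the formulas are the same for both values of [f]. *)
Lemma polf_partials (f : bool) (a al b be : R * R -> R) u a1 a2 al1 al2 b1 b2 be1 be2 :
  grad a u a1 a2 -> grad al u al1 al2 -> grad b u b1 b2 -> grad be u be1 be2 ->
  let F := fun w => polf f (a w) (al w) (b w) (be w) in
  [/\ omega (partial1 F u) (partial2 F u) =
        a u * (a1 * al2 - a2 * al1) + b u * (b1 * be2 - b2 * be1),
      dot (partial1 F u) (partial1 F u) = Qform (a u) (b u) a1 al1 b1 be1 a1 al1 b1 be1,
      dot (partial2 F u) (partial2 F u) = Qform (a u) (b u) a2 al2 b2 be2 a2 al2 b2 be2 &
      dot (partial1 F u) (partial2 F u) = Qform (a u) (b u) a1 al1 b1 be1 a2 al2 b2 be2].
Proof.
move=> ga gal gb gbe F.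
have gs (h : R * R -> R) h1 h2 : grad h u h1 h2 -> grad (fun w => h w + pi / 2) u h1 h2.
  by move=> gh; apply: grad_eq (gradD gh (grad_cst (pi / 2) u)) _ _; rewrite addr0.
rewrite /F /polf /Qform; case: f F => F.
  have [-> ->] := pol_partials ga gal gb (gs _ _ _ gbe).
  by rewrite omega_dpol !dot_dpol.
have [-> ->] := pol_partials gb gbe ga (gs _ _ _ gal).
rewrite omega_dpol !dot_dpol; split; ring.
Qed.

Lemma polf_near_partials (f : bool) (F : R * R -> 'rV[R]_4) (a al b be : R * R -> R) u
    a1 a2 al1 al2 b1 b2 be1 be2 :
  (\forall w \near u, polf f (a w) (al w) (b w) (be w) = F w) ->
  grad a u a1 a2 -> grad al u al1 al2 -> grad b u b1 b2 -> grad be u be1 be2 ->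
  omega (partial1 F u) (partial2 F u) =
    a u * (a1 * al2 - a2 * al1) + b u * (b1 * be2 - b2 * be1) /\
  area_density F u =
    Num.sqrt (Qform (a u) (b u) a1 al1 b1 be1 a1 al1 b1 be1 *
              Qform (a u) (b u) a2 al2 b2 be2 a2 al2 b2 be2 -
              Qform (a u) (b u) a1 al1 b1 be1 a2 al2 b2 be2 ^+ 2).
Proof.
move=> nF ga gal gb gbe.
pose G := fun w => polf f (a w) (al w) (b w) (be w).
have := polf_partials f ga gal gb gbe; rewrite /= -/G => -[w12 d1 d2 d12].
have e1 : partial1 F u = partial1 G u by apply: esym; exact: near_eq_derive nF.
have e2 : partial2 F u = partial2 G u by apply: esym; exact: near_eq_derive nF.
split; first by rewrite e1 e2.
rewrite /area_density e1 e2; congr (Num.sqrt (_ * _ - _ ^+ 2)); [exact: d1|exact: d2|exact: d12].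
Qed.

End PolarCoordinates.

(** * The lagrangian map *)

(* The map on the strip.  Writing [th = pi s / N] and [c = 1 / N]:
   - for [2 <= y <= 3] it is an annulus of orbits of the circle action with
     weights (p, -q), on the level set [p |z|^2 - q |w|^2 = 2 c];
   - for [3 <= y <= 4] the circle [w = 0] which bounds that annulus is closed
     up by orbits of weights (p, 2 p), ending on a curve of period [pi] in
     [th], hence on the core of the Moebius band;
   - on a square cell of [0 <= y <= 2] the coordinates [(H, th)] run over the
     boundary of a rectangle shrunk by [cell_sin] while [(K, psi)] run over a
     circle, traversed twice, expanded by [cell_cos]. *)
Section LagrangianMap.
Context {R : realType}.
Variables (f : bool) (p q N : nat).
Let n : R := N%:R.
Let c : R := n^-1.
Let P : R := p%:R.
Let Q : R := q%:R.

(* Action-angle coordinates: [H] and [K] are the moment maps of the circle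
   actions of weights (p, -q) and (1, 1), up to linear changes. *)
Definition action_angle (H th K psi : R) : 'rV[R]_4 :=
  polf f (Num.sqrt (2 * (Q * K + H) / (P + Q))) (P * th + psi)
         (Num.sqrt (2 * (P * K - H) / (P + Q))) (- (Q * th) + psi).

(** With [x * |x|] and [x * x] instead of [x], the derivatives of [cell_sin] and [cell_cos] carry a
    factor [|x|]. It cancels the factor [1 / |x|] from the passage between slope coordinates and
    strip coordinates, so the area density stays bounded at the puncture. *)
Definition cell_sin (x : R) : R := sin (pi / 2 * (x * `|x|)).
Definition cell_cos (x : R) : R := cos (pi / 2 * (x * x)).

Definition cell_X (b : bool) (k x : R) := if b then k * cell_sin x else cell_sin x.
Definition cell_sg (b : bool) : R := if b then -1 else 1.

(** One pair of opposite triangles of a square cell: [k] is the slope if [b] is false and its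
    reciprocal if [b] is true, with [|k| <= 1]. The sign [cell_sg] makes the two arcs in the
    [(K, psi)] plane complementary halves of a circle, with common ends on the diagonals [|k| = 1].
    As all slopes together run once through the circle, the boundary of the square runs through it
    twice. *)
Definition cell (b : bool) (xi k x : R) : 'rV[R]_4 :=
  action_angle (c / 2 + c / 2 * cell_X (~~ b) k x) (pi / n * (xi + cell_X b k x))
    (1 / 2 + cell_sg b * (c * cell_cos x * cos (pi / 2 * k)))
    (- (c * cell_cos x * sin (pi / 2 * k))).

Definition cell_center (s : R) : R := 2 * (Num.floor (s / 2))%:~R + 1.

Definition cell_map (xi : R) (u : R * R) : 'rV[R]_4 :=
  if `|u.2 - 1| <= `|u.1 - xi|
  then cell false xi ((u.2 - 1) / (u.1 - xi)) (u.1 - xi)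
  else cell true xi ((u.1 - xi) / (u.2 - 1)) (u.2 - 1).

(** The value of [|w|], which decreases linearly to 0. The factor is its value at [H = c],
    [K = 1 / 2], where the level set meets the unit sphere and the cells end. *)
Definition annulus_radius (y : R) : R := Num.sqrt ((P - 2 * c) / (P + Q)) * (3 - y).

Definition annulus_map (u : R * R) : 'rV[R]_4 :=
  polf f (Num.sqrt ((2 * c + Q * annulus_radius u.2 ^+ 2) / P)) (P * (pi / n * u.1))
         (annulus_radius u.2) (- (Q * (pi / n * u.1))).

(** The two amplitudes put the image on the level [p |z|^2 + 2 p |w|^2 = 2 c] of the moment map for
    the weights [(p, 2 p)], which contains the circle [w = 0] at the end of the annulus. *)
Definition core_map (u : R * R) : 'rV[R]_4 :=
  polf f (Num.sqrt (2 * c / P) * sin (pi / 2 * (4 - u.2))) (P * (pi / n * u.1))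
         (Num.sqrt (c / P) * cos (pi / 2 * (4 - u.2))) (2 * P * (pi / n * u.1)).

Definition half_strip_map (u : R * R) : 'rV[R]_4 :=
  if u.2 <= 2 then cell_map (cell_center u.1) u
  else if u.2 <= 3 then annulus_map u else core_map u.

Definition strip_map (u : R * R) : 'rV[R]_4 :=
  if u.2 <= 4 then half_strip_map u else half_strip_map (u.1 + n, 8 - u.2).

Definition cap_map (i : nat) (u : R * R) : 'rV[R]_4 :=
  let xi := ((cap i).*2.+1)%:R in
  if `|u.1| <= 1 then cell (odd i) xi u.1 (u.2 - 1)
  else cell (~~ odd i) xi (u.1)^-1 (u.1 * (u.2 - 1)).

Definition chart_map (i : nat) (u : R * R) : 'rV[R]_4 :=
  if (i < 4)%N then strip_map u else cap_map i u.

Hypothesis N0 : (0 < N)%N.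
Let n0 : 0 < n. Proof. by rewrite ltr0n. Qed.

Lemma polf_int2pi (a al b be : R) (j k : int) :
  polf f a (al + j%:~R * (2 * pi)) b (be + k%:~R * (2 * pi)) = polf f a al b be.
Proof.
rewrite /polf; case: f; apply/matrixP => i l; rewrite !mxE;
  rewrite ![_ + _ * (2 * pi) + pi / 2]addrAC !cosDint2pi !sinDint2pi //.
Qed.

Lemma action_angle_int2pi (H th K psi : R) (j : int) :
  action_angle H (th + j%:~R * (2 * pi)) K psi = action_angle H th K psi.
Proof.
rewrite /action_angle -[RHS](polf_int2pi _ _ _ _ ((p : int) * j) (- ((q : int) * j))).
by congr polf; rewrite ?mulrNz ?intrM -?[(p : int)%:~R]/P -?[(q : int)%:~R]/Q; ring.
Qed.

Let angle_shift (s : R) (j : int) : pi / n * (s + 2 * n * j%:~R) = pi / n * s + j%:~R * (2 * pi).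
Proof. by have := gt_eqF n0 => /negbT h; field. Qed.

Lemma cell_shift b (xi k x : R) (j : int) :
  cell b (xi + 2 * n * j%:~R) k x = cell b xi k x.
Proof.
rewrite /cell [xi + _ + _]addrAC angle_shift; exact: action_angle_int2pi.
Qed.

Lemma cell_center_shift (s : R) (j : int) :
  cell_center (s + 2 * n * j%:~R) = cell_center s + 2 * n * j%:~R.
Proof.
rewrite /cell_center; have -> : (s + 2 * n * j%:~R) / 2 = s / 2 + ((N : int) * j)%:~R.
  by rewrite intrM -[(N : int)%:~R]/n; field.
by rewrite floorDrz ?intr_int // intrKfloor intrD intrM -[(N : int)%:~R]/n; ring.
Qed.

Lemma half_strip_map_shift (s y : R) (j : int) :
  half_strip_map (s + 2 * n * j%:~R, y) = half_strip_map (s, y).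
Proof.
rewrite /half_strip_map /=; case: ifP => _.
  have e (t : R) : s + t - (cell_center s + t) = s - cell_center s by ring.
  by rewrite /cell_map /= cell_center_shift !e !cell_shift.
case: ifP => _.
  rewrite /annulus_map /= angle_shift.
  rewrite -[RHS](polf_int2pi _ _ _ _ ((p : int) * j) (- ((q : int) * j))).
  by congr polf; rewrite ?mulrNz ?intrM -?[(p : int)%:~R]/P -?[(q : int)%:~R]/Q; ring.
rewrite /core_map /= angle_shift.
rewrite -[RHS](polf_int2pi _ _ _ _ ((p : int) * j) (2 * (p : int) * j)).
by congr polf; rewrite ?mulrNz ?intrM -?[(p : int)%:~R]/P; ring.
Qed.

(** On the core [z = 0], so only the angle with the factor [2 P] counts, and half a turn of [th]
    adds [P] full turns to it. *)
Lemma half_strip_map_core (s : R) : half_strip_map (s + n, 4) = half_strip_map (s, 4).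
Proof.
have e2 : (4 <= 2 :> R) = false by apply/negbTE; rewrite -ltNge; lra.
have e3 : (4 <= 3 :> R) = false by apply/negbTE; rewrite -ltNge; lra.
rewrite /half_strip_map /= e2 e3 /core_map /= subrr mulr0 sin0 mulr0.
rewrite -[RHS](polf_int2pi _ _ _ _ 0 (p : int)) -[(p : int)%:~R]/P.
have h := negbT (gt_eqF n0).
have -> : 2 * P * (pi / n * (s + n)) = 2 * P * (pi / n * s) + P * (2 * pi) by field.
rewrite mul0r addr0 /polf; case: f; apply/matrixP => i k; rewrite !mxE; by rewrite !mul0r.
Qed.

Lemma strip_map_deck (d : int) (u : R * R) : strip_map (deck N d u) = strip_map u.
Proof.
case: u => s y; rewrite /deck /= -/n.
(* The sign gives the parity of [d]: even deck transformations are translations by multiples of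
   [2 n], odd ones are followed by the reflection [y -> 8 - y] and a further translation by [n]. *)
have par (e : R) : cos (d%:~R * pi) = e -> e = 1 \/ e = -1 ->
    exists j : int, d%:~R = 2 * j%:~R + (if e == 1 then 0 else 1) :> R.
  move=> ce e1.
  pose d' := if e == 1 then d else d - 1.
  have [j jE] : exists j : int, d'%:~R * pi = 0 + j%:~R * (2 * pi) :> R.
    apply: cos_sin_eq; rewrite ?cos0 ?sin0 ?sin_intpi // /d'.
    case: e1 ce => -> ce; first by rewrite eqxx /= ce.
    have -> : (-1 == 1 :> R) = false by apply/negbTE; rewrite lt_eqF //; lra.
    by rewrite intrB mulrBl mul1r cosB cospi sinpi ce mulr0 addr0; ring.
  exists j; apply: (mulIf (_ : pi != 0 :> R)); first by rewrite gt_eqF ?pi_gt0.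
  move: jE; rewrite add0r /d'; case: ifP => _ jE; first by rewrite jE; ring.
  by move: jE; rewrite intrB mulrBl mul1r => /eqP; rewrite subr_eq => /eqP ->; ring.
have [e|e] := cos_intpi (R := R) d.
  have [|j] := par _ e; first by left.
  rewrite eqxx addr0 e => ->; have -> : 4 + 1 * (y - 4) = y by ring.
  have sh t : t + 2 * j%:~R * n = t + 2 * n * j%:~R by ring.
  rewrite sh /strip_map /=; case: ifP => _; rewrite ?half_strip_map_shift //.
  by rewrite addrAC half_strip_map_shift.
have [|j] := par _ e; first by right.
have -> : (-1 == 1 :> R) = false by apply/negbTE; rewrite lt_eqF //; lra.
rewrite e => ->; have -> : 4 + -1 * (y - 4) = 8 - y by ring.
have -> : s + (2 * j%:~R + 1) * n = s + n + 2 * n * j%:~R by ring.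
rewrite /strip_map /=; have [y4|y4|y4] := ltgtP y 4.
- have -> : (8 - y <= 4) = false by apply/negbTE; rewrite -ltNge; lra.
  have -> : 8 - (8 - y) = y by ring.
  have -> : s + n + 2 * n * j%:~R + n = s + 2 * n * (j + 1)%:~R by rewrite intrD; ring.
  by rewrite half_strip_map_shift.
- have -> : 8 - y <= 4 by lra.
  by rewrite half_strip_map_shift.
- have -> : 8 - y = 4 by lra.
  by rewrite lexx half_strip_map_shift y4 half_strip_map_core.
Qed.

Lemma cell_diag (xi k x : R) : `|k| = 1 -> cell true xi k (k * x) = cell false xi k x.
Proof.
move=> k1; have kk : k * k = 1 by rewrite -expr2 -real_normK ?num_real // k1 expr1n.
have Sk : cell_sin (k * x) = k * cell_sin x.
  have [-> |->] : k = 1 \/ k = -1.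
    by move/eqP: kk; rewrite -expr2 sqrf_eq1 => /orP[]/eqP ->; [left|right].
    by rewrite !mul1r.
  by rewrite !mulN1r /cell_sin normrN mulNr mulrN sinN.
have Ck : cell_cos (k * x) = cell_cos x.
  by rewrite /cell_cos; congr (cos (_ * _)); rewrite mulrACA kk mul1r.
have ck : cos (pi / 2 * k) = 0.
  have [-> |->] : k = 1 \/ k = -1.
    by move/eqP: kk; rewrite -expr2 sqrf_eq1 => /orP[]/eqP ->; [left|right].
    by rewrite mulr1 cos_pihalf.
  by rewrite mulrN1 cosN cos_pihalf.
rewrite /cell /cell_X /= Sk Ck ck !mulr0; congr action_angle.
by rewrite mulrA kk mul1r.
Qed.

Lemma cap_map_flip i j (k x : R) : cap i = cap j -> odd i = ~~ odd j -> k != 0 ->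
  cap_map i (k, x + 1) = cap_map j (k^-1, k * x + 1).
Proof.
move=> ij oij k0; rewrite /cap_map /= !addrK ij oij negbK invrK normfV.
have [k1|k1] := leP `|k| 1.
  have [k2|k2] := leP `|k|^-1 1; last by rewrite mulrA mulVf // mul1r.
  have kE : `|k| = 1.
    by apply/eqP; rewrite eq_le k1 /=; move: k2; rewrite invf_le1 // normr_gt0.
  have kV : k^-1 = k.
    apply: (mulfI k0); rewrite mulfV // -expr2 -real_normK ?num_real // kE expr1n //.
  rewrite kV; case: (odd j) => /=; first by rewrite cell_diag.
  have kk : k * (k * x) = x by rewrite mulrA -{2}kV mulfV // mul1r.
  by rewrite -[RHS]cell_diag // kk.
by rewrite invf_le1 ?normr_gt0 ?ltW.
Qed.

Lemma cell_center_eq k (x : R) : `|x| < 1 -> cell_center ((k.*2.+1)%:R + x) = (k.*2.+1)%:R.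
Proof.
rewrite ltr_norml => /andP[x0 x1].
rewrite /cell_center odd_natr; suff -> : Num.floor ((2 * k%:R + 1 + x) / 2) = (k : int) by [].
by apply/floor_def; rewrite intrD -[(k : int)%:~R]/(k%:R : R); apply/andP; split; lra.
Qed.

Lemma cap_map_strip i u : (4 <= i)%N -> cdom N i u -> exc i u = false ->
  chart_map i u = strip_map (lft i u).
Proof.
move=> i4; case: u => k w [+ _]; rewrite /dom_open_part ltnNge i4 /exc i4 /= => -[w1 kw1] w0.
have x0 : w - 1 != 0 by rewrite subr_eq0 w0.
rewrite /chart_map ltnNge i4 /= /lft ltnNge i4 /= /off /=.
set x := w - 1 in w1 kw1 x0 *.
have lt1 (t : R) : `|t| < 1 / 2 -> `|t| < 1 by move=> h; apply: lt_trans h _; lra.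
have bd (X Y : R) : `|X| < 1 / 2 -> `|Y| < 1 / 2 ->
  strip_map ((cap i).*2.+1%:R + X, 1 + Y) =
  if `|Y| <= `|X| then cell false (cap i).*2.+1%:R (Y / X) X
  else cell true (cap i).*2.+1%:R (X / Y) Y.
  move=> X1 Y1; have /andP[Y2 Y3] : - (1 / 2) < Y < 1 / 2 by rewrite -ltr_norml.
  rewrite /strip_map /half_strip_map /=.
  have -> : 1 + Y <= 4 by lra.
  have -> : 1 + Y <= 2 by lra.
  rewrite cell_center_eq ?lt1 // /cell_map /=.
  have E (a b : R) : a + b - a = b by ring.
  by rewrite !E.
rewrite /cap_map /= -/x.
have nk : `|k * x| <= `|x| = (`|k| <= 1).
  by rewrite normrM -[X in _ <= X]mul1r ler_pM2r // normr_gt0.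
case: (odd i) => /=; rewrite bd //.
  have [k1|k1] := leP `|k| 1; last first.
    have k0 : k != 0 by rewrite -normr_gt0 (lt_trans _ k1).
    rewrite normrM -[X in X <= _]mul1r ler_pM2r ?normr_gt0 // ltW //.
    by have -> : x / (k * x) = k^-1 by rewrite invfM mulrCA divff // mulr1.
  have [xk|xk] := leP `|x| `|k * x|; last by rewrite mulfK.
  have kE : `|k| = 1.
    apply/eqP; rewrite eq_le k1 /=; move: xk.
    by rewrite normrM -[X in X <= _]mul1r ler_pM2r ?normr_gt0.
  have k0 : k != 0 by rewrite -normr_gt0 kE.
  have kV : k^-1 = k.
    by apply: (mulfI k0); rewrite mulfV // -expr2 -real_normK ?num_real // kE expr1n.
  have -> : x / (k * x) = k by rewrite invfM mulrCA divff // mulr1 kV.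
  have kk : k * (k * x) = x by rewrite mulrA -{2}kV mulfV // mul1r.
  by rewrite -(cell_diag _ _ kE) kk.
rewrite nk; case: ifP => k1; first by rewrite mulfK.
have k0 : k != 0 by apply: contraFneq k1 => ->; rewrite normr0 ler01.
by have -> : x / (k * x) = k^-1 by rewrite invfM mulrCA divff // mulr1.
Qed.

(** This makes the map well defined on the glued surface. Off the crosscaps each chart map is
    [strip_map] after the blow-down, and [strip_map] is invariant under the deck group; on a
    crosscap the two charts differ by inversion of the slope. *)
Lemma chart_map_eq i j u v : (i < ncharts N)%N -> (j < ncharts N)%N ->
  cdom N i u -> cdom N j v -> cpar N i u = cpar N j v ->
  chart_map i u = chart_map j v.
Proof.
move=> iN jN du dv uv; have euv := cpar_exc uv.
have strip l w : cdom N l w -> exc l w = false -> chart_map l w = strip_map (lft l w).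
  move=> dw ew; have [l4|l4] := ltnP l 4; last exact: cap_map_strip.
  by rewrite /chart_map /lft l4.
have [eu|eu] := boolP (exc i u); last first.
  have ev : exc j v = false by rewrite -euv; exact: negbTE.
  rewrite (strip _ _ du (negbTE eu)) (strip _ _ dv ev).
  move: uv => /pair_equal_spec[/(orbit_inv_inj N0)[d ->] _].
  by rewrite strip_map_deck.
have ev : exc j v by rewrite -euv.
have [/andP[i4 /eqP u1] /andP[j4 /eqP v1]] := (eu, ev).
have ij : cap i = cap j.
  move: uv => /pair_equal_spec[+ _]; rewrite (lft_exc eu) (lft_exc ev).
  by apply: center_orbit => //; exact: cap_lt.
have [oij|oij] := eqVneq (odd i) (odd j).
  have iEj : i = j.
    rewrite -(subnK i4) -(subnK j4) -(odd_double_half (i - 4)) -(odd_double_half (j - 4)).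
    by rewrite !oddB // oij -/(cap i) -/(cap j) ij.
  by move: uv; rewrite iEj in du * => /(cpar_inj N0 du dv) ->.
have oE : odd i = ~~ odd j by move: oij; case: (odd i); case: (odd j).
move: uv => /pair_equal_spec[_]; rewrite /tag eu ev oE.
case: u u1 {du eu euv} => k w /= ->; case: v v1 {dv ev} => k' w' /= -> tE.
have [k0 kE] : k != 0 /\ k^-1 = k'.
  move: tE; case: (odd j) => /= -[].
    by case: eqVneq => // k'0 [->]; rewrite invr_neq0 ?invrK.
  by case: eqVneq => // k0 [<-].
rewrite /chart_map [(i < 4)%N]ltnNge [(j < 4)%N]ltnNge i4 j4 /= -kE.
by have := cap_map_flip 0 ij oE k0; rewrite mulr0 !add0r.
Qed.

End LagrangianMap.

(** * Calculus of locally Lipschitz maps *)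

Section LocallyLipschitz.
Context {R : realType}.
Implicit Types (u v w : R * R) (D : set (R * R)).

(** The local bound on [F] is included so that products stay in the class. The set [D] restricts
    attention to where a formula is valid; the pieces are joined by [llip_paste]. *)
Definition llip (V : normedModType R) D (F : R * R -> V) u : Prop :=
  exists k e : R, [/\ 0 <= k, 0 < e,
    forall x, ball u e x -> D x -> `|F x| <= k &
    forall x y, ball u e x -> ball u e y -> D x -> D y -> `|F x - F y| <= k * `|x - y|].

Lemma llip_near (V : normedModType R) D (F G : R * R -> V) u :
  (\forall w \near u, D w -> F w = G w) -> llip D F u -> llip D G u.
Proof.
move=> /nbhs_ballP[d /= d0 dFG] [k [e [k0 e0 Fb Fl]]].
have me x : ball u (Num.min e d) x -> ball u e x /\ ball u d x.
  by move=> bx; split; apply: le_ball bx; rewrite ge_min lexx ?orbT.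
exists k, (Num.min e d); split=> //; first by rewrite lt_min e0.
  by move=> x /me[xe xd] Dx; rewrite -(dFG _ xd Dx) Fb.
move=> x y /me[xe xd] /me[ye yd] Dx Dy.
by rewrite -(dFG _ xd Dx) -(dFG _ yd Dy) Fl.
Qed.

Lemma llip_ext (V : normedModType R) D (F G : R * R -> V) u :
  (forall w, D w -> F w = G w) -> llip D F u -> llip D G u.
Proof. by move=> FG; apply: llip_near; apply: filterE. Qed.

Lemma llip_sub (V : normedModType R) D D' (F : R * R -> V) u :
  (\forall w \near u, D' w -> D w) -> llip D F u -> llip D' F u.
Proof.
move=> /nbhs_ballP[d /= d0 dD] [k [e [k0 e0 Fb Fl]]].
have me x : ball u (Num.min e d) x -> ball u e x /\ ball u d x.
  by move=> bx; split; apply: le_ball bx; rewrite ge_min lexx ?orbT.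
exists k, (Num.min e d); split=> //; first by rewrite lt_min e0.
  by move=> x /me[xe xd] /(dD _ xd) Dx; exact: Fb.
by move=> x y /me[xe xd] /me[ye yd] /(dD _ xd) Dx /(dD _ yd) Dy; exact: Fl.
Qed.

Lemma llip_empty (V : normedModType R) D (F : R * R -> V) u :
  (\forall w \near u, ~ D w) -> llip D F u.
Proof.
move=> /nbhs_ballP[d /= d0 dD]; exists 0, d; split=> //.
  by move=> x /dD.
by move=> x y /dD.
Qed.

Lemma llip_cst D (c : R) u : llip D (fun=> c) u.
Proof.
exists `|c|, 1; split=> //= x y _ _ _ _.
by rewrite subrr normr0 mulr_ge0.
Qed.

Lemma llip_fst D u : llip D fst u.
Proof.
have h (x y : R * R) : `|x.1 - y.1| <= `|x - y|.
  by rewrite [leRHS]prod_normE le_max lexx.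
exists (`|u| + 2), 1; split=> //.
  move=> x; rewrite -ball_normE /= => ux _.
  have x1 : `|x.1| <= `|x| by rewrite [leRHS]prod_normE le_max lexx.
  have := ler_normB u (u - x); rewrite opprB subrKC => h2; lra.
move=> x y _ _ _ _; apply: le_trans (h x y) _.
by rewrite ler_peMl //; have := normr_ge0 u; lra.
Qed.

Lemma llip_snd D u : llip D snd u.
Proof.
have h (x y : R * R) : `|x.2 - y.2| <= `|x - y|.
  by rewrite [leRHS]prod_normE le_max lexx orbT.
exists (`|u| + 2), 1; split=> //.
  move=> x; rewrite -ball_normE /= => ux _.
  have x1 : `|x.2| <= `|x| by rewrite [leRHS]prod_normE le_max lexx orbT.
  have := ler_normB u (u - x); rewrite opprB subrKC => h2; lra.
move=> x y _ _ _ _; apply: le_trans (h x y) _.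
by rewrite ler_peMl //; have := normr_ge0 u; lra.
Qed.

Lemma llipD D (F G : R * R -> R) u : llip D F u -> llip D G u ->
  llip D (fun w => F w + G w) u.
Proof.
move=> [k [e [k0 e0 Fb Fl]]] [l [d [l0 d0 Gb Gl]]].
have me x : ball u (Num.min e d) x -> ball u e x /\ ball u d x.
  by move=> bx; split; apply: le_ball bx; rewrite ge_min lexx ?orbT.
exists (k + l), (Num.min e d); split=> //; [exact: addr_ge0 | by rewrite lt_min e0 | |].
  move=> x /me[xe xd] Dx; apply: le_trans (ler_normD _ _) _.
  by apply: lerD; [exact: Fb | exact: Gb].
move=> x y /me[xe xd] /me[ye yd] Dx Dy.
rewrite opprD addrACA mulrDl; apply: le_trans (ler_normD _ _) _.
by apply: lerD; [exact: Fl | exact: Gl].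
Qed.

Lemma llipM D (F G : R * R -> R) u : llip D F u -> llip D G u ->
  llip D (fun w => F w * G w) u.
Proof.
move=> [k [e [k0 e0 Fb Fl]]] [l [d [l0 d0 Gb Gl]]].
have me x : ball u (Num.min e d) x -> ball u e x /\ ball u d x.
  by move=> bx; split; apply: le_ball bx; rewrite ge_min lexx ?orbT.
have kl : 0 <= k * l by exact: mulr_ge0.
exists (2 * (k * l)), (Num.min e d); split=> //; [lra | by rewrite lt_min e0 | |].
  move=> x /me[xe xd] Dx; rewrite normrM.
  have := ler_pM (normr_ge0 _) (normr_ge0 _) (Fb x xe Dx) (Gb x xd Dx); lra.
move=> x y /me[xe xd] /me[ye yd] Dx Dy.
have -> : F x * G x - F y * G y = F x * (G x - G y) + G y * (F x - F y) by ring.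
apply: le_trans (ler_normD _ _) _; rewrite !normrM.
have h1 := ler_pM (normr_ge0 _) (normr_ge0 _) (Fb x xe Dx) (Gl x y xd yd Dx Dy).
have h2 := ler_pM (normr_ge0 _) (normr_ge0 _) (Gb y yd Dy) (Fl x y xe ye Dx Dy).
have -> : 2 * (k * l) * `|x - y| = k * (l * `|x - y|) + l * (k * `|x - y|) by ring.
exact: lerD.
Qed.

Lemma llipN D (F : R * R -> R) u : llip D F u -> llip D (fun w => - F w) u.
Proof.
move=> h; apply: llip_ext (llipM (llip_cst D (-1) u) h) => w _.
by rewrite mulN1r.
Qed.

Lemma llip_comp1 D (phi : R -> R) (B : R) (F : R * R -> R) u :
  (forall s t, `|phi s - phi t| <= `|s - t|) -> llip D F u ->
  llip D (fun w => phi (F w)) u.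
Proof.
move=> phi1 [k [e [k0 e0 Fb Fl]]].
exists (k + `|phi 0|), e; split=> //; first exact: addr_ge0.
  move=> x xe Dx; rewrite -[phi (F x)](subrK (phi 0)).
  apply: le_trans (ler_normD _ _) _; rewrite lerD2r.
  by apply: le_trans (phi1 _ _) _; rewrite subr0; exact: Fb.
move=> x y xe ye Dx Dy; apply: le_trans (phi1 _ _) _; apply: le_trans (Fl _ _ xe ye Dx Dy) _.
by rewrite ler_wpM2r // lerDl.
Qed.

Lemma llipV D (F : R * R -> R) u (d : R) : 0 < d ->
  (\forall w \near u, D w -> d <= `|F w|) -> llip D F u ->
  llip D (fun w => (F w)^-1) u.
Proof.
move=> d0 /nbhs_ballP[e' /= e'0 dF] [k [e [k0 e0 Fb Fl]]].
have me x : ball u (Num.min e e') x -> ball u e x /\ ball u e' x.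
  by move=> bx; split; apply: le_ball bx; rewrite ge_min lexx ?orbT.
have V0 : 0 <= d^-1 by rewrite invr_ge0 ltW.
have kV : 0 <= k * (d^-1 * d^-1) by rewrite !mulr_ge0.
exists (d^-1 + k * (d^-1 * d^-1)), (Num.min e e'); split=> //; [exact: addr_ge0|by rewrite lt_min e0| |].
  move=> x /me[xe xd] Dx; have Fx := dF _ xd Dx; rewrite normfV.
  have : `|F x|^-1 <= d^-1 by rewrite lef_pV2 ?posrE //; apply: lt_le_trans Fx.
  lra.
move=> x y /me[xe xd] /me[ye yd] Dx Dy; have Fx := dF _ xd Dx; have Fy := dF _ yd Dy.
have Fx0 : F x != 0 by rewrite -normr_gt0; apply: lt_le_trans Fx.
have Fy0 : F y != 0 by rewrite -normr_gt0; apply: lt_le_trans Fy.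
have -> : (F x)^-1 - (F y)^-1 = - (F x - F y) * ((F x)^-1 * (F y)^-1) by field; apply/andP.
rewrite normrM normrN normrM !normfV.
have h1 : `|F x|^-1 * `|F y|^-1 <= d^-1 * d^-1.
  by apply: ler_pM; rewrite ?invr_ge0 // lef_pV2 ?posrE //; apply: lt_le_trans d0 _.
have h0 : 0 <= `|F x|^-1 * `|F y|^-1 by rewrite mulr_ge0 ?invr_ge0.
have := ler_pM (normr_ge0 _) h0 (Fl x y xe ye Dx Dy) h1.
rewrite [k * _ * _]mulrAC => h; apply: le_trans h _.
by rewrite ler_wpM2r // lerDr.
Qed.

Lemma llip_sqrt D (F : R * R -> R) u (d : R) : 0 < d ->
  (\forall w \near u, D w -> d <= F w) -> llip D F u ->
  llip D (fun w => Num.sqrt (F w)) u.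
Proof.
move=> d0 /nbhs_ballP[e' /= e'0 dF] [k [e [k0 e0 Fb Fl]]].
have me x : ball u (Num.min e e') x -> ball u e x /\ ball u e' x.
  by move=> bx; split; apply: le_ball bx; rewrite ge_min lexx ?orbT.
have sd : 0 < Num.sqrt d by rewrite sqrtr_gt0.
have sV : 0 <= (Num.sqrt d)^-1 by rewrite invr_ge0 ltW.
exists (Num.sqrt k + k * (Num.sqrt d)^-1), (Num.min e e'); split=> //.
- by rewrite addr_ge0 ?sqrtr_ge0 ?mulr_ge0.
- by rewrite lt_min e0.
- move=> x /me[xe xd] Dx; rewrite ger0_norm ?sqrtr_ge0 //.
  have : Num.sqrt (F x) <= Num.sqrt k.
    by apply: ler_wsqrtr; apply: le_trans (ler_norm _) (Fb _ xe Dx).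
  by have : 0 <= k * (Num.sqrt d)^-1 by [rewrite mulr_ge0]; lra.
move=> x y /me[xe xd] /me[ye yd] Dx Dy; have Fx := dF _ xd Dx; have Fy := dF _ yd Dy.
have sx : Num.sqrt d <= Num.sqrt (F x) by exact: ler_wsqrtr.
have sy : 0 <= Num.sqrt (F y) by exact: sqrtr_ge0.
set X := Num.sqrt (F x) in sx *; set Y := Num.sqrt (F y) in sy *.
have XX : X ^+ 2 = F x by rewrite sqr_sqrtr // (le_trans (ltW d0)).
have YY : Y ^+ 2 = F y by rewrite sqr_sqrtr // (le_trans (ltW d0)).
have XY : 0 < X + Y by apply: ltr_wpDr => //; exact: lt_le_trans sx.
have h : `|X - Y| * (X + Y) = `|F x - F y|.
  by rewrite -{1}(gtr0_norm XY) -normrM; congr `|_|; rewrite -XX -YY; ring.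
have h2 : `|X - Y| * Num.sqrt d <= k * `|x - y|.
  apply: le_trans (Fl x y xe ye Dx Dy); rewrite -h ler_wpM2l //; lra.
rewrite -ler_pdivlMr // in h2; apply: le_trans h2 _.
rewrite mulrAC ler_wpM2r // lerDr sqrtr_ge0 //.
Qed.

Lemma lip_of_derive (phi dphi : R -> R) :
  (forall s : R, is_derive s 1 phi (dphi s)) -> (forall s, `|dphi s| <= 1) ->
  forall s t, `|phi s - phi t| <= `|s - t|.
Proof.
move=> dp d1.
suff H (s t : R) : s <= t -> `|phi s - phi t| <= `|s - t|.
  move=> s t; have [|/ltW ts] := leP s t; first exact: H.
  by rewrite distrC [leRHS]distrC; exact: H.
move=> st; have cp : {within `[s, t], continuous phi}.
  apply: continuous_subspaceT => x.
  by apply: differentiable_continuous; apply/derivable1_diffP; case: (dp x).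
have [x _ E] := MVT_segment st (fun x _ => dp x) cp.
by rewrite distrC [leRHS]distrC E normrM ler_piMl.
Qed.

Lemma llip_cos D (F : R * R -> R) u : llip D F u -> llip D (fun w => cos (F w)) u.
Proof.
apply: (llip_comp1 (phi := cos) 0); apply: (@lip_of_derive cos (fun s => - sin s)) => s.
by rewrite normrN; exact: sin_max.
Qed.

Lemma llip_sin D (F : R * R -> R) u : llip D F u -> llip D (fun w => sin (F w)) u.
Proof.
apply: (llip_comp1 (phi := sin) 0); apply: (@lip_of_derive sin cos) => s.
exact: cos_max.
Qed.

Lemma llip_norm D (F : R * R -> R) u : llip D F u -> llip D (fun w => `|F w|) u.
Proof. by apply: (llip_comp1 (phi := Num.norm) 0) => s t; exact: ler_dist_dist. Qed.

Lemma llip_row D (m : nat) (F : R * R -> 'rV[R]_m) u :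
  (forall k, llip D (fun w => F w 0 k) u) -> llip D F u.
Proof.
move=> /choice[k /choice[e H]].
pose K := \sum_i k i; pose E := \big[Num.min/1]_i e i.
have kK i : k i <= K.
  rewrite /K (bigD1 i) //= lerDl sumr_ge0 // => j _; by case: (H j).
have K0 : 0 <= K by rewrite sumr_ge0 // => j _; case: (H j).
have E0 : 0 < E by apply: lt_bigmin => // i _; case: (H i).
have Ee i : E <= e i by exact: bigmin_le_cond.
have b i x : ball u E x -> ball u (e i) x by apply: le_ball.
exists K, E; split=> // [x ux Dx|x y ux uy Dx Dy].
  rewrite [leLHS]mx_normrE; apply: bigmax_le => // -[i j] _ /=; rewrite ord1.
  by have [_ _ h _] := H j; apply: le_trans (h x (b j x ux) Dx) (kK j).
rewrite [leLHS]mx_normrE; apply: bigmax_le => [|[i j] _ /=]; first exact: mulr_ge0.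
rewrite ord1 !mxE; have [_ _ _ h] := H j.
apply: le_trans (h x y (b j x ux) (b j y uy) Dx Dy) _.
by rewrite ler_wpM2r.
Qed.

(** A segment between points on different sides stays in the convex set [D] and in the ball, and by
    the intermediate value theorem it meets [g = 0], where both estimates hold. The triangle
    inequality through that point adds the two constants. *)
Lemma llip_paste (V : normedModType R) D (F : R * R -> V) (g : R * R -> R) u :
  (forall x y (t : R), D x -> D y -> 0 <= t <= 1 -> D (x + t *: (y - x))) ->
  continuous g ->
  llip (D `&` [set w | g w <= 0]) F u -> llip (D `&` [set w | 0 <= g w]) F u ->
  llip D F u.
Proof.
move=> Dc cg [k [e [k0 e0 Fb Fl]]] [l [d [l0 d0 Gb Gl]]].
have me x : ball u (Num.min e d) x -> ball u e x /\ ball u d x.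
  by move=> bx; split; apply: le_ball bx; rewrite ge_min lexx ?orbT.
have bc (r t : R) x y : ball u r x -> ball u r y -> 0 <= t <= 1 -> ball u r (x + t *: (y - x)).
  rewrite -ball_normE /= => ux uy /andP[t0 t1].
  have -> : u - (x + t *: (y - x)) = (1 - t) *: (u - x) + t *: (u - y).
    rewrite [LHS]surjective_pairing [RHS]surjective_pairing /=.
    by congr pair; rewrite /GRing.scale /=; ring.
  apply: le_lt_trans (ler_normD _ _) _; rewrite !normrZ (ger0_norm t0) ger0_norm ?subr_ge0 //.
  have [->|t00] := eqVneq t 0; first by rewrite subr0 mul1r mul0r addr0.
  have tp : 0 < t by rewrite lt_def t00.
  have -> : r = (1 - t) * r + t * r by ring.
  apply: ler_ltD; last by rewrite ltr_pM2l.
  by apply: ler_wpM2l; [rewrite subr_ge0 | exact: ltW].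
have mix x y : ball u (Num.min e d) x -> ball u (Num.min e d) y -> D x -> D y ->
    g x <= 0 -> 0 <= g y -> `|F x - F y| <= (k + l) * `|x - y|.
  move=> bx by_ Dx Dy gx gy.
  have cp : {within `[0, 1], continuous (fun t : R => g (x + t *: (y - x)))}.
    have cl : continuous (fun t : R => x + t *: (y - x)).
      by move=> t; apply: cvgD; [exact: cvg_cst | exact: scalel_continuous].
    by apply: continuous_subspaceT => t; apply: continuous_comp; [exact: cl | exact: cg].
  have h01 : Num.min (g (x + 0 *: (y - x))) (g (x + 1 *: (y - x))) <= 0 <=
      Num.max (g (x + 0 *: (y - x))) (g (x + 1 *: (y - x))).
    by rewrite scale0r addr0 scale1r subrKC ge_min gx le_max gy orbT.
  have [t] := IVT ler01 cp h01; rewrite in_itv /= => t01 gt.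
  set z := x + t *: (y - x) in gt.
  have Dz : D z by exact: Dc.
  have bz : ball u (Num.min e d) z by exact: bc.
  have h1 : `|F x - F z| <= k * `|x - z|.
    by apply: Fl; rewrite ?gt //; [case: (me _ bx) | case: (me _ bz) | split; rewrite /= ?gt].
  have h2 : `|F z - F y| <= l * `|z - y|.
    by apply: Gl; rewrite ?gt //; [case: (me _ bz) | case: (me _ by_) | split; rewrite /= ?gt].
  have /andP[t0 t1] := t01.
  have xz : `|x - z| <= `|x - y|.
    rewrite /z opprD addrA subrr add0r -scalerN opprB normrZ ger0_norm //.
    by rewrite -[leRHS]mul1r ler_wpM2r.
  have zy : `|z - y| <= `|x - y|.
    have -> : z - y = (1 - t) *: (x - y).
      rewrite /z [LHS]surjective_pairing [RHS]surjective_pairing /=.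
      by congr pair; rewrite /GRing.scale /=; ring.
    by rewrite normrZ ger0_norm ?subr_ge0 // -[leRHS]mul1r ler_wpM2r // gerBl.
  have -> : F x - F y = (F x - F z) + (F z - F y) by rewrite addrA subrK.
  apply: le_trans (ler_normD _ _) _; rewrite mulrDl; apply: lerD.
    by apply: le_trans h1 _; rewrite ler_wpM2l.
  by apply: le_trans h2 _; rewrite ler_wpM2l.
exists (k + l), (Num.min e d); split=> //; [exact: addr_ge0 | by rewrite lt_min e0 | |].
  move=> x /me[xe xd] Dx; have [gx|gx] := leP (g x) 0.
    by apply: le_trans (Fb x xe _) _ => //; rewrite lerDl.
  by apply: le_trans (Gb x xd _) _; [split=> //; exact: ltW | rewrite lerDr].
move=> x y bx by_ Dx Dy; have [xe xd] := me _ bx; have [ye yd] := me _ by_.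
have [gx|gx] := leP (g x) 0; have [gy|gy] := leP (g y) 0.
- by apply: le_trans (Fl x y xe ye _ _) _ => //; rewrite ler_wpM2r // lerDl.
- by apply: mix => //; exact: ltW.
- by rewrite distrC [`|x - y|]distrC; apply: mix => //; exact: ltW.
- by apply: le_trans (Gl x y xd yd _ _) _; [split=> //; exact: ltW | split=> //; exact: ltW | rewrite ler_wpM2r // lerDr].
Qed.

Lemma llip_lipschitz (V : normedModType R) D (F : R * R -> V) u : llip D F u ->
  exists k : R, exists2 W : set (R * R), nbhs u W & k.-lipschitz_(W `&` D) F.
Proof.
move=> [k [e [k0 e0 Fb Fl]]]; exists k, (ball u e); first exact: nbhsx_ballx.
by move=> [x y] [/= [bx Dx] [by_ Dy]]; exact: Fl.
Qed.

End LocallyLipschitz.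

(** * The map is Lipschitz in every chart *)

Section MapLipschitz.
Context {R : realType}.
Variables (f : bool) (p q N : nat).
Hypotheses (p0 : (0 < p)%N) (pq : (p < q)%N) (N8 : (8 <= N)%N).
Let n : R := N%:R.
Let c : R := n^-1.
Let P : R := p%:R.
Let Q : R := q%:R.
Implicit Types (u v w : R * R) (D : set (R * R)).

(** The bound [c <= 1 / 8] keeps both radii positive on the cells: where [K >= 1 / 2 - c] and
    [H <= c], it gives [P K - H >= P (1 / 2 - c) - c >= P / 4]. *)
Lemma params : [/\ 8 <= n, 0 < c, c <= 1 / 8, 1 <= P & P + 1 <= Q].
Proof.
have n8 : 8 <= n by rewrite ler_nat.
have n0 : 0 < n by lra.
split=> //; first by rewrite invr_gt0.
- by rewrite /c -[X in _ <= X]/(1 * 8^-1) mul1r lef_pV2 ?posrE //; lra.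
- by rewrite -[1]/(1%:R) ler_nat.
- by rewrite -[1]/(1%:R) -natrD ler_nat addn1.
Qed.

Lemma llip_polf D (a al b be : R * R -> R) u : llip D a u -> llip D al u ->
  llip D b u -> llip D be u -> llip D (fun w => polf f (a w) (al w) (b w) (be w)) u.
Proof.
have H (a' al' b' be' : R * R -> R) : llip D a' u -> llip D al' u ->
    llip D b' u -> llip D be' u -> llip D (fun w => pol (a' w) (al' w) (b' w) (be' w)) u.
  move=> ha hal hb hbe; apply: llip_row => k.
  case: k => -[|[|[|[|//]]]] i.
  - by apply: llip_ext (llipM ha (llip_cos hal)) => w _; rewrite mxE.
  - by apply: llip_ext (llipM ha (llip_sin hal)) => w _; rewrite mxE.
  - by apply: llip_ext (llipM hb (llip_cos hbe)) => w _; rewrite mxE.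
  - by apply: llip_ext (llipM hb (llip_sin hbe)) => w _; rewrite mxE.
move=> ha hal hb hbe; rewrite /polf; case: f.
  by apply: H => //; apply: llipD => //; exact: llip_cst.
by apply: H => //; apply: llipD => //; exact: llip_cst.
Qed.

Lemma llipZ D (k : R) (F : R * R -> R) u : llip D F u -> llip D (fun w => k * F w) u.
Proof. by move=> h; apply: llipM => //; exact: llip_cst. Qed.

(* The arguments of the square roots stay away from 0 on the cells. *)
Lemma moment_bounds (H K : R) : 0 <= H <= c -> `|K - 1 / 2| <= c ->
  P / (2 * (P + Q)) <= 2 * (Q * K + H) / (P + Q) /\
  P / (2 * (P + Q)) <= 2 * (P * K - H) / (P + Q).
Proof.
have [n8 c0 c8 P1 PQ] := params.
move=> /andP[H0 Hc]; rewrite ler_norml => /andP[K0 K1].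
have PQ0 : 0 < P + Q by lra.
have -> : P / (2 * (P + Q)) = (P / 2) / (P + Q) by field; lra.
rewrite !ler_pM2r ?invr_gt0 //.
have K38 : 3 / 8 <= K by lra.
have h1 : Q * (3 / 8) <= Q * K by apply: ler_wpM2l => //; lra.
have h2 : P * (1 / 2 - c) <= P * K by apply: ler_wpM2l => //; lra.
have h3 : P * c <= P * (1 / 8) by apply: ler_wpM2l => //; lra.
by split; lra.
Qed.

Lemma llip_action_angle D (H th K psi : R * R -> R) u :
  (\forall w \near u, D w -> 0 <= H w <= c /\ `|K w - 1 / 2| <= c) ->
  llip D H u -> llip D th u -> llip D K u -> llip D psi u ->
  llip D (fun w => action_angle f p q (H w) (th w) (K w) (psi w)) u.
Proof.
have [n8 c0 c8 P1 PQ] := params.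
move=> bd lH lth lK lpsi.
have d0 : 0 < P / (2 * (P + Q)) by rewrite divr_gt0 //; lra.
have Vc (F : R * R -> R) : llip D F u -> llip D (fun w => 2 * F w / (P + Q)) u.
  by move=> lF; apply: llipM; [exact: llipZ | exact: llip_cst].
apply: llip_polf.
- apply: (llip_sqrt d0).
    by apply: filterS bd => w h /h[h1 h2]; have [] := moment_bounds h1 h2.
  by apply: (Vc (fun w => Q * K w + H w)); apply: llipD => //; exact: llipZ.
- by apply: llipD => //; exact: llipZ.
- apply: (llip_sqrt d0).
    by apply: filterS bd => w h /h[h1 h2]; have [] := moment_bounds h1 h2.
  by apply: (Vc (fun w => P * K w - H w)); apply: llipD; [exact: llipZ | exact: llipN].
- by apply: llipD => //; apply: llipN; exact: llipZ.
Qed.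

Lemma cell_sin_le1 (x : R) : `|cell_sin x| <= 1. Proof. exact: sin_max. Qed.
Lemma cell_cos_le1 (x : R) : `|cell_cos x| <= 1. Proof. exact: cos_max. Qed.

Lemma cell_bounds b (k x : R) : `|k| <= 1 ->
  0 <= c / 2 + c / 2 * cell_X b k x <= c /\
  `|1 / 2 + cell_sg b * (c * cell_cos x * cos (pi / 2 * k)) - 1 / 2| <= c.
Proof.
have [n8 c0 c8 P1 PQ] := params.
move=> k1.
have X1 : `|cell_X b k x| <= 1.
  rewrite /cell_X; case: b; last exact: cell_sin_le1.
  by rewrite normrM mulr_ile1 //; exact: cell_sin_le1.
split.
  move: X1; rewrite ler_norml => /andP[X0 X1].
  have h1 : c / 2 * -1 <= c / 2 * cell_X b k x by apply: ler_wpM2l => //; lra.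
  have h2 : c / 2 * cell_X b k x <= c / 2 * 1 by apply: ler_wpM2l => //; lra.
  by apply/andP; split; lra.
rewrite addrAC subrr add0r !normrM (gtr0_norm c0).
have -> : `|cell_sg b| = 1 :> R by rewrite /cell_sg; case: (b); rewrite ?normrN normr1.
have c0' := ltW c0; rewrite mul1r -mulrA -[leRHS]mulr1 ler_wpM2l //.
by rewrite mulr_ile1 //; [exact: cell_cos_le1 | exact: cos_max].
Qed.

Lemma llip_cell D b (xi : R) (k x : R * R -> R) u :
  (\forall w \near u, D w -> `|k w| <= 1) -> llip D k u -> llip D x u ->
  llip D (fun w => cell f p q N b xi (k w) (x w)) u.
Proof.
move=> k1 lk lx.
have lS : llip D (fun w => cell_sin (x w)) u.
  by apply: llip_sin; apply: llipZ; apply: llipM => //; exact: llip_norm.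
have lC : llip D (fun w => cell_cos (x w)) u.
  by apply: llip_cos; apply: llipZ; exact: llipM.
have lX b' : llip D (fun w => cell_X b' (k w) (x w)) u.
  by rewrite /cell_X; case: b' => //; exact: llipM.
have lck : llip D (fun w => cos (pi / 2 * k w)) u by apply: llip_cos; exact: llipZ.
have lsk : llip D (fun w => sin (pi / 2 * k w)) u by apply: llip_sin; exact: llipZ.
apply: llip_action_angle.
- apply: filterS k1 => w h /h h1.
  have [h2 _] := cell_bounds (~~ b) (x w) h1; have [_ h3] := cell_bounds b (x w) h1.
  by split.
- by apply: llipD; [exact: llip_cst | exact: llipZ].
- by apply: llipZ; apply: llipD => //; exact: llip_cst.
- apply: llipD; first exact: llip_cst.
  by apply: llipZ; apply: llipM => //; exact: llipZ.
- by apply: llipN; apply: llipM => //; exact: llipZ.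
Qed.

Lemma llip_annulus D u : llip D (annulus_map f p q N) u.
Proof.
have [n8 c0 c8 P1 PQ] := params.
have lb : llip D (fun w => annulus_radius p q N w.2) u.
  by apply: llipZ; apply: llipD; [exact: llip_cst | apply: llipN; exact: llip_snd].
have lth : llip D (fun w => pi / n * w.1) u by apply: llipZ; exact: llip_fst.
apply: llip_polf => //.
- apply: (@llip_sqrt _ _ _ _ (2 * c / P)).
  + by rewrite divr_gt0 //; lra.
  + apply: filterE => w _; rewrite ler_pM2r ?invr_gt0; last by lra.
    by rewrite lerDl mulr_ge0 ?sqr_ge0 //; lra.
  + apply: llipM; last exact: llip_cst.
    apply: llipD; first exact: llip_cst.
    apply: llipZ; apply: llip_ext (llipM lb lb) => w _; by rewrite expr2.
- exact: llipZ.
- by apply: llipN; exact: llipZ.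
Qed.

Lemma llip_core D u : llip D (core_map f p N) u.
Proof.
have lth : llip D (fun w => pi / n * w.1) u by apply: llipZ; exact: llip_fst.
have l4 : llip D (fun w : R * R => pi / 2 * (4 - w.2)) u.
  by apply: llipZ; apply: llipD; [exact: llip_cst | apply: llipN; exact: llip_snd].
apply: llip_polf.
- by apply: llipZ; exact: llip_sin.
- exact: llipZ.
- by apply: llipZ; exact: llip_cos.
- by apply: llipM => //; exact: llip_cst.
Qed.

Lemma cell_sin1 : cell_sin (1 : R) = 1.
Proof. by rewrite /cell_sin normr1 !mulr1 sin_pihalf. Qed.

Lemma cell_sinN (x : R) : cell_sin (- x) = - cell_sin x.
Proof. by rewrite /cell_sin normrN mulNr mulrN sinN. Qed.

(** On the border of the square [cell_cos] vanishes and the circle has shrunk to the point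
    [K = 1 / 2], [psi = 0]. What remains is affine in [(X, Y)] and does not depend on the slope, so
    a cell fits its neighbours, the annulus and the link of the cone. *)
Lemma cell_edge (xi X Y : R) : Num.max `|X| `|Y| = 1 ->
  cell_map f p q N xi (xi + X, 1 + Y) =
  action_angle f p q (c / 2 + c / 2 * Y) (pi / n * (xi + X)) (1 / 2) 0.
Proof.
move=> XY; rewrite /cell_map /=.
have E (a b : R) : a + b - a = b by ring.
rewrite !E.
have unit_ (x : R) : `|x| = 1 -> cell_sin x = x /\ cell_cos x = 0.
  move=> x1; have [->|->] : x = 1 \/ x = -1.
    move: x1; have [x0|x0] := leP 0 x; first by rewrite ger0_norm // => ->; left.
    by rewrite ltr0_norm // => h; right; rewrite -h opprK.
    by rewrite cell_sin1 /cell_cos !mulr1 cos_pihalf.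
  by rewrite cell_sinN cell_sin1 /cell_cos mulrNN !mulr1 cos_pihalf.
case: ifP => YX.
  have X1 : `|X| = 1 by rewrite -XY; apply/esym/max_idPl.
  have X0 : X != 0 by rewrite -normr_gt0 X1.
  have [sX cX] := unit_ X X1.
  by rewrite /cell /cell_X /= sX cX divfK // !(mulr0, mul0r) oppr0 addr0.
have XY' : `|X| <= `|Y| by rewrite ltW // ltNge YX.
have Y1 : `|Y| = 1 by rewrite -XY; apply/esym/max_idPr.
have Y0 : Y != 0 by rewrite -normr_gt0 Y1.
have [sY cY] := unit_ Y Y1.
by rewrite /cell /cell_X /= sY cY divfK // !(mulr0, mul0r) oppr0 addr0.
Qed.

Lemma cell_annulus (xi s : R) : `|s - xi| <= 1 ->
  cell_map f p q N xi (s, 2) = annulus_map f p q N (s, 2).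
Proof.
have [n8 c0 c8 P1 PQ] := params.
move=> s1; rewrite -[s](subrKC xi) -[2](_ : 1 + 1 = 2); last by ring.
rewrite cell_edge; last by rewrite normr1; apply/max_idPr.
rewrite subrKC /action_angle /annulus_map /annulus_radius /= -/n -/c -/P -/Q.
have PQ0 : P + Q != 0 by rewrite gt_eqF //; lra.
have P0 : P != 0 by rewrite gt_eqF //; lra.
have B0 : 0 <= (P - 2 * c) / (P + Q) by rewrite divr_ge0 //; lra.
have e1 : 3 - (1 + 1) = 1 :> R by ring.
rewrite e1 !mulr1 sqr_sqrtr // !addr0; congr polf; congr Num.sqrt; field; rewrite ?PQ0 ?P0 //.
Qed.

(** The two pieces use different angles for [w], which does not matter since [w = 0] there. *)
Lemma annulus_core (s : R) : annulus_map f p q N (s, 3) = core_map f p N (s, 3).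
Proof.
rewrite /annulus_map /core_map /annulus_radius /= subrr mulr0.
have -> : pi / 2 * (4 - 3) = pi / 2 :> R by ring.
rewrite sin_pihalf cos_pihalf !mulr0 expr0n mulr0 addr0 mulr1.
by rewrite /polf; case: f; apply/matrixP => i k; rewrite !mxE !mul0r.
Qed.

Lemma cdist_center (j : int) : cdist (2 * j%:~R + 1, 1 : R) = 0.
Proof.
rewrite /cdist /= subrr expr0n add0r.
have -> : pi / 2 * (2 * j%:~R + 1) = pi / 2 + j%:~R * pi :> R by field.
by rewrite cosDintpi cos_pihalf mul0r expr0n.
Qed.

Let conv (a b t : R) : a + t * (b - a) = (1 - t) * a + t * b. Proof. ring. Qed.

Let conv_le (a b t m : R) : a <= m -> b <= m -> 0 <= t <= 1 -> a + t * (b - a) <= m.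
Proof.
move=> am bm /andP[t0 t1]; rewrite conv.
have h1 : (1 - t) * a <= (1 - t) * m by apply: ler_wpM2l => //; lra.
have h2 : t * b <= t * m by exact: ler_wpM2l.
by lra.
Qed.

Let conv_ge (a b t m : R) : m <= a -> m <= b -> 0 <= t <= 1 -> m <= a + t * (b - a).
Proof.
move=> am bm /andP[t0 t1]; rewrite conv.
have h1 : (1 - t) * m <= (1 - t) * a by apply: ler_wpM2l => //; lra.
have h2 : t * m <= t * b by exact: ler_wpM2l.
by lra.
Qed.

Let csub1 (a : R) : continuous (fun w : R * R => w.1 - a).
Proof. by move=> w; apply: cvgB; [exact: cvg_fst | exact: cvg_cst]. Qed.
Let csub2 (a : R) : continuous (fun w : R * R => w.2 - a).
Proof. by move=> w; apply: cvgB; [exact: cvg_snd | exact: cvg_cst]. Qed.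

Lemma llip_cell_map (xi : R) D u :
  (forall x y (t : R), D x -> D y -> 0 <= t <= 1 -> D (x + t *: (y - x))) ->
  u <> (xi, 1) -> llip D (cell_map f p q N xi) u.
Proof.
move=> Dc uxi.
pose X (w : R * R) := w.1 - xi; pose Y (w : R * R) := w.2 - 1.
have lX D' : llip D' X u by apply: llipD; [exact: llip_fst | exact: llip_cst].
have lY D' : llip D' Y u by apply: llipD; [exact: llip_snd | exact: llip_cst].
have cX : continuous X by exact: csub1.
have cY : continuous Y by exact: csub2.
have cg : continuous (fun w => `|Y w| - `|X w|).
  by move=> w; apply: cvgB; apply: cvg_norm; [exact: cY | exact: cX].
have half (Z : R * R -> R) : continuous Z -> Z u != 0 -> \forall w \near u, `|Z u| / 2 <= `|Z w|.
  move=> cZ Z0; have zp : 0 < `|Z u| by rewrite normr_gt0.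
  have o : open [set w | `|Z u| / 2 < `|Z w|].
    by apply: open_ltf => w; [exact: cvg_cst | apply: cvg_norm; exact: cZ].
  have hu : `|Z u| / 2 < `|Z u| by lra.
  by apply: filterS (open_nbhs_nbhs (conj o hu)) => w /ltW.
apply: (llip_paste (g := fun w => `|Y w| - `|X w|)) => //.
  (* On the axis [X = 0], away from the centre, the region [|Y| <= |X|] does not come near [u];
     otherwise [X] is bounded away from 0 and the slope is Lipschitz. *)
  have [X0|X0] := eqVneq (X u) 0.
    apply: llip_empty.
    have Y0 : 0 < `|Y u|.
      rewrite normr_gt0 subr_eq0; apply/eqP => Y1; apply: uxi.
      by rewrite [u]surjective_pairing Y1; congr pair; apply/eqP; rewrite -subr_eq0 -[_ - _]/(X u) X0.
    have o : open [set w | 0 < `|Y w| - `|X w|].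
      by apply: open_ltf => w; [exact: cvg_cst | exact: cg].
    have hu : 0 < `|Y u| - `|X u| by rewrite X0 normr0 subr0.
    by apply: filterS (open_nbhs_nbhs (conj o hu)) => w /= h [_ /=]; rewrite leNgt h.
  apply: (llip_ext (F := fun w => cell f p q N false xi (Y w / X w) (X w))).
    by move=> w [_ /=]; rewrite subr_le0 /cell_map => ->.
  have d0 : 0 < `|X u| / 2 by rewrite divr_gt0 ?normr_gt0.
  apply: llip_cell => //.
    apply: filterS (half X cX X0) => w Xw [_ /=]; rewrite subr_le0 => YX.
    have Xw0 : 0 < `|X w| by exact: lt_le_trans Xw.
    by rewrite normrM normfV ler_pdivrMr // mul1r.
  apply: llipM => //; apply: (llipV d0) => //.
  by apply: filterS (half X cX X0).
have [Y0|Y0] := eqVneq (Y u) 0.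
  apply: llip_empty.
  have X0 : 0 < `|X u|.
    rewrite normr_gt0 subr_eq0; apply/eqP => X1; apply: uxi.
    by rewrite [u]surjective_pairing X1; congr pair; apply/eqP; rewrite -subr_eq0 -[_ - _]/(Y u) Y0.
  have o : open [set w | `|Y w| - `|X w| < 0].
    by apply: open_ltf => w; [exact: cg | exact: cvg_cst].
  have hu : `|Y u| - `|X u| < 0 by rewrite Y0 normr0 sub0r oppr_lt0.
  by apply: filterS (open_nbhs_nbhs (conj o hu)) => w /= h [_ /=]; rewrite leNgt h.
have d0 : 0 < `|Y u| / 2 by rewrite divr_gt0 ?normr_gt0.
apply: (llip_near (F := fun w => cell f p q N true xi (X w / Y w) (Y w))).
  apply: filterS (half Y cY Y0) => w Yw [_ /=]; rewrite subr_ge0 /cell_map => XY.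
  have Yw0 : 0 < `|Y w| by exact: lt_le_trans Yw.
  case: ifP => // YX.
  have XYe : `|X w| = `|Y w| by apply/eqP; rewrite eq_le XY.
  have X0 : X w != 0 by rewrite -normr_gt0 XYe.
  have Yn : Y w != 0 by rewrite -normr_gt0.
  have k1 : `|Y w / X w| = 1 by rewrite normrM normfV XYe divff // gt_eqF.
  have cd := cell_diag f p q N xi (X w) k1; rewrite divfK // in cd; rewrite -cd.
  have sq : X w * X w = Y w * Y w.
    by rewrite -!expr2 -[X w ^+ 2]real_normK ?num_real // XYe real_normK ?num_real.
  have kE : X w / Y w = Y w / X w by apply: (mulIf Yn); rewrite divfK // mulrAC -sq mulfK.
  by rewrite kE.
apply: llip_cell => //.
  apply: filterS (half Y cY Y0) => w Yw [_ /=]; rewrite subr_ge0 => XY.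
  have Yw0 : 0 < `|Y w| by exact: lt_le_trans Yw.
  by rewrite normrM normfV ler_pdivrMr // mul1r.
apply: llipM => //; apply: (llipV d0) => //.
by apply: filterS (half Y cY Y0).
Qed.

Lemma cell_center_floor (j : int) (s : R) : 2 * j%:~R <= s < 2 * j%:~R + 2 ->
  cell_center s = 2 * j%:~R + 1.
Proof.
move=> /andP[h1 h2]; rewrite /cell_center (floor_def (m := j)) //.
by rewrite intrD; apply/andP; split; lra.
Qed.

Lemma llip_cells u : 0 < cdist u ->
  llip [set w | 0 <= w.2 /\ w.2 <= 2] (fun w => cell_map f p q N (cell_center w.1) w) u.
Proof.
move=> cu; set D := [set w | _].
(* [2 m] is a cell edge nearest to [u.1], so that only the cells on its two sides come near [u]. *)
pose m := Num.floor ((u.1 + 1) / 2).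
have mu : 2 * m%:~R - 1 <= u.1 < 2 * m%:~R + 1.
  have := floor_itv ((u.1 + 1) / 2); rewrite -/m intrD => /andP[h1 h2].
  by apply/andP; split; lra.
have /andP[mu1 mu2] := mu.
(* The upper bound stays short of [2 m + 2], where [cell_center] jumps to the next cell; at the
   lower bound [2 m - 2] it already has the value of the left cell. *)
pose Dm := [set w : R * R | (0 <= w.2 /\ w.2 <= 2) /\ (2 * m%:~R - 2 <= w.1 /\ w.1 <= 2 * m%:~R + 2 - 1 / 2)].
have DmC x y (t : R) : Dm x -> Dm y -> 0 <= t <= 1 -> Dm (x + t *: (y - x)).
  move=> [[x1 x2] [x3 x4]] [[y1 y2] [y3 y4]] t01; rewrite /Dm /= /GRing.scale /=.
  by split; split; first [exact: conv_ge | exact: conv_le].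
have near_w : \forall w \near u, 2 * m%:~R - 2 < w.1 /\ w.1 < 2 * m%:~R + 2 - 1 / 2.
  have o1 : open [set w : R * R | 2 * m%:~R - 2 < w.1].
    by apply: open_ltf => w; [exact: cvg_cst | exact: cvg_fst].
  have o2 : open [set w : R * R | w.1 < 2 * m%:~R + 2 - 1 / 2].
    by apply: open_ltf => w; [exact: cvg_fst | exact: cvg_cst].
  have h1 : 2 * m%:~R - 2 < u.1 by lra.
  have h2 : u.1 < 2 * m%:~R + 2 - 1 / 2 by lra.
  exact: open_nbhs_nbhs (conj (openI o1 o2) (conj h1 h2)).
apply: (llip_sub (D := Dm)).
  by apply: filterS near_w => w [h1 h2] Dw; split=> //; split; exact: ltW.
have ne (j : int) : u <> (2 * j%:~R + 1, 1).
  by move=> e; move: cu; rewrite e cdist_center ltxx.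
have mB : (m - 1)%:~R = m%:~R - 1 :> R by rewrite intrB.
apply: (llip_paste (g := fun w => w.1 - 2 * m%:~R) DmC); first exact: csub1.
  apply: (llip_ext (F := cell_map f p q N (2 * (m - 1)%:~R + 1))).
    move=> [s y] [[[y0 y2] [s1 s2]] /=]; rewrite subr_le0 /= in s1 s2 y0 y2 * => s3.
    have [e|ne'] := eqVneq s (2 * m%:~R); last first.
      have s3' : s < 2 * m%:~R by rewrite lt_neqAle ne' s3.
      by rewrite (cell_center_floor (j := m - 1)) // mB; apply/andP; split; lra.
    rewrite (cell_center_floor (j := m)); last by apply/andP; split; lra.
    have y1 : `|y - 1| <= 1 by rewrite ler_norml; apply/andP; split; lra.
    rewrite -[y](subrKC 1).
    have -> : s = 2 * (m - 1)%:~R + 1 + 1 by rewrite mB e; ring.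
    rewrite cell_edge; last by rewrite normr1; apply/max_idPl.
    have -> : 2 * (m - 1)%:~R + 1 + 1 = 2 * m%:~R + 1 + (-1) :> R by rewrite mB; ring.
    by rewrite cell_edge // normrN normr1; apply/max_idPl.
  apply: llip_cell_map; last exact: ne.
  move=> x y t [Dx gx] [Dy gy] t01; split; first exact: DmC.
  rewrite /= subr_le0 in gx; rewrite /= subr_le0 in gy.
  by rewrite /= /GRing.scale /= subr_le0; apply: conv_le.
apply: (llip_ext (F := cell_map f p q N (2 * m%:~R + 1))).
  move=> [s y] [[[y0 y2] [s1 s2]] /=]; rewrite subr_ge0 /= in s1 s2 y0 y2 * => s3.
  by rewrite (cell_center_floor (j := m)) //; apply/andP; split; lra.
apply: llip_cell_map; last exact: ne.
move=> x y t [Dx gx] [Dy gy] t01; split; first exact: DmC.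
rewrite /= subr_ge0 in gx; rewrite /= subr_ge0 in gy.
by rewrite /= /GRing.scale /= subr_ge0; apply: conv_ge.
Qed.

Lemma llip_strip u : 0 < cdist u -> u.2 < 5 ->
  llip [set w | 0 <= w.2] (strip_map f p q N) u.
Proof.
have [n8 c0 c8 P1 PQ] := params.
move=> cu u5.
apply: (llip_paste (g := fun w => w.2 - 4)); last 2 first.
- pose D := [set w : R * R | 0 <= w.2 /\ w.2 <= 4].
  apply: (llip_sub (D := D)).
    by apply: filterE => w [/= w0]; rewrite subr_le0.
  apply: (llip_ext (F := half_strip_map f p q N)).
    by move=> w [_ w4]; rewrite /strip_map w4.
  have Dc x y (t : R) : D x -> D y -> 0 <= t <= 1 -> D (x + t *: (y - x)).
    move=> [x1 x2] [y1 y2] t01; rewrite /D /= /GRing.scale /=.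
    by split; [exact: conv_ge | exact: conv_le].
  apply: (llip_paste (g := fun w => w.2 - 2) Dc); first exact: csub2.
    apply: (llip_sub (D := [set w | 0 <= w.2 /\ w.2 <= 2])).
      by apply: filterE => w [[w0 _] /=]; rewrite subr_le0.
    apply: llip_ext (llip_cells cu) => w [w0 w2].
    by rewrite /half_strip_map w2.
  pose F w := if w.2 <= 3 then annulus_map f p q N w else core_map f p N w.
  apply: (llip_ext (F := F)).
    move=> [s y] [[/= y0 y4]]; rewrite subr_ge0 => y2; rewrite /half_strip_map /F /=.
    have [y2'|y2'] := leP y 2; last by [].
    have -> : y = 2 by lra.
    have -> : 2 <= 3 :> R by lra.
    rewrite cell_annulus // /cell_center.
    have := floor_itv (s / 2); rewrite intrD => /andP[h1 h2].
    by rewrite ler_norml; apply/andP; split; lra.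
  apply: (llip_sub (D := setT)); first exact: filterE.
  apply: (llip_paste (g := fun w => w.2 - 3)); [by []|exact: csub2| |].
    apply: llip_ext (llip_annulus _ u) => w [_ /=]; rewrite subr_le0 /F => ->.
    by [].
  apply: llip_ext (llip_core _ u) => -[s y] [_ /=]; rewrite subr_ge0 /F /= => y3.
  case: ifP => // y3'; have -> : y = 3 by lra.
  by rewrite annulus_core.
- have o : open [set w : R * R | w.2 < 5].
    by apply: open_ltf => w; [exact: cvg_snd | exact: cvg_cst].
  pose F (w : R * R) := core_map f p N (w.1 + n, 8 - w.2).
  apply: (llip_near (F := F)).
    apply: filterS (open_nbhs_nbhs (conj o u5)) => -[s y] /= y5 [_ /=]; rewrite subr_ge0 => y4.
    rewrite /strip_map /F /=.
    have core t z : 3 < z -> half_strip_map f p q N (t, z) = core_map f p N (t, z).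
      move=> z3; rewrite /half_strip_map /=.
      by rewrite [z <= 2]leNgt [z <= 3]leNgt z3 (_ : 2 < z) //; lra.
    case: ifP => y4'; last by rewrite core //; lra.
    have -> : y = 4 by lra.
    have -> : 8 - 4 = 4 :> R by ring.
    rewrite -core; last by lra.
    by apply: half_strip_map_core; apply: leq_trans N8.
  have lth : llip ([set w : R * R | 0 <= w.2] `&` [set w | 0 <= w.2 - 4])
      (fun w => pi / n * (w.1 + n)) u.
    by apply: llipZ; apply: llipD; [exact: llip_fst | exact: llip_cst].
  have l4 : llip ([set w : R * R | 0 <= w.2] `&` [set w | 0 <= w.2 - 4])
      (fun w : R * R => pi / 2 * (4 - (8 - w.2))) u.
    apply: llipZ; apply: llipD; first exact: llip_cst.
    by apply: llipN; apply: llipD; [exact: llip_cst | apply: llipN; exact: llip_snd].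
  apply: llip_polf.
  + by apply: llipZ; exact: llip_sin.
  + exact: llipZ.
  + by apply: llipZ; exact: llip_cos.
  + by apply: llipM => //; exact: llip_cst.
- by move=> x y t /= x0 y0 t01; rewrite /GRing.scale /=; exact: conv_ge.
- exact: csub2.
Qed.

Lemma llip_cap i u : llip setT (cap_map f p q N i) u.
Proof.
have cg : continuous (fun w : R * R => `|w.1| - 1).
  by move=> w; apply: cvgB; [apply: cvg_norm; exact: cvg_fst | exact: cvg_cst].
have l1 D : llip D (fun w : R * R => w.2 - 1) u.
  by apply: llipD; [exact: llip_snd | exact: llip_cst].
apply: (llip_paste (g := fun w => `|w.1| - 1)) => //.
  apply: (llip_ext (F := fun w => cell f p q N (odd i) (cap i).*2.+1%:R w.1 (w.2 - 1))).
    by move=> w [_ /=]; rewrite subr_le0 /cap_map => ->.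
  apply: llip_cell => //; last exact: llip_fst.
  by apply: filterE => w [_ /=]; rewrite subr_le0.
apply: (llip_ext (F := fun w => cell f p q N (~~ odd i) (cap i).*2.+1%:R (w.1)^-1 (w.1 * (w.2 - 1)))).
  move=> w [_ /=]; rewrite subr_ge0 /cap_map => w1; case: ifP => // w1'.
  have e1 : `|w.1| = 1 by apply/eqP; rewrite eq_le w1' w1.
  have w0 : w.1 != 0 by rewrite -normr_gt0 e1.
  have wV : (w.1)^-1 = w.1.
    by apply: (mulfI w0); rewrite mulfV // -expr2 -real_normK ?num_real // e1 expr1n.
  rewrite wV; case: (odd i) => /=; last by rewrite cell_diag.
  have kk : w.1 * (w.1 * (w.2 - 1)) = w.2 - 1 by rewrite mulrA -{2}wV mulfV // mul1r.
  by rewrite -(cell_diag f p q N _ _ e1) kk.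
apply: llip_cell.
- apply: filterE => w [_ /=]; rewrite subr_ge0 => w1.
  by rewrite normfV invf_le1 // (lt_le_trans _ w1).
- apply: (@llipV _ _ _ _ 1) => //; last exact: llip_fst.
  by apply: filterE => w [_ /=]; rewrite subr_ge0.
- by apply: llipM => //; exact: llip_fst.
Qed.

Lemma chart_map_lipschitz i u : cdom N i u -> exists k : R,
  exists2 W : set (R * R), nbhs u W & k.-lipschitz_(W `&` cdom N i) (chart_map f p q N i).
Proof.
move=> du; apply: llip_lipschitz; rewrite /chart_map.
have [i4|i4] := boolP (i < 4)%N; last first.
  by apply: llip_sub (llip_cap i u); exact: filterE.
have [_ u5] := lft_range du; rewrite /lft i4 in u5.
apply: llip_sub (llip_strip _ u5); first by apply: filterE => w [].
by case: du; rewrite /dom_open_part i4 => -[_ []].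
Qed.

End MapLipschitz.

(** * Isotropy and area density *)

Section MapDensity.
Context {R : realType}.
Variables (f : bool) (p q N : nat).
Hypotheses (p0 : (0 < p)%N) (pq : (p < q)%N) (N8 : (8 <= N)%N).
Let n : R := N%:R.
Let c : R := n^-1.
Let P : R := p%:R.
Let Q : R := q%:R.
Implicit Types (u v w : R * R).

Let prm : [/\ 8 <= n, 0 < c, c <= 1 / 8, 1 <= P & P + 1 <= Q] := @params R p q N p0 pq N8.

Definition Qsq (a b a1 al1 b1 be1 : R) : R := Qform a b a1 al1 b1 be1 a1 al1 b1 be1.

Lemma Qsq_ge0 (a b a1 al1 b1 be1 : R) : 0 <= Qsq a b a1 al1 b1 be1.
Proof.
have -> : Qsq a b a1 al1 b1 be1 = a1 ^+ 2 + (a * al1) ^+ 2 + b1 ^+ 2 + (b * be1) ^+ 2.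
  by rewrite /Qsq /Qform; ring.
by rewrite !addr_ge0 // sqr_ge0.
Qed.

(* Both sides scale by the determinant of a change of coordinates
   [(k, x) = (k w, x w)], so the density is bounded in the coordinates [(k, x)]. *)
Lemma polf_local (F : R * R -> 'rV[R]_4) (a al b be : R * R -> R) (k x : R * R -> R) u
    k1 k2 x1 x2 a1 a2 al1 al2 b1 b2 be1 be2 :
  (\forall w \near u, polf f (a (k w, x w)) (al (k w, x w)) (b (k w, x w)) (be (k w, x w)) = F w) ->
  grad k u k1 k2 -> grad x u x1 x2 ->
  grad a (k u, x u) a1 a2 -> grad al (k u, x u) al1 al2 ->
  grad b (k u, x u) b1 b2 -> grad be (k u, x u) be1 be2 ->
  let A := a (k u, x u) in let B := b (k u, x u) in
  omega (partial1 F u) (partial2 F u) =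
    (k1 * x2 - k2 * x1) * (A * (a1 * al2 - a2 * al1) + B * (b1 * be2 - b2 * be1)) /\
  area_density F u <= `|k1 * x2 - k2 * x1| *
    Num.sqrt (Qsq A B a1 al1 b1 be1 * Qsq A B a2 al2 b2 be2).
Proof.
move=> nF gk gx ga gal gb gbe A B.
have [-> ->] := polf_near_partials nF (grad_comp2 ga gk gx) (grad_comp2 gal gk gx)
  (grad_comp2 gb gk gx) (grad_comp2 gbe gk gx).
split; first by rewrite -/A -/B; ring.
rewrite -sqrtr_sqr -sqrtrM ?sqr_ge0 //; apply: ler_wsqrtr; rewrite -/A -/B -subr_ge0.
set L := (X in 0 <= X).
have -> : L = ((k1 * x2 - k2 * x1) * Qform A B a1 al1 b1 be1 a2 al2 b2 be2) ^+ 2.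
  by rewrite /L /Qsq /Qform; ring.
exact: sqr_ge0.
Qed.

(** The radii are bounded and, by [moment_bounds], stay away from 0, so the metric is at most a
    constant times the euclidean metric in [(H, th, K, psi)]. The density is then controlled by the
    sizes [M1] and [M2] of the two partial derivatives. The right-hand side for [omega] is the form
    [dH dth + dK dpsi]. *)
Lemma action_angle_local (F : R * R -> 'rV[R]_4) (H th K psi : R * R -> R) (k x : R * R -> R) u
    k1 k2 x1 x2 H1 H2 th1 th2 K1 K2 psi1 psi2 (M1 M2 : R) :
  (\forall w \near u, action_angle f p q (H (k w, x w)) (th (k w, x w)) (K (k w, x w)) (psi (k w, x w)) = F w) ->
  grad k u k1 k2 -> grad x u x1 x2 ->
  grad H (k u, x u) H1 H2 -> grad th (k u, x u) th1 th2 ->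
  grad K (k u, x u) K1 K2 -> grad psi (k u, x u) psi1 psi2 ->
  0 <= H (k u, x u) <= c -> `|K (k u, x u) - 1 / 2| <= c ->
  0 <= M1 -> 0 <= M2 ->
  `|H1| <= M1 -> `|th1| <= M1 -> `|K1| <= M1 -> `|psi1| <= M1 ->
  `|H2| <= M2 -> `|th2| <= M2 -> `|K2| <= M2 -> `|psi2| <= M2 ->
  omega (partial1 F u) (partial2 F u) =
    (k1 * x2 - k2 * x1) * ((H1 * th2 - H2 * th1) + (K1 * psi2 - K2 * psi1)) /\
  area_density F u <= `|k1 * x2 - k2 * x1| *
    (M1 * M2 * (4 * (P + Q) / P + 2 * (P + 1) ^+ 2 + 2 * (Q + 1) ^+ 2)).
Proof.
have [n8 c0 c8 P1 PQ] := prm.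
move=> nF gk gx gH gth gK gpsi Hb Kb M10 M20 H1b th1b K1b psi1b H2b th2b K2b psi2b.
have [Ab Bb] := moment_bounds p0 pq N8 Hb Kb.
set z := (k u, x u) in gH gth gK gpsi Hb Kb Ab Bb.
have PQ0 : 0 < P + Q by lra.
have [P0 Q0 PQ1 PQ2] : [/\ 0 <= P, 0 <= Q, P + 1 <= P + Q & Q + 1 <= P + Q] by split; lra.
have d0 : 0 < P / (2 * (P + Q)) by rewrite divr_gt0 //; lra.
pose A w := 2 * (Q * K w + H w) / (P + Q).
pose B w := 2 * (P * K w - H w) / (P + Q).
have A0 : 0 < A z by exact: lt_le_trans Ab.
have B0 : 0 < B z by exact: lt_le_trans Bb.
have gA : grad A z (2 * (Q * K1 + H1) / (P + Q)) (2 * (Q * K2 + H2) / (P + Q)).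
  have g := gradM (gradZ 2 (gradD (gradZ Q gK) gH)) (grad_cst (P + Q)^-1 z).
  by apply: grad_eq g _ _; rewrite mulr0 addr0.
have gB : grad B z (2 * (P * K1 - H1) / (P + Q)) (2 * (P * K2 - H2) / (P + Q)).
  have g := gradM (gradZ 2 (gradB (gradZ P gK) gH)) (grad_cst (P + Q)^-1 z).
  by apply: grad_eq g _ _; rewrite mulr0 addr0.
have gal : grad (fun w => P * th w + psi w) z (P * th1 + psi1) (P * th2 + psi2).
  exact: gradD (gradZ P gth) gpsi.
have gbe : grad (fun w => - (Q * th w) + psi w) z (- (Q * th1) + psi1) (- (Q * th2) + psi2).
  exact: gradD (gradN (gradZ Q gth)) gpsi.
have [-> D] := polf_local nF gk gx (grad_sqrt A0 gA) gal (grad_sqrt B0 gB) gbe.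
rewrite -/z; have sA := sqr_sqrtr (ltW A0); have sB := sqr_sqrtr (ltW B0).
have rA : 0 < Num.sqrt (A z) by rewrite sqrtr_gt0.
have rB : 0 < Num.sqrt (B z) by rewrite sqrtr_gt0.
split.
  congr (_ * _).
  have rA0 := negbT (gt_eqF rA); have rB0 := negbT (gt_eqF rB); have PQn := negbT (gt_eqF PQ0).
  by field; rewrite PQn rA0 rB0.
apply: le_trans D _; apply: ler_wpM2l => //.
set E := 4 * (P + Q) / P + _ + _.
have abs_le (M y1 y2 : R) : `|y1| <= M -> `|y2| <= M -> forall s t : R, 0 <= s -> 0 <= t ->
    `|s * y1 + t * y2| <= (s + t) * M.
  move=> h1 h2 s t s0 t0; apply: le_trans (ler_normD _ _) _.
  rewrite !normrM (ger0_norm s0) (ger0_norm t0) mulrDl.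
  by apply: lerD; exact: ler_wpM2l.
have sq_le (y M : R) : `|y| <= M -> y ^+ 2 <= M ^+ 2.
  by move=> h; rewrite -real_normK ?num_real // ler_pXn2r // nnegrE // (le_trans _ h).
have /andP[Hz0 Hz1] := Hb.
have [Kz0 Kb'] : 0 <= K z /\ K z <= 1.
  by move: Kb; clear -c8; rewrite ler_norml => /andP[h1 h2]; split; lra.
have A2 : A z <= 2.
  rewrite /A ler_pdivrMr //.
  by have : Q * K z <= Q * 1; [exact: ler_wpM2l | clear -P1 c8 Hz1; lra].
have B2 : B z <= 2.
  rewrite /B ler_pdivrMr //.
  by have : P * K z <= P * 1; [exact: ler_wpM2l | clear -PQ P1 Hz0; lra].
(* Each radial term is at most [2 (P + Q) / P] times [M^2], from the lower bound on the squared
   radius. The angular terms are at most [2 (P + 1)^2 M^2] and [2 (Q + 1)^2 M^2], as the squared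
   radii are at most 2. [E] is the sum of these constants. *)
have Qb (h t k' s M : R) : 0 <= M -> `|h| <= M -> `|t| <= M -> `|k'| <= M -> `|s| <= M ->
    Qsq (Num.sqrt (A z)) (Num.sqrt (B z)) (2 * (Q * k' + h) / (P + Q) / (2 * Num.sqrt (A z)))
      (P * t + s) (2 * (P * k' - h) / (P + Q) / (2 * Num.sqrt (B z))) (- (Q * t) + s)
    <= M ^+ 2 * E.
  move=> M0 hM tM kM sM.
  have -> : Qsq (Num.sqrt (A z)) (Num.sqrt (B z)) (2 * (Q * k' + h) / (P + Q) / (2 * Num.sqrt (A z)))
      (P * t + s) (2 * (P * k' - h) / (P + Q) / (2 * Num.sqrt (B z))) (- (Q * t) + s) =
      ((Q * k' + h) / (P + Q)) ^+ 2 * (A z)^-1 + A z * (P * t + s) ^+ 2 +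
      (((P * k' - h) / (P + Q)) ^+ 2 * (B z)^-1 + B z * (- (Q * t) + s) ^+ 2).
    move: sA sB rA rB; move: (Num.sqrt (A z)) (Num.sqrt (B z)) => ra rb <- <- ra0 rb0.
    have rA0 := negbT (gt_eqF ra0); have rB0 := negbT (gt_eqF rb0); have PQn := negbT (gt_eqF PQ0).
    by rewrite /Qsq /Qform; field; rewrite PQn rA0 rB0.
  have V (r y : R) : P / (2 * (P + Q)) <= r -> `|y| <= M -> y ^+ 2 * r^-1 <= M ^+ 2 * (2 * (P + Q) / P).
    move=> r0 yM; apply: ler_pM; rewrite ?sqr_ge0 //.
    - by rewrite invr_ge0; apply: le_trans r0; exact: ltW.
    - exact: sq_le.
    - have -> : 2 * (P + Q) / P = (P / (2 * (P + Q)))^-1 by rewrite invf_div.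
      by rewrite lef_pV2 ?posrE //; exact: lt_le_trans r0.
  have frac (y1 y2 g : R) : `|y1| <= M -> `|y2| <= M -> 0 <= g -> g + 1 <= P + Q ->
      `|(g * y1 + 1 * y2) / (P + Q)| <= M.
    move=> h1 h2 g0 g1; rewrite normrM normfV (gtr0_norm PQ0) ler_pdivrMr //.
    apply: le_trans (abs_le M _ _ h1 h2 g 1 g0 ler01) _.
    by rewrite mulrC; apply: ler_wpM2l.
  have hN : `|- h| <= M by rewrite normrN.
  have tN : `|- t| <= M by rewrite normrN.
  have f1 := frac k' h Q kM hM; have f2 := frac k' (- h) P kM hN.
  rewrite mul1r in f1; rewrite mul1r in f2.
  have v1 := V _ _ Ab (f1 _ _); have v2 := V _ _ Bb (f2 _ _).
  have w1 := abs_le M _ _ tM sM P 1; have w2 := abs_le M _ _ tN sM Q 1.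
  rewrite mul1r in w1; rewrite mul1r mulrN in w2.
  have s1 : A z * (P * t + s) ^+ 2 <= 2 * ((P + 1) * M) ^+ 2.
    by apply: ler_pM; rewrite ?sqr_ge0 ?(ltW A0) //; apply: sq_le; apply: w1.
  have s2 : B z * (- (Q * t) + s) ^+ 2 <= 2 * ((Q + 1) * M) ^+ 2.
    by apply: ler_pM; rewrite ?sqr_ge0 ?(ltW B0) //; apply: sq_le; apply: w2.
  have -> : M ^+ 2 * E = M ^+ 2 * (2 * (P + Q) / P) + 2 * ((P + 1) * M) ^+ 2 +
      (M ^+ 2 * (2 * (P + Q) / P) + 2 * ((Q + 1) * M) ^+ 2).
    by rewrite /E; ring.
  by apply: lerD; apply: lerD => //; [exact: v1 | exact: v2].
have E0 : 0 <= E.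
  have h (t : R) : 0 <= 2 * t ^+ 2 by rewrite mulr_ge0 ?sqr_ge0.
  apply: addr_ge0 (h _); apply: addr_ge0 (h _).
  by rewrite divr_ge0 // mulr_ge0 // ltW.
have -> : M1 * M2 * E = Num.sqrt ((M1 ^+ 2 * E) * (M2 ^+ 2 * E)).
  have -> : (M1 ^+ 2 * E) * (M2 ^+ 2 * E) = (M1 * M2 * E) ^+ 2 by ring.
  by rewrite sqrtr_sqr ger0_norm // !mulr_ge0.
apply: ler_wsqrtr; apply: ler_pM; rewrite ?Qsq_ge0 //; exact: Qb.
Qed.

End MapDensity.

Section PieceDensity.
Context {R : realType}.
Variables (f : bool) (p q N : nat).
Hypotheses (p0 : (0 < p)%N) (pq : (p < q)%N) (N8 : (8 <= N)%N).
Let n : R := N%:R.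
Let c : R := n^-1.
Let P : R := p%:R.
Let Q : R := q%:R.
Implicit Types (u v w : R * R).

Let prm : [/\ 8 <= n, 0 < c, c <= 1 / 8, 1 <= P & P + 1 <= Q] := @params R p q N p0 pq N8.

Lemma cell_sin_cos (x : R) : cos (pi / 2 * (x * `|x|)) = cell_cos x.
Proof.
rewrite /cell_cos; have [x0|x0] := ler0P x; last by [].
by rewrite mulrN mulrN cosN.
Qed.

Lemma mulr_cell_sin (x : R) : x * sin (pi / 2 * (x * x)) = `|x| * cell_sin x.
Proof.
rewrite /cell_sin; have [x0|x0] := ler0P x; last by [].
by rewrite !mulrN sinN mulrNN.
Qed.

Lemma grad_cell_sin u : u.2 != 0 ->
  grad (fun w => cell_sin w.2) u 0 (pi * `|u.2| * cell_cos u.2).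
Proof.
move=> u0; have g2 := grad_snd u.
(* Near a point with [u.2 != 0] the absolute value is the linear function [Num.sg u.2 * w.2]. *)
have g := grad_sin (gradZ (pi / 2) (gradM g2 (gradZ (Num.sg u.2) g2))).
have uE : Num.sg u.2 * u.2 = `|u.2| by rewrite -normrEsg.
apply: (@grad_near _ (fun w => sin (pi / 2 * (w.2 * (Num.sg u.2 * w.2))))); last first.
  apply: grad_eq g _ _; first by rewrite /= !mulr0 mul0r addr0 !mulr0.
  by rewrite mul1r mulr1 [u.2 * Num.sg _]mulrC uE cell_sin_cos; field.
have : \forall w \near u, 0 < Num.sg u.2 * w.2.
  apply: open_nbhs_nbhs; split; last by rewrite /= uE normr_gt0.
  by apply: open_ltf => w; [exact: cvg_cst | apply: cvgM; [exact: cvg_cst | exact: cvg_snd]].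
apply: filterS => w w0; rewrite /cell_sin; congr (sin (_ * (_ * _))).
by rewrite -[LHS]gtr0_norm // normrM normr_sg u0 mul1r.
Qed.

Lemma grad_cell_cos u :
  grad (fun w => cell_cos w.2) u 0 (- (pi * `|u.2| * cell_sin u.2)).
Proof.
have g2 := grad_snd u.
apply: grad_eq (grad_cos (gradZ (pi / 2) (gradM g2 g2))) _ _ => /=.
  by rewrite !mul0r !mulr0 addr0 !mulr0.
by rewrite -[pi * `|_| * _]mulrA -mulr_cell_sin; field.
Qed.

Definition piece_const : R := 4 * (P + Q) / P + 2 * (P + 1) ^+ 2 + 2 * (Q + 1) ^+ 2.

Lemma pi_lt4 : pi < 4 :> R. Proof. by have := @pihalf_lt2 R; lra. Qed.

(** As [pi < 4], the [k]-derivatives are at most [4 c] and the [x]-derivatives at most [16 c |x|];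
    their product is the source of [64 c^2 |x|]. The symplectic form is a multiple of the derivative
    of [cell_sin^2 + cell_cos^2 = 1]: what the rectangle gains in area, the doubled circle loses. *)
Lemma cell_local b (xi : R) (F : R * R -> 'rV[R]_4) (k x : R * R -> R) u k1 k2 x1 x2 :
  (\forall w \near u, cell f p q N b xi (k w) (x w) = F w) ->
  grad k u k1 k2 -> grad x u x1 x2 -> `|k u| <= 1 -> x u != 0 ->
  omega (partial1 F u) (partial2 F u) = 0 /\
  area_density F u <= `|k1 * x2 - k2 * x1| * `|x u| * (64 * piece_const * c ^+ 2).
Proof.
have [n8 c0 c8 P1 PQ] := prm.
move=> nF gk gx ku xu0; set z : R * R := (k u, x u).
have p_0 := pi_gt0 R; have p_4 := pi_lt4; have c0' := ltW c0.
have nx := normr_ge0 (x u).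
have cx : 0 <= c * `|x u| by exact: mulr_ge0.
have [pih0 pih2] : 0 <= (pi : R) / 2 * 1 /\ (pi : R) / 2 * 1 <= 2 by split; lra.
have ch0 : 0 <= c / 2 by lra.
have [m0 m1 m2 m3] : [/\ 0 <= 4 * c, c / 2 * 1 <= 4 * c, 4 * c * 1 <= 4 * c & c * 1 * 2 <= 4 * c].
  by split; lra.
have [m4 m5 m6 m7] : [/\ 0 <= 16 * (c * `|x u|), c / 2 * (4 * `|x u|) <= 16 * (c * `|x u|),
    4 * c * (4 * `|x u|) <= 16 * (c * `|x u|) & c * (4 * `|x u|) * 1 <= 16 * (c * `|x u|)].
  by split; lra.
have gS : grad (fun w => cell_sin w.2) z 0 (pi * `|z.2| * cell_cos z.2) by exact: grad_cell_sin.
have gC := grad_cell_cos z.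
have gK := gradZ (pi / 2) (grad_fst z).
set S := cell_sin (x u) in gS gC; set C := cell_cos (x u) in gS gC.
set S' := pi * _ * _ in gS; set C' := - _ in gC.
have gX b' : grad (fun w => cell_X b' w.1 w.2) z (if b' then S else 0)
    (if b' then k u * S' else S').
  rewrite /cell_X; case: b' => //.
  by apply: grad_eq (gradM (grad_fst z) gS) _ _; rewrite /= ?mul1r ?mulr0 ?addr0 ?mul0r ?add0r.
set ck := cos (pi / 2 * k u); set sk := sin (pi / 2 * k u).
have gH := gradD (grad_cst (c / 2) z) (gradZ (c / 2) (gX (~~ b))).
have gth := gradZ (pi / n) (gradD (grad_cst xi z) (gX b)).
have gcC := gradZ c gC.
have gKm := gradD (grad_cst (1 / 2) z) (gradZ (cell_sg b) (gradM gcC (grad_cos gK))).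
have gpsi := gradN (gradM gcC (grad_sin gK)).
have [Hb Kb] : 0 <= c / 2 + c / 2 * cell_X (~~ b) (k u) (x u) <= c /\
    `|1 / 2 + cell_sg b * (c * cell_cos (x u) * cos (pi / 2 * k u)) - 1 / 2| <= c.
  have [h _] := cell_bounds p0 pq N8 (~~ b) (x u) ku.
  by have [_ h'] := cell_bounds p0 pq N8 b (x u) ku.
have S1 : `|S| <= 1 by exact: cell_sin_le1.
have C1 : `|C| <= 1 by exact: cell_cos_le1.
have ck1 : `|ck| <= 1 by exact: cos_max.
have sk1 : `|sk| <= 1 by exact: sin_max.
have sg1 : `|cell_sg b| = 1 :> R by rewrite /cell_sg; case: (b); rewrite ?normrN normr1.
have d4 (y : R) : `|y| <= 1 -> `|pi * `|x u| * y| <= 4 * `|x u|.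
  move=> y1; rewrite !normrM normr_id (gtr0_norm p_0) -[leRHS]mulr1.
  apply: ler_pM => //; first by rewrite mulr_ge0 // ltW.
  by apply: ler_wpM2r => //; exact: ltW.
have S'1 : `|S'| <= 4 * `|x u| by exact: d4.
have C'1 : `|C'| <= 4 * `|x u| by rewrite normrN; exact: d4.
have prod (a y M M' : R) : `|a| <= M -> `|y| <= M' -> `|a * y| <= M * M'.
  by move=> h h'; rewrite normrM; exact: ler_pM.
have pc : pi * c <= 4 * c by rewrite ler_pM2r // ltW.
have pc0 : 0 <= pi * c by rewrite mulr_ge0 // ltW.
have c2 : `|c / 2| <= c / 2 by rewrite ger0_norm.
have pnE : pi / n = pi * c by [].
have pn : `|pi / n| <= 4 * c by rewrite pnE ger0_norm.
have cC : `|c * C| <= c * 1 by apply: prod => //; rewrite ger0_norm.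
have cC' : `|c * C'| <= c * (4 * `|x u|) by apply: prod => //; rewrite ger0_norm.
have tr (y M M' : R) : `|y| <= M -> M <= M' -> `|y| <= M' by exact: le_trans.
have key := action_angle_local p0 pq N8 (F := F) (M1 := 4 * c) (M2 := 16 * (c * `|x u|)) nF gk gx
  gH gth gKm gpsi Hb Kb.
have p2 (y : R) : `|y| <= 1 -> `|y * (pi / 2 * 1)| <= 2.
  move=> y1; have h : `|pi / 2 * 1| <= 2 :> R by rewrite ger0_norm.
  by rewrite -[leRHS]mul1r; exact: prod.
have nsk : `|- sk| <= 1 by rewrite normrN.
have kS := prod _ _ _ _ ku S'1.
have m8 : c / 2 * (1 * (4 * `|x u|)) <= 16 * (c * `|x u|) by rewrite mul1r.
have m9 : 4 * c * (1 * (4 * `|x u|)) <= 16 * (c * `|x u|) by rewrite mul1r.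
have [||||||||||-> D] := key; rewrite /= -?/S -?/C -?/ck -?/sk ?add0r ?mulr0 ?addr0 ?mul0r ?mulr0 ?add0r ?addr0 //.
- case: (b) => /=; first by rewrite mulr0 normr0.
  exact: tr (prod _ _ _ _ c2 S1) m1.
- case: (b) => /=; last by rewrite mulr0 normr0.
  exact: tr (prod _ _ _ _ pn S1) m2.
- by rewrite normrM sg1 mul1r; apply: tr (prod _ _ _ _ cC (p2 _ nsk)) m3.
- by rewrite normrN; apply: tr (prod _ _ _ _ cC (p2 _ ck1)) m3.
- case: (b) => /=; first exact: tr (prod _ _ _ _ c2 S'1) m5.
  exact: tr (prod _ _ _ _ c2 kS) m8.
- case: (b) => /=; last exact: tr (prod _ _ _ _ pn S'1) m6.
  exact: tr (prod _ _ _ _ pn kS) m9.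
- by rewrite normrM sg1 mul1r; apply: tr (prod _ _ _ _ cC' ck1) m7.
- by rewrite normrN; apply: tr (prod _ _ _ _ cC' sk1) m7.
split; last first.
  apply: le_trans D _; rewrite -[leRHS]mulrA; apply: ler_wpM2l => //.
  by rewrite -/piece_const le_eqVlt; apply/orP; left; apply/eqP; rewrite -/n -/c; ring.
have cs : ck ^+ 2 + sk ^+ 2 = 1 by exact: cos2Dsin2.
set L := (X in _ * X); suff -> : L = 0 by rewrite mulr0.
(* [S'] and [C'] are the derivatives of [S] and [C] in [x], so this is half the derivative of
   [S^2 + C^2]. *)
have SC : S * S' + C * C' = 0 by rewrite /S' /C' /= -/S -/C; ring.
rewrite /L pnE /cell_sg; case: (b) => /=.
  transitivity (- (pi / 2 * c ^+ 2 * (S * S' + C * C' * (ck ^+ 2 + sk ^+ 2)))).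
    by field.
  by rewrite cs mulr1 SC mulr0 oppr0.
transitivity (pi / 2 * c ^+ 2 * (S * S' + C * C' * (ck ^+ 2 + sk ^+ 2))).
  by field.
by rewrite cs mulr1 SC mulr0.
Qed.

End PieceDensity.

Section ChartDensity.
Context {R : realType}.
Variables (f : bool) (p q N : nat).
Hypotheses (p0 : (0 < p)%N) (pq : (p < q)%N) (N8 : (8 <= N)%N).
Let n : R := N%:R.
Let c : R := n^-1.
Let P : R := p%:R.
Let Q : R := q%:R.
Implicit Types (u v w : R * R).

Let prm : [/\ 8 <= n, 0 < c, c <= 1 / 8, 1 <= P & P + 1 <= Q] := @params R p q N p0 pq N8.

(** The sign [e] covers both halves of the band around the core, entered by [y] for [y < 4] and by
    [8 - y] beyond. Isotropy is the relation [A^2 = 2 B^2] between the two amplitudes. *)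
Lemma core_local (F : R * R -> 'rV[R]_4) (s y : R * R -> R) u (e : R) :
  (\forall w \near u, core_map f p N (s w, y w) = F w) ->
  grad s u 1 0 -> grad y u 0 e -> e ^+ 2 = 1 ->
  omega (partial1 F u) (partial2 F u) = 0 /\ area_density F u <= 64 * P * c ^+ 2.
Proof.
have [n8 c0 c8 P1 PQ] := prm.
move=> nF gs gy e1; have p_0 := pi_gt0 R; have p_4 := @pi_lt4 R.
have gt := gradZ (pi / 2) (gradB (grad_cst 4 u) gy).
have ga := gradZ (Num.sqrt (2 * c / P)) (grad_sin gt).
have gb := gradZ (Num.sqrt (c / P)) (grad_cos gt).
have gth := gradZ (pi / n) gs.
have gal := gradZ P gth; have gbe := gradZ (2 * P) gth.
have [-> ->] := polf_near_partials nF ga gal gb gbe.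
rewrite /Qform -/(pi / n) -[pi / n]/(pi * c).
set C := cos _; set S := sin _.
set A := Num.sqrt (2 * c / P); set B := Num.sqrt (c / P).
have A2 : A ^+ 2 = 2 * (c / P) by rewrite sqr_sqrtr -?mulrA // !mulr_ge0 ?invr_ge0 //; lra.
have B2 : B ^+ 2 = c / P by rewrite sqr_sqrtr // divr_ge0 //; lra.
have CS : C ^+ 2 + S ^+ 2 = 1 by exact: cos2Dsin2.
have P0 : P != 0 by apply/eqP => h; lra.
split.
  transitivity ((B ^+ 2 * 2 - A ^+ 2) * (- (C * S * pi / 2 * e * P * (pi * c)))); first by field.
  by rewrite A2 B2; ring.
rewrite -[leRHS]ger0_norm; last by rewrite !mulr_ge0 ?sqr_ge0 //; lra.
rewrite -sqrtr_sqr; apply: ler_wsqrtr.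
set L := (X in X <= _).
have -> : L = ((S ^+ 2 * A ^+ 2 + 4 * C ^+ 2 * B ^+ 2) * P ^+ 2 * (pi * c) ^+ 2) *
    ((C ^+ 2 * A ^+ 2 + S ^+ 2 * B ^+ 2) * (pi ^+ 2 / 4) * e ^+ 2) by rewrite /L; field.
rewrite e1 A2 B2.
have -> : (S ^+ 2 * (2 * (c / P)) + 4 * C ^+ 2 * (c / P)) * P ^+ 2 * (pi * c) ^+ 2 *
    ((C ^+ 2 * (2 * (c / P)) + S ^+ 2 * (c / P)) * (pi ^+ 2 / 4) * 1) =
    ((2 * S ^+ 2 + 4 * C ^+ 2) * (2 * C ^+ 2 + S ^+ 2)) * (pi ^+ 4 / 4) * c ^+ 4 by field.
have -> : (64 * P * c ^+ 2) ^+ 2 = 64 ^+ 2 * P ^+ 2 * c ^+ 4 by ring.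
have C0 := sqr_ge0 C; have S0 := sqr_ge0 S.
have q8 : (2 * S ^+ 2 + 4 * C ^+ 2) * (2 * C ^+ 2 + S ^+ 2) <= 4 * 2.
  by apply: ler_pM; lra.
have p44 : pi ^+ 4 <= 4 ^+ 4 :> R by rewrite ler_pXn2r ?nnegrE //; lra.
have PP : 1 <= P ^+ 2 by rewrite expr_ge1 //; lra.
apply: ler_wpM2r; first by rewrite exprn_ge0 //; lra.
apply: (@le_trans _ _ (4 * 2 * (4 ^+ 4 / 4))); last by lra.
apply: ler_pM => //; try lra.
- by apply: mulr_ge0; lra.
- by have := exprn_ge0 4 (ltW p_0); lra.
Qed.

Definition annulus_level (y : R) : R := 2 * c + Q * annulus_radius p q N y ^+ 2.

(** The exact density: a bound up to a constant factor would lose the gain, which is a term of order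
    [c log (1 / c)] beside a main term that tends to the area of the cone. *)
Definition annulus_density (y : R) : R :=
  pi * c * Num.sqrt ((P - 2 * c) / (P + Q)) *
  (((P + Q) * annulus_level y - 2 * c * Q) / Num.sqrt (P * annulus_level y)).

Lemma annulus_local (F : R * R -> 'rV[R]_4) u :
  (\forall w \near u, annulus_map f p q N w = F w) ->
  omega (partial1 F u) (partial2 F u) = 0 /\ area_density F u = annulus_density u.2.
Proof.
have [n8 c0 c8 P1 PQ] := prm.
move=> nF; have p_0 := pi_gt0 R.
set r := Num.sqrt ((P - 2 * c) / (P + Q)).
have r0 : 0 <= r by exact: sqrtr_ge0.
have gb := gradZ r (gradB (grad_cst 3 u) (grad_snd u)).
have gY := gradD (grad_cst (2 * c) u) (gradZ Q (gradM gb gb)).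
have gYP := gradM gY (grad_cst P^-1 u).
have gth := gradZ (pi / n) (grad_fst u).
set b := r * (3 - u.2) in gb gY gYP.
set Y := annulus_level u.2.
have YE : 2 * c + Q * (b * b) = Y by rewrite /Y /annulus_level expr2.
rewrite -/b YE in gYP.
have Q0 : 0 <= Q by lra.
have Y0 : 0 < Y.
  by have := mulr_ge0 Q0 (sqr_ge0 b); rewrite -YE expr2; lra.
have YP0 : 0 < Y * P^-1 by rewrite divr_gt0 //; lra.
rewrite -YE in YP0.
have ga := grad_sqrt YP0 gYP.
have nF' : \forall w \near u, polf f (Num.sqrt ((2 * c + Q * (r * (3 - w.2) * (r * (3 - w.2)))) * P^-1))
    (P * (pi / n * w.1)) (r * (3 - w.2)) (- (Q * (pi / n * w.1))) = F w.
  by apply: filterS nF => w <-; rewrite /annulus_map /annulus_radius expr2.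
have [-> ->] := polf_near_partials nF' ga (gradZ P gth) gb (gradN (gradZ Q gth)).
rewrite -/b YE /Qform -[pi / n]/(pi * c).
set a := Num.sqrt (Y * P^-1).
rewrite YE in YP0.
have a0 : 0 < a by rewrite sqrtr_gt0.
have a2 : a ^+ 2 = Y / P by rewrite sqr_sqrtr // ltW.
have aN : a != 0 by rewrite gt_eqF.
have PN : P != 0 by apply/eqP => h; lra.
have YN : Y != 0 by rewrite gt_eqF.
split; first by field; rewrite aN PN.
rewrite /annulus_density -/r -/Y.
set T := _ * Y - _.
have TE : T = P * Y + (Q * b) ^+ 2 by rewrite /T -YE; ring.
have T0 : 0 <= T by rewrite TE addr_ge0 ?sqr_ge0 // mulr_ge0 //; lra.
rewrite -[RHS]ger0_norm; last first.
  by apply: mulr_ge0; [rewrite !mulr_ge0 //; lra | rewrite divr_ge0 // sqrtr_ge0].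
have PY0 : 0 < P * Y by rewrite mulr_gt0 //; lra.
rewrite -sqrtr_sqr; congr Num.sqrt.
have -> : (pi * c * r * (T / Num.sqrt (P * Y))) ^+ 2 = (pi * c * r * T) ^+ 2 / (P * Y).
  by rewrite mulrA exprMn exprVn sqr_sqrtr // ltW.
transitivity ((pi * c) ^+ 2 * (P ^+ 2 * a ^+ 2 + (Q * b) ^+ 2) *
  (r ^+ 2 * ((Q * b) ^+ 2 / (P ^+ 2 * a ^+ 2) + 1))); first by field; rewrite aN PN.
rewrite a2 TE; field; by rewrite YN PN.
Qed.

End ChartDensity.

Section ChartLocal.
Context {R : realType}.
Variables (f : bool) (p q N : nat).
Hypotheses (p0 : (0 < p)%N) (pq : (p < q)%N) (N8 : (8 <= N)%N).
Let n : R := N%:R.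
Let c : R := n^-1.
Let P : R := p%:R.
Let Q : R := q%:R.
Implicit Types (u v w : R * R).

Let prm : [/\ 8 <= n, 0 < c, c <= 1 / 8, 1 <= P & P + 1 <= Q] := @params R p q N p0 pq N8.

(* The map is smooth off these lines, which contain those along which its
   pieces meet. *)
Definition grid_lines : set (R * R) := [set u | exists j : int,
  [\/ u.1 = j%:~R, u.2 = j%:~R, u.1 - u.2 = j%:~R | u.1 + u.2 = j%:~R]].

Definition strip_density (y : R) : R :=
  if y <= 2 then 64 * piece_const p q * c ^+ 2
  else if y <= 3 then annulus_density p q N y else 64 * P * c ^+ 2.

Lemma near_ltf (F G : R * R -> R) u : continuous F -> continuous G -> F u < G u ->
  \forall w \near u, F w < G w.
Proof. by move=> cF cG Fu; apply: open_nbhs_nbhs; split=> //; exact: open_ltf. Qed.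

Lemma cell_map_local (F : R * R -> 'rV[R]_4) (xi : R) u :
  (\forall w \near u, cell_map f p q N xi w = F w) -> `|u.2 - 1| != `|u.1 - xi| :> R ->
  omega (partial1 F u) (partial2 F u) = 0 /\
  area_density F u <= 64 * piece_const p q * c ^+ 2.
Proof.
move=> nF ne.
have c1 : continuous (fun w : R * R => `|w.1 - xi|).
  by move=> w; apply: cvg_norm; apply: cvgB; [exact: cvg_fst | exact: cvg_cst].
have c2 : continuous (fun w : R * R => `|w.2 - 1|).
  by move=> w; apply: cvg_norm; apply: cvgB; [exact: cvg_snd | exact: cvg_cst].
have g1 : grad (fun w : R * R => w.1 - xi) u 1 0.
  by apply: grad_eq (gradB (grad_fst u) (grad_cst xi u)) _ _; rewrite subr0.
have g2 : grad (fun w : R * R => w.2 - 1) u 0 1.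
  by apply: grad_eq (gradB (grad_snd u) (grad_cst 1 u)) _ _; rewrite subr0.
(* The change to coordinates [(Y / X, X)] or [(X / Y, Y)] has determinant plus or minus the inverse
   of its second coordinate, which cancels the factor [|x|] in [cell_local]. *)
have fin (x y : R) : y * x = 1 \/ y * x = -1 -> `|y| * `|x| * (64 * piece_const p q * c ^+ 2) =
    64 * piece_const p q * c ^+ 2.
  by move=> [] yx; rewrite -normrM yx ?normrN normr1 mul1r.
have [lt|lt|e] := ltgtP (`|u.2 - 1| : R) (`|u.1 - xi| : R); last by rewrite e eqxx in ne.
- have x0 : u.1 - xi != 0 by rewrite -normr_gt0 (le_lt_trans _ lt).
  have nF' : \forall w \near u, cell f p q N false xi ((w.2 - 1) / (w.1 - xi)) (w.1 - xi) = F w.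
    apply: filterS2 (near_ltf c2 c1 lt) nF => w h <-.
    by rewrite /cell_map ltW.
  have [|-> D] := cell_local p0 pq N8 nF' (gradM g2 (gradV x0 g1)) g1 _ x0.
    by rewrite normrM normfV ler_pdivrMr ?normr_gt0 // mul1r ltW.
  split=> //; apply: le_trans D _; rewrite fin //; right; field; exact: x0.
- have x0 : u.2 - 1 != 0 by rewrite -normr_gt0 (le_lt_trans _ lt).
  have nF' : \forall w \near u, cell f p q N true xi ((w.1 - xi) / (w.2 - 1)) (w.2 - 1) = F w.
    apply: filterS2 (near_ltf c1 c2 lt) nF => w h <-.
    by rewrite /cell_map leNgt h.
  have [|-> D] := cell_local p0 pq N8 nF' (gradM g1 (gradV x0 g2)) g2 _ x0.
    by rewrite normrM normfV ler_pdivrMr ?normr_gt0 // mul1r ltW.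
  split=> //; apply: le_trans D _; rewrite fin //; left; field; exact: x0.
Qed.

Lemma grid_abs u (j : int) : ~ grid_lines u -> `|u.2 - 1| != `|u.1 - j%:~R| :> R.
Proof.
move=> nu; apply/eqP => e; apply: nu.
have := congr1 (fun t => t ^+ 2) e; rewrite !real_normK ?num_real // => /eqP.
rewrite eqf_sqr => /orP[] /eqP h.
- exists (j - 1); apply: Or43; rewrite intrB; lra.
- exists (j + 1); apply: Or44; rewrite intrD; lra.
Qed.

(** Isotropy is required in all strip charts, which reach up to [y < 5]; the density only in chart
    0, which carries the whole area and ends at [y = 4]. *)
Lemma strip_local u : 0 < u.2 < 5 -> ~ grid_lines u ->
  omega (partial1 (strip_map f p q N) u) (partial2 (strip_map f p q N) u) = 0 /\
  (u.2 < 4 -> area_density (strip_map f p q N) u <= strip_density u.2).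
Proof.
have [n8 c0 c8 P1 PQ] := prm.
move=> /andP[u0 u5] nu.
have c1 : continuous (fun w : R * R => w.1) by move=> w; exact: cvg_fst.
have c2 : continuous (fun w : R * R => w.2) by move=> w; exact: cvg_snd.
have ck (k : R) : continuous (fun w : R * R => k) by move=> w; exact: cvg_cst.
have ni (k : nat) : u.2 != k%:R by apply/eqP => h; apply: nu; exists k; exact: Or42.
have below (k : R) : u.2 < k -> \forall w \near u, w.2 < k by exact: near_ltf.
have above (k : R) : k < u.2 -> \forall w \near u, k < w.2 by exact: near_ltf.
rewrite /strip_density.
have [y2|y2|y2] := ltgtP u.2 2; last by have := ni 2%N; rewrite y2 eqxx.
  pose j : int := Num.floor (u.1 / 2).
  have /andP[j1 j2] : j%:~R <= u.1 / 2 < (j + 1)%:~R by rewrite floor_le /= floorD1_gt.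
  rewrite intrD in j2.
  have j3 : 2 * j%:~R < u.1.
    rewrite lt_neqAle; apply/andP; split; last by lra.
    by apply/eqP => h; apply: nu; exists (2 * j); apply: Or41; rewrite intrM -h.
  have j4 : u.1 < 2 * j%:~R + 2 by lra.
  have nF : \forall w \near u, cell_map f p q N (2 * j + 1)%:~R w = strip_map f p q N w.
    apply: filterS3 (below _ y2) (near_ltf (ck (2 * j%:~R)) c1 j3)
      (near_ltf c1 (ck (2 * j%:~R + 2)) j4) => w w2 w3 w4.
    rewrite /strip_map /half_strip_map (le_trans (ltW w2)); last by lra.
    by rewrite (ltW w2) (cell_center_floor (j := j)) ?(ltW w3) // intrD intrM.
  have [-> D] := cell_map_local nF (grid_abs _ nu).
  by [].
have [y3|y3|y3] := ltgtP u.2 3; last by have := ni 3%N; rewrite y3 eqxx.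
  have nF : \forall w \near u, annulus_map f p q N w = strip_map f p q N w.
    apply: filterS2 (below _ y3) (above _ y2) => w w3 w2.
    rewrite /strip_map /half_strip_map (le_trans (ltW w3)); last by lra.
    by rewrite leNgt w2 /= (ltW w3).
  have [-> ->] := annulus_local p0 pq N8 nF; by [].
have [y4|y4|y4] := ltgtP u.2 4; last by have := ni 4%N; rewrite y4 eqxx.
  have nF : \forall w \near u, core_map f p N (w.1, w.2) = strip_map f p q N w.
    apply: filterS2 (below _ y4) (above _ y3) => -[s y] /= w4 w3.
    rewrite /strip_map /half_strip_map /= (ltW w4) leNgt [X in ~~ X](lt_trans _ w3) /=; last by lra.
    by rewrite leNgt w3.
  have [->] := core_local (e := 1) p0 pq N8 nF (grad_fst u) (grad_snd u) (expr1n _ _).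
  by [].
have nF : \forall w \near u, core_map f p N (w.1 + n, 8 - w.2) = strip_map f p q N w.
  apply: filterS2 (above _ y4) (below _ u5) => -[s y] /= w4 w5.
  rewrite /strip_map /half_strip_map /= leNgt w4 /=.
  have -> : (8 - y <= 2) = false by apply/negbTE; rewrite -ltNge; lra.
  by have -> : (8 - y <= 3) = false by apply/negbTE; rewrite -ltNge; lra.
have g1 : grad (fun w : R * R => w.1 + n) u 1 0.
  by apply: grad_eq (gradD (grad_fst u) (grad_cst n u)) _ _; rewrite addr0.
have g2 : grad (fun w : R * R => 8 - w.2) u 0 (-1).
  by apply: grad_eq (gradB (grad_cst 8 u) (grad_snd u)) _ _; rewrite sub0r ?oppr0.
have e1 : (-1) ^+ 2 = 1 :> R by rewrite sqrrN expr1n.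
have [-> _] := core_local p0 pq N8 nF g1 g2 e1.
by split=> // y4'; have := lt_trans y4 y4'; rewrite ltxx.
Qed.

Lemma cap_local i u : ~ grid_lines u ->
  omega (partial1 (cap_map f p q N i) u) (partial2 (cap_map f p q N i) u) = 0.
Proof.
move=> nu.
have x0 : u.2 - 1 != 0.
  by rewrite subr_eq0; apply/eqP => h; apply: nu; exists 1; exact: Or42.
have c1 : continuous (fun w : R * R => `|w.1|) by move=> w; apply: cvg_norm; exact: cvg_fst.
have ck : continuous (fun w : R * R => 1 : R) by move=> w; exact: cvg_cst.
have g2 : grad (fun w : R * R => w.2 - 1) u 0 1.
  by apply: grad_eq (gradB (grad_snd u) (grad_cst 1 u)) _ _; rewrite subr0.
have [k1|k1|k1] := ltgtP (`|u.1| : R) 1.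
- have nF : \forall w \near u, cell f p q N (odd i) ((cap i).*2.+1)%:R w.1 (w.2 - 1) = cap_map f p q N i w.
    by apply: filterS (near_ltf c1 ck k1) => w w1; rewrite /cap_map ltW.
  by have [|->] := cell_local p0 pq N8 nF (grad_fst u) g2 _ x0; first exact: ltW.
- have nF : \forall w \near u, cell f p q N (~~ odd i) ((cap i).*2.+1)%:R (w.1)^-1 (w.1 * (w.2 - 1)) = cap_map f p q N i w.
    by apply: filterS (near_ltf ck c1 k1) => w w1; rewrite /cap_map leNgt w1.
  have u0 : u.1 != 0 by rewrite -normr_gt0 (lt_trans _ k1).
  have [||->] := cell_local p0 pq N8 nF (gradV u0 (grad_fst u)) (gradM (grad_fst u) g2) => //.
  + by rewrite normfV invf_le1 ?normr_gt0 // ltW.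
  + by rewrite mulf_neq0.
- exfalso; apply: nu.
  have := congr1 (fun t => t ^+ 2) k1; rewrite real_normK ?num_real // expr1n => /eqP.
  by rewrite sqrf_eq1 => /orP[] /eqP e1; [exists 1|exists (-1)]; exact: Or41.
Qed.

Lemma chart_map_isotropic i u : cdom N i u -> 0 < u.2 -> ~ grid_lines u ->
  omega (partial1 (chart_map f p q N i) u) (partial2 (chart_map f p q N i) u) = 0.
Proof.
move=> du u0 nu; have [i4|i4] := boolP (i < 4)%N; last first.
  have -> : @chart_map R f p q N i = cap_map f p q N i by apply/funext => w; rewrite /chart_map (negbTE i4).
  exact: cap_local.
have -> : @chart_map R f p q N i = strip_map f p q N by apply/funext => w; rewrite /chart_map i4.
have [_ u5] := lft_range du; rewrite /lft i4 in u5.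
by have [|->] := strip_local (u := u) _ nu; rewrite ?u0.
Qed.

End ChartLocal.

(** * Area estimates *)

Section Integrals.
Context {R : realType}.

Section Measure.
Local Open Scope ereal_scope.
Context d (T : measurableType d) (mu : {measure set T -> \bar R}).

(** The integral of a nonnegative function is a supremum over the simple functions below it, so it
    is monotone for arbitrary functions. This allows area densities to be compared with explicit
    bounds without a proof that the densities are measurable. *)
Lemma ge0_integral_le_nonmeasurable (D : set T) (f g : T -> \bar R) :
  (forall x, 0 <= f x) -> (forall x, 0 <= g x) -> (forall x, D x -> f x <= g x) ->
  \int[mu]_(x in D) f x <= \int[mu]_x g x.
Proof.
move=> f0 g0 fg; rewrite integral_mkcond.
have fD0 x : 0 <= (f \_ D) x by rewrite patchE; case: (x \in D).
have fDg x : (f \_ D) x <= g x by rewrite patchE; case: ifPn => // /set_mem; exact: fg.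
rewrite (ge0_integralTE _ fD0) (ge0_integralTE _ g0); apply: ereal_sup_le => _ [h hf <-].
by exists h => // x; exact: le_trans (hf x) (fDg x).
Qed.

Lemma negligible_integral_le (D N : set T) (f g : T -> \bar R) :
  mu.-negligible N -> measurable_fun setT g ->
  (forall x, 0 <= f x) -> (forall x, 0 <= g x) ->
  (forall x, D x -> ~ N x -> f x <= g x) ->
  \int[mu]_(x in D) f x <= \int[mu]_x g x.
Proof.
move=> [A [mA A0 NA]] mg f0 g0 fg.
(* Raising [g] to infinity on a null set leaves its integral unchanged and makes the inequality hold
   everywhere on [D]. *)
pose g' x := if x \in A then +oo else g x.
have g'0 x : 0 <= g' x by rewrite /g'; case: ifP.
have mg' : measurable_fun setT g'.
  apply: measurable_fun_if => //.
  - apply: (measurable_fun_bool true); rewrite setTI.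
    by rewrite (_ : _ @^-1` _ = A) //; apply/seteqP; split=> x /=; [exact: set_mem | exact: mem_set].
  - exact: measurable_funTS.
have -> : \int[mu]_x g x = \int[mu]_x g' x.
  apply: ge0_ae_eq_integral => //; exists A; split=> // x /= h; apply: contrapT => nA.
  by apply: h => _; rewrite /g'; case: ifPn => // /set_mem.
apply: ge0_integral_le_nonmeasurable => // x Dx; rewrite /g'; case: ifPn => [_|nA].
  exact: leey.
by apply: fg => // /NA Ax; move: nA; rewrite notin_setE.
Qed.

End Measure.

Local Notation mu1 := (@lebesgue_measure R).

Lemma measurable_mul_coords (a b : R -> R) : measurable_fun setT a -> measurable_fun setT b ->
  measurable_fun setT (fun u : measurableTypeR R * measurableTypeR R => a u.1 * b u.2).
Proof.
move=> ma mb; apply: measurable_funM.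
- exact: (measurableT_comp ma measurable_fst).
- exact: (measurableT_comp mb measurable_snd).
Qed.

Lemma integral_mul_coords (a b : R -> R) : measurable_fun setT a -> measurable_fun setT b ->
  (forall x, 0 <= a x) -> (forall x, 0 <= b x) ->
  (\int[lebesgue2]_u (a u.1 * b u.2)%:E = \int[mu1]_x (a x)%:E * \int[mu1]_y (b y)%:E)%E.
Proof.
move=> ma mb a0 b0.
have mab := measurable_mul_coords ma mb.
rewrite /lebesgue2 fubini_tonelli1; first last.
- by move=> u; rewrite lee_fin mulr_ge0.
- exact/measurable_EFinP.
rewrite /fubini_F /= -ge0_integralZr //; first last.
- by apply: integral_ge0 => y _; rewrite lee_fin.
- by move=> x _; rewrite lee_fin.
- exact/measurable_EFinP.
apply: eq_integral => x _; rewrite -ge0_integralZl //.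
- exact/measurable_EFinP.
- by move=> y _; rewrite lee_fin.
- by rewrite lee_fin.
Qed.

Lemma lebesgue2_xsection0 (A : set (R * R)) :
  measurable (A : set (measurableTypeR R * measurableTypeR R)) ->
  (forall x, mu1 (xsection A x) = 0%E) -> lebesgue2 A = 0%E.
Proof.
move=> mA A0; rewrite -[LHS]/(\int[mu1]_x (mu1 \o xsection A) x)%E.
by apply: integral0_eq => x _; exact: A0.
Qed.

Lemma grid_lines_negligible : lebesgue2.-negligible (@grid_lines R).
Proof.
have m1 : measurable_fun setT (fst : measurableTypeR R * measurableTypeR R -> measurableTypeR R).
  exact: measurable_fst.
have m2 : measurable_fun setT (snd : measurableTypeR R * measurableTypeR R -> measurableTypeR R).
  exact: measurable_snd.
have pre (g : R * R -> R) (j : R) :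
    measurable_fun setT (g : measurableTypeR R * measurableTypeR R -> measurableTypeR R) ->
    measurable ([set u | g u = j] : set (measurableTypeR R * measurableTypeR R)).
  by move=> mg; rewrite -[X in measurable X]setTI; exact: (mg measurableT _ (measurable_set1 j)).
have graph (g : R * R -> R) (h : R -> R) (j : R) :
    measurable_fun setT (g : measurableTypeR R * measurableTypeR R -> measurableTypeR R) ->
    (forall u, g u = j -> u.2 = h u.1) ->
    lebesgue2.-negligible ([set u | g u = j]).
  move=> mg gh; have mA := pre _ j mg; exists [set u | g u = j]; split=> //.
  apply: lebesgue2_xsection0 => // x; apply/eqP; rewrite eq_le measure_ge0 andbT.
  rewrite -(lebesgue_measure_set1 (h x)); apply: le_measure; rewrite ?inE //.
  - exact: measurable_xsection.
  - by move=> y; rewrite /xsection /= inE => /gh.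
have line (j : R) : lebesgue2.-negligible [set u | [\/ u.1 = j, u.2 = j, u.1 - u.2 = j | u.1 + u.2 = j]].
  have -> : [set u : R * R | [\/ u.1 = j, u.2 = j, u.1 - u.2 = j | u.1 + u.2 = j]] =
      [set u | u.1 = j] `|` [set u | u.2 = j] `|` [set u | u.1 - u.2 = j] `|` [set u | u.1 + u.2 = j].
    apply/seteqP; split=> u /=.
      by move=> [] ?; [left; left; left|left; left; right|left; right|right].
    by move=> [[[]|]|] ?; [exact: Or41|exact: Or42|exact: Or43|exact: Or44].
  (* A vertical line has a section of infinite measure over its abscissa, so it is treated as a
     product with a null factor instead of through its sections. *)
  have v : lebesgue2.-negligible [set u : R * R | u.1 = j].
    exists ([set j] `*` setT); split.
    - by apply: measurableX => //; exact: measurable_set1.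
    - have m1j : measurable ([set j] : set (measurableTypeR R)) by exact: measurable_set1.
      have mT : measurable (setT : set (measurableTypeR R)) by exact: measurableT.
      have e := product_measure1E (@lebesgue_measure R) (@lebesgue_measure R) m1j mT.
      apply: (etrans e); apply: (etrans (congr1 (fun t => t * _)%E (lebesgue_measure_set1 j))).
      exact: mul0e.
    - by move=> u.
  do ?apply: negligibleU => //.
  - exact: (graph snd (fun=> j)).
  - apply: (graph (fun u => u.1 - u.2) (fun x => x - j)); first exact: measurable_funB.
    by move=> u <-; rewrite opprB addrC subrK.
  - apply: (graph (fun u => u.1 + u.2) (fun x => j - x)); first exact: measurable_funD.
    by move=> u <-; rewrite addrC addKr.
have : lebesgue2.-negligible (\bigcup_(k : nat)
    ([set u : R * R | [\/ u.1 = k%:R, u.2 = k%:R, u.1 - u.2 = k%:R | u.1 + u.2 = k%:R]] `|`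
     [set u : R * R | [\/ u.1 = - k%:R, u.2 = - k%:R, u.1 - u.2 = - k%:R | u.1 + u.2 = - k%:R]])).
  by apply: negligible_bigcup => k; apply: negligibleU; exact: line.
apply: negligibleS => u [[k|k] h]; first by exists k => //; left.
by exists k.+1 => //; right; move: h; rewrite NegzE rmorphN.
Qed.

End Integrals.

(** * The area of the annulus *)

Section AnnulusIntegral.
Context {R : realType}.
Variables (p q N : nat).
Hypotheses (p0 : (0 < p)%N) (pq : (p < q)%N) (N8 : (8 <= N)%N).
Let n : R := N%:R.
Let c : R := n^-1.
Let P : R := p%:R.
Let Q : R := q%:R.
Let r : R := Num.sqrt ((P - 2 * c) / (P + Q)).
Let Y (b : R) : R := 2 * c + Q * b ^+ 2.

Let prm : [/\ 8 <= n, 0 < c, c <= 1 / 8, 1 <= P & P + 1 <= Q] := @params R p q N p0 pq N8.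

Let Y0 b : 0 < Y b.
Proof.
have [n8 c0 c8 P1 PQ] := prm.
have Q0 : 0 <= Q by lra.
by have := mulr_ge0 Q0 (sqr_ge0 b); rewrite /Y; lra.
Qed.

Let YQ b : 0 < Num.sqrt Q * b + Num.sqrt (Y b).
Proof.
have [n8 c0 c8 P1 PQ] := prm.
have : `|Num.sqrt Q * b| < Num.sqrt (Y b).
  rewrite -sqrtr_sqr exprMn sqr_sqrtr; last by lra.
  by rewrite ltr_sqrt // /Y; lra.
rewrite ltr_norml => /andP[h _]; lra.
Qed.

(** A primitive of the density in the variable [b = |w|]. The logarithm is an inverse hyperbolic
    sine; its coefficient is proportional to [Q - P] and would vanish for equal weights. *)
Definition annulus_primitive (b : R) : R :=
  (P + Q) / 2 * (b * Num.sqrt (Y b)) -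
  c * (Q - P) / Num.sqrt Q * ln (Num.sqrt Q * b + Num.sqrt (Y b)).

Lemma annulus_primitive_derive b :
  is_derive b (1 : R) annulus_primitive (((P + Q) * Y b - 2 * c * Q) / Num.sqrt (Y b)).
Proof.
have [n8 c0 c8 P1 PQ] := prm.
have dY : is_derive b (1 : R) Y (Q * (2 * b)).
  rewrite (_ : Y = cst (2 * c) + Q \*: ((id : R -> R) ^+ 2)); last first.
    by apply/funext => x; rewrite /Y /= fctE.
  apply: is_derive_eq; rewrite /GRing.scale /= add0r; ring.
have dS := is_derive1_comp (is_derive1_sqrt (Y0 b)) dY.
have dQ : is_derive b (1 : R) (fun x => Num.sqrt Q * x) (Num.sqrt Q).
  rewrite (_ : (fun x => Num.sqrt Q * x) = Num.sqrt Q \*: (id : R -> R)); last by apply/funext.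
  by apply: is_derive_eq; rewrite /GRing.scale /= mulr1.
have dA := is_deriveD dQ dS.
have dL := @is_derive1_comp R (@ln R) ((fun x => Num.sqrt Q * x) + (Num.sqrt \o Y)) b _ _
  (is_derive1_ln (YQ b)) dA.
have dB := is_deriveM (is_derive_id b (1 : R)) dS.
have := is_deriveB (is_deriveZ ((P + Q) / 2) dB) (is_deriveZ (c * (Q - P) / Num.sqrt Q) dL).
have -> : (P + Q) / 2 \*: ((id : R -> R) * (Num.sqrt \o Y)) -
    c * (Q - P) / Num.sqrt Q \*: (@ln R \o ((fun x => Num.sqrt Q * x) + (Num.sqrt \o Y))) =
    annulus_primitive by apply/funext.
move=> D; apply: is_derive_eq D _; rewrite /GRing.scale /=.
have := YQ b; have := Y0 b.
have sY := sqr_sqrtr (ltW (Y0 b)).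
have YE : Y b = 2 * c + Q * b ^+ 2 by [].
have SY : 0 < Num.sqrt (Y b) by rewrite sqrtr_gt0.
have SQ : 0 < Num.sqrt Q by rewrite sqrtr_gt0; lra.
have sQ : Num.sqrt Q ^+ 2 = Q by rewrite sqr_sqrtr //; lra.
move: SY SQ sY sQ; rewrite YE.
move: (Num.sqrt (2 * c + Q * b ^+ 2)) (Num.sqrt Q) => s t s0 t0 sE tE _ d0.
have s1 := negbT (gt_eqF s0); have t1 := negbT (gt_eqF t0); have d1 := negbT (gt_eqF d0).
rewrite -sE.
have bE : 2 * c = s ^+ 2 - t ^+ 2 * b ^+ 2 by rewrite sE tE; ring.
have cE : c = (s ^+ 2 - t ^+ 2 * b ^+ 2) / 2 by rewrite -bE; field.
rewrite cE -tE; field; by rewrite s1 t1 d1.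
Qed.

Lemma annulus_levelE (y : R) : annulus_level p q N y = Y (r * (3 - y)).
Proof. by []. Qed.

Lemma annulus_density_ge0 (y : R) : 0 <= annulus_density p q N y.
Proof.
have [n8 c0 c8 P1 PQ] := prm.
have yY : 0 < annulus_level p q N y by rewrite annulus_levelE Y0.
have h : 2 * c <= annulus_level p q N y.
  by rewrite lerDl mulr_ge0 ?sqr_ge0 //; lra.
have hQ : Q * (2 * c) <= Q * annulus_level p q N y by apply: ler_wpM2l => //; lra.
have hP : 0 <= P * annulus_level p q N y by rewrite mulr_ge0 //; lra.
rewrite /annulus_density -/n -/c -/P -/Q; apply: mulr_ge0.
  by rewrite !mulr_ge0 ?sqrtr_ge0 // ?pi_ge0 //; lra.
by apply: divr_ge0; rewrite ?sqrtr_ge0 //; lra.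
Qed.

Lemma annulus_density_continuous : continuous (annulus_density p q N : R -> R).
Proof.
have [n8 c0 c8 P1 PQ] := prm.
have cL : continuous (annulus_level p q N : R -> R).
  have -> : annulus_level p q N =
      fun z => 2 * c + Q * (annulus_radius p q N z * annulus_radius p q N z).
    by apply/funext => z; rewrite /annulus_level expr2.
  move=> y; apply: cvgD; first exact: cvg_cst.
  apply: cvgM; first exact: cvg_cst.
  have h : annulus_radius p q N z @[z --> y] --> annulus_radius p q N y.
    by apply: cvgM; [exact: cvg_cst | apply: cvgB; [exact: cvg_cst | exact: cvg_id]].
  exact: (cvgM h h).
move=> y; apply: cvgM; first exact: cvg_cst.
apply: cvgM; first by apply: cvgB; [apply: cvgM; [exact: cvg_cst | exact: cL] | exact: cvg_cst].
have yY : 0 < P * annulus_level p q N y by rewrite mulr_gt0 ?annulus_levelE ?Y0 //; lra.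
apply: cvgV; first by rewrite gt_eqF // sqrtr_gt0.
apply: (cvg_comp (fun z => P * annulus_level p q N z) Num.sqrt); last exact: sqrt_continuous.
by apply: cvgM; [exact: cvg_cst | exact: cL].
Qed.

Lemma annulus_integral :
  (\int[lebesgue_measure]_(y in `[2%R, 3%R]) (annulus_density p q N y)%:E =
   (pi * c / Num.sqrt P * (annulus_primitive r - annulus_primitive 0))%:E)%E.
Proof.
have [n8 c0 c8 P1 PQ] := prm.
pose F (y : R) : R := - (pi * c / Num.sqrt P) * annulus_primitive (r * (3 - y)).
have dF (y : R) : is_derive y (1 : R) F (annulus_density p q N y).
  have db : is_derive y (1 : R) (fun z : R => r * (3 - z)) (- r).
    rewrite (_ : (fun z : R => r * (3 - z)) = r \*: (cst 3 - (id : R -> R))); last by apply/funext.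
    by apply: is_derive_eq; rewrite /GRing.scale /= sub0r mulrN1.
  have := is_deriveZ (- (pi * c / Num.sqrt P))
    (@is_derive1_comp R annulus_primitive (fun z => r * (3 - z)) y _ _
      (annulus_primitive_derive (r * (3 - y))) db).
  rewrite -[_ \*: _]/F => D; apply: is_derive_eq D _; rewrite /GRing.scale /=.
  rewrite /annulus_density -/n -/c -/P -/Q annulus_levelE -/r sqrtrM; last by lra.
  have s1 : Num.sqrt P != 0 by rewrite gt_eqF // sqrtr_gt0; lra.
  have s2 : Num.sqrt (Y (r * (3 - y))) != 0 by rewrite gt_eqF // sqrtr_gt0.
  by field; rewrite s1 s2.
have cF : continuous F.
  move=> y; apply: differentiable_continuous; apply/derivable1_diffP.
  by have [] := dF y.
rewrite (continuous_FTC2 (F := F)).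
- rewrite -EFinB /F subrr mulr0; congr (_%:E).
  have -> : 3 - 2 = 1 :> R by ring.
  by rewrite mulr1; ring.
- by rewrite ltr_nat.
- by apply: continuous_subspaceT; exact: annulus_density_continuous.
- split=> [y _||].
  + by have [] := dF y.
  + exact: cvg_at_right_filter (cF 2).
  + exact: cvg_at_left_filter (cF 3).
- by move=> y _; rewrite derive1E; have [_ ->] := dF y.
Qed.

(* The logarithm comes from the thin end of the annulus, where the circle
   [w = 0] has radius of order [sqrt c]; it is the gain over the cone. *)
Lemma annulus_gain :
  2 * n * (pi * c / Num.sqrt P * (annulus_primitive r - annulus_primitive 0)) <=
  pi * Num.sqrt (P * Q) - c * (pi / Num.sqrt (P * Q) * ln (n / 4)).
Proof.
have [n8 c0 c8 P1 PQ] := prm.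
have n0 : n != 0 by apply/eqP => h; lra.
have p_0 := pi_gt0 R.
have [P0 Q0] : 0 <= P /\ 0 <= Q by split; lra.
have sP : 0 < Num.sqrt P by rewrite sqrtr_gt0; lra.
have sQ : 0 < Num.sqrt Q by rewrite sqrtr_gt0; lra.
have r0 : 0 <= r by exact: sqrtr_ge0.
have PQ0 : 0 < P + Q by lra.
have r2 : r ^+ 2 = (P - 2 * c) / (P + Q) by rewrite sqr_sqrtr // divr_ge0 //; lra.
have Y1 : Y r = P * (Q + 2 * c) / (P + Q).
  by rewrite /Y r2; field; exact: negbT (gt_eqF PQ0).
have PQ1 : P + Q <= 2 * (P * Q).
  have h1 : 0 <= (P - 1) * (Q - 1) by rewrite mulr_ge0; lra.
  have h2 : 0 <= P * Q - 1 by have := ler_pM ler01 ler01 P1 (_ : 1 <= Q); lra.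
  lra.
have Yh : 1 / 2 <= Y r.
  rewrite Y1 ler_pdivlMr //; have h : 0 <= P * (2 * c) by rewrite mulr_ge0 //; lra.
  lra.
set A := Num.sqrt Q * r + Num.sqrt (Y r).
have A0 : 0 < A by exact: YQ.
have A2 : 1 / 2 <= A ^+ 2.
  apply: le_trans Yh _; rewrite -[leLHS](sqr_sqrtr (ltW (Y0 r))).
  have YA : Num.sqrt (Y r) <= A by rewrite /A lerDr mulr_ge0 // ltW.
  by rewrite ler_pXn2r ?nnegrE ?sqrtr_ge0 // ltW.
have B0 : 0 < Num.sqrt (2 * c) by rewrite sqrtr_gt0; lra.
(* At the wide end [A ^+ 2 >= 1 / 2], at the thin end the argument of the logarithm has square
   [2 c]; the quotient of the squares is at least [1 / (4 c) = n / 4]. *)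
have lnAB : ln (n / 4) <= 2 * (ln A - ln (Num.sqrt (2 * c))).
  have -> : 2 * (ln A - ln (Num.sqrt (2 * c))) = ln (A ^+ 2 / (2 * c)).
    have e : Num.sqrt (2 * c) ^+ 2 = 2 * c by rewrite sqr_sqrtr //; lra.
    rewrite -{2}e ln_div ?posrE ?exprn_gt0 // !lnXn // !mulr2n; ring.
  rewrite ler_ln ?posrE; first last.
  - by rewrite divr_gt0 ?exprn_gt0 //; lra.
  - by lra.
  have -> : n / 4 = 1 / 2 / (2 * c) by rewrite /c; field.
  by rewrite ler_pM2r // invr_gt0; lra.
(* [(P - 2 c) (Q + 2 c) = P Q - 2 c (Q - P) - 4 c^2] is at most [P Q], as [P < Q]. Multiplied by
   [2 pi / sqrt P], the right-hand side becomes [pi sqrt (P Q)], the area of the cone. *)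
have first_le : (P + Q) / 2 * (r * Num.sqrt (Y r)) <= Num.sqrt P * Num.sqrt (P * Q) / 2.
  have -> : (P + Q) / 2 * (r * Num.sqrt (Y r)) = Num.sqrt (P * ((P - 2 * c) * (Q + 2 * c))) / 2.
    have h1 : P * ((P - 2 * c) * (Q + 2 * c)) = (P + Q) ^+ 2 * (r ^+ 2 * Y r).
      by rewrite r2 Y1; field; exact: negbT (gt_eqF PQ0).
    rewrite h1 sqrtrM ?sqr_ge0 // sqrtr_sqr ger0_norm ?(ltW PQ0) //.
    rewrite sqrtrM ?sqr_ge0 // sqrtr_sqr ger0_norm //; ring.
  rewrite ler_pM2r ?invr_gt0; last by lra.
  rewrite -sqrtrM //; apply: ler_wsqrtr; apply: ler_wpM2l => //.
  have h : 0 <= c * (Q - P) by rewrite mulr_ge0; lra.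
  have := sqr_ge0 c; lra.
have -> : 2 * n * (pi * c / Num.sqrt P * (annulus_primitive r - annulus_primitive 0)) =
    2 * pi / Num.sqrt P * ((P + Q) / 2 * (r * Num.sqrt (Y r))) -
    2 * pi / Num.sqrt P * (c * (Q - P) / Num.sqrt Q * (ln A - ln (Num.sqrt (2 * c)))).
  rewrite /annulus_primitive -/(Y r) -/A mul0r !mulr0 !add0r.
  have -> : Y 0 = 2 * c by rewrite /Y expr0n mulr0 addr0.
  have cn : n * c = 1 by rewrite mulfV.
  have sP1 := negbT (gt_eqF sP); have sQ1 := negbT (gt_eqF sQ).
  set X := _ - _ - _; have -> : 2 * n * (pi * c / Num.sqrt P * X) = 2 * (n * c) * (pi / Num.sqrt P * X) by field.
  by rewrite cn /X; field; rewrite sP1 sQ1.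
apply: lerB.
  have -> : pi * Num.sqrt (P * Q) = 2 * pi / Num.sqrt P * (Num.sqrt P * Num.sqrt (P * Q) / 2).
    by field; exact: negbT (gt_eqF sP).
  by apply: ler_wpM2l => //; rewrite divr_ge0 // ?(ltW sP) //; lra.
rewrite sqrtrM //.
set L := ln A - _ in lnAB *.
have L0 : 0 <= 2 * L.
  apply: le_trans lnAB; apply: ln_ge0; lra.
have -> : 2 * pi / Num.sqrt P * (c * (Q - P) / Num.sqrt Q * L) =
    c * (pi / (Num.sqrt P * Num.sqrt Q) * ((Q - P) * (2 * L))).
  by field; rewrite !(negbT (gt_eqF _)).
apply: ler_wpM2l; first by lra.
apply: ler_wpM2l; first by rewrite divr_ge0 ?mulr_ge0 // ltW.
apply: le_trans lnAB _.
by rewrite -[leLHS]mul1r; apply: ler_wpM2r => //; lra.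
Qed.

End AnnulusIntegral.

Section AreaBounds.
Context {R : realType}.
Local Notation mu1 := (@lebesgue_measure R).

Lemma integral_indic_itv (a b : R) : a <= b ->
  (\int[mu1]_x (\1_`[a, b]%classic x)%:E = (b - a)%:E)%E.
Proof.
move=> ab; rewrite integral_indic // setIT.
apply: (etrans (lebesgue_measure_itv `[a, b]%R)); rewrite /= lte_fin.
case: ltP => // ba; rewrite (_ : b = a) ?subrr //; apply/eqP; rewrite eq_le ba ab //.
Qed.

Lemma integral_mul_indic (g : R -> R) (A : set R) :
  (\int[mu1]_x (g x * \1_A x)%:E = \int[mu1]_(x in A) (g x)%:E)%E.
Proof.
rewrite [RHS]integral_mkcond; apply: eq_integral => x _.
by rewrite patchE indicE; case: (x \in A); rewrite ?mulr1 ?mulr0.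
Qed.

Section Strip.
Variables (p q N : nat).
Hypotheses (p0 : (0 < p)%N) (pq : (p < q)%N) (N8 : (8 <= N)%N).
Let n : R := N%:R.
Let c : R := n^-1.
Let P : R := p%:R.
Let Q : R := q%:R.

Let prm : [/\ 8 <= n, 0 < c, c <= 1 / 8, 1 <= P & P + 1 <= Q] := @params R p q N p0 pq N8.

(** The cells occupy width [2 n] and height 2 with density at most [64 piece_const c^2], the core
    band width [2 n] and height 1 with density at most [64 P c^2]; since [n c = 1], this is their
    total area divided by [c]. *)
Definition strip_const : R := 256 * piece_const p q + 128 * P.

Definition strip_area_bound : R :=
  strip_const * c + pi * Num.sqrt (P * Q) - c * (pi / Num.sqrt (P * Q) * ln (n / 4)).

Lemma piece_const_ge0 : 0 <= piece_const p q :> R.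
Proof.
have [n8 c0 c8 P1 PQ] := prm.
by rewrite /piece_const -/P -/Q !addr_ge0 ?divr_ge0 ?mulr_ge0 ?sqr_ge0 //; lra.
Qed.

Lemma strip_area (D : set (R * R)) (F : R * R -> 'rV[R]_4) :
  (forall u, D u -> 0 <= u.1 <= 2 * n /\ 0 <= u.2 <= 4) ->
  (forall u, D u -> ~ grid_lines u -> area_density F u <= strip_density p q N u.2) ->
  (param_area D F <= strip_area_bound%:E)%E.
Proof.
have [n8 c0 c8 P1 PQ] := prm; move=> Db DF.
pose A : R := 64 * piece_const p q * c ^+ 2; pose B : R := 64 * P * c ^+ 2.
have A0 : 0 <= A by have := piece_const_ge0 => h; rewrite !mulr_ge0 ?sqr_ge0 //; lra.
have B0 : 0 <= B by rewrite !mulr_ge0 ?sqr_ge0 //; lra.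
pose dens : R -> R := annulus_density p q N.
have dens0 y : 0 <= dens y by exact: annulus_density_ge0.
have md : measurable_fun setT dens.
  by apply: continuous_measurable_fun; exact: annulus_density_continuous.
pose a (x : R) : R := \1_`[0, 2 * n]%classic x.
(* The closed intervals share the heights 2 and 3, where the sum exceeds the density; this is
   harmless for an upper bound. *)
pose b (y : R) : R := A * \1_`[0, 2]%classic y + dens y * \1_`[2, 3]%classic y +
  B * \1_`[3, 4]%classic y.
have mi (x y : R) : measurable_fun setT (\1_`[x, y]%classic : R -> R) by [].
have mA : measurable_fun setT (fun y : R => A * \1_`[0, 2]%classic y).
  by apply: measurable_funM => //; exact: measurable_cst.
have mB : measurable_fun setT (fun y : R => B * \1_`[3, 4]%classic y).
  by apply: measurable_funM => //; exact: measurable_cst.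
have mD : measurable_fun setT (fun y : R => dens y * \1_`[2, 3]%classic y).
  exact: measurable_funM.
have mb : measurable_fun setT b.
  by apply: measurable_funD => //; exact: measurable_funD.
have ma : measurable_fun setT a by exact: mi.
have mab := measurable_mul_coords ma mb.
have i0 (x y z : R) : 0 <= \1_`[x, y]%classic z :> R by rewrite indicE.
have a0 x : 0 <= a x by exact: i0.
have ti (k x y z : R) : 0 <= k -> 0 <= k * \1_`[x, y]%classic z :> R.
  by move=> k0; apply: mulr_ge0 => //; exact: i0.
have tA x y z := ti A x y z A0; have tB x y z := ti B x y z B0.
have tD w x y z := ti (dens w) x y z (dens0 w).
have b0 y : 0 <= b y by apply: addr_ge0; [apply: addr_ge0|].
have : (param_area D F <= \int[lebesgue2]_u (a u.1 * b u.2)%:E)%E.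
  apply: (negligible_integral_le grid_lines_negligible).
  - exact/measurable_EFinP.
  - by move=> u; rewrite lee_fin sqrtr_ge0.
  - by move=> u; rewrite lee_fin mulr_ge0.
  - move=> u Du nu; rewrite lee_fin; apply: le_trans (DF u Du nu) _.
    have [u1 /andP[y0 y4]] := Db u Du.
    have ind (x y z : R) : x <= z -> z <= y -> \1_`[x, y]%classic z = 1 :> R.
      by move=> xz zy; rewrite indicE mem_set //= in_itv /= xz zy.
    have -> : a u.1 = 1 by case/andP: u1 => *; exact: ind.
    rewrite mul1r /strip_density -/n -/c -/P -/A -/B -/(dens u.2) /b.
    have [h2|h2] := leP u.2 2.
      by rewrite (ind 0 2) // mulr1 -addrA lerDl addr_ge0.
    have [h3|h3] := leP u.2 3.
      by rewrite (ind 2 3) // ?(ltW h2) // mulr1 addrAC lerDr addr_ge0.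
    by rewrite (ind 3 4) // ?(ltW h3) // mulr1 lerDr addr_ge0.
move/le_trans; apply; rewrite integral_mul_coords //.
rewrite integral_indic_itv; last by lra.
have -> : (\int[mu1]_y (b y)%:E = (A * 2 + pi * c / Num.sqrt P *
    (annulus_primitive p q N (Num.sqrt ((P - 2 * c) / (P + Q))) - annulus_primitive p q N 0) + B)%:E)%E.
  rewrite /b; under eq_integral do rewrite !EFinD.
  rewrite ge0_integralD //; first last.
  - exact/measurable_EFinP.
  - by move=> y _; rewrite lee_fin.
  - by apply/measurable_EFinP; exact: measurable_funD.
  - by move=> y _; rewrite lee_fin addr_ge0.
  rewrite ge0_integralD //; first last.
  - exact/measurable_EFinP.
  - by move=> y _; rewrite lee_fin.
  - exact/measurable_EFinP.
  - by move=> y _; rewrite lee_fin.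
  rewrite (etrans (integral_mul_indic dens _) (annulus_integral p0 pq N8)) -/n -/c -/P -/Q.
  have cst_itv (k x y : R) : 0 <= k -> x <= y ->
      (\int[mu1]_z (k * \1_`[x, y]%classic z)%:E = (k * (y - x))%:E)%E.
    move=> k0 xy; under eq_integral do rewrite EFinM.
    rewrite ge0_integralZl_EFin ?integral_indic_itv //.
    exact/measurable_EFinP.
  have le34 : 3 <= 4 :> R by lra.
  rewrite (cst_itv A 0 2) // (cst_itv B 3 4) //.
  rewrite -!EFinD; congr (_%:E); congr (_ + _ + _); ring.
rewrite -EFinM lee_fin.
rewrite subr0 /strip_area_bound -/n -/c.
set I := _ * (_ - _).
have g : 2 * n * I <= pi * Num.sqrt (P * Q) - c * (pi / Num.sqrt (P * Q) * ln (n / 4)).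
  exact: annulus_gain.
have cn : n * c = 1 by rewrite mulfV //; apply/eqP => h; lra.
have -> : 2 * n * (A * 2 + I + B) = strip_const * c * (n * c) + 2 * n * I.
  by rewrite /strip_const /A /B; ring.
rewrite cn mulr1; lra.
Qed.

End Strip.

(** * The area of the cone *)

Section ConeArea.
Variables (p q : nat).
Hypotheses (p0 : (0 < p)%N) (q0 : (0 < q)%N).
Let P : R := p%:R.
Let Q : R := q%:R.

Lemma gamma_pol (s : R) : gamma R p q s =
  pol (Num.sqrt (Q / (P + Q))) (Num.sqrt (P / Q) * s)
      (Num.sqrt (P / (P + Q))) (- (Num.sqrt (Q / P) * s) + pi / 2).
Proof.
have [P0 Q0] : 0 < P /\ 0 < Q by rewrite !ltr0n.
have i : (Num.sqrt (p + q)%:R)^-1 = Num.sqrt (P + Q)^-1 :> R.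
  by rewrite natrD sqrtrV // addr_ge0 // ltW.
rewrite /gamma i !sqrtrM ?(ltW P0) ?(ltW Q0) // -/P -/Q.
apply/matrixP => k j; rewrite !mxE; case: j => -[|[|[|[|//]]]] ? /=;
  rewrite ?cosDpihalf ?sinDpihalf; ring.
Qed.

Lemma polar_pol (u : R * R) : polar R p q u =
  pol (u.1 * Num.sqrt (Q / (P + Q))) (Num.sqrt (P / Q) * u.2)
      (u.1 * Num.sqrt (P / (P + Q))) (- (Num.sqrt (Q / P) * u.2) + pi / 2).
Proof.
rewrite /polar gamma_pol; apply/matrixP => k j; rewrite !mxE.
by case: j => -[|[|[|[|//]]]] ? /=; ring.
Qed.

Lemma dot_pol (a al b be : R) : dot (pol a al b be) (pol a al b be) = a ^+ 2 + b ^+ 2.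
Proof.
rewrite /dot !big_ord_recl big_ord0 !mxE /= addr0.
have h1 := cos2Dsin2 al; have h2 := cos2Dsin2 be.
transitivity (a ^+ 2 * (cos al ^+ 2 + sin al ^+ 2) + b ^+ 2 * (cos be ^+ 2 + sin be ^+ 2)).
  by ring.
by rewrite h1 h2 !mulr1.
Qed.

Lemma polar_density (u : R * R) : area_density (polar R p q) u = `|u.1|.
Proof.
have [P0 Q0] : 0 < P /\ 0 < Q by rewrite !ltr0n.
have P1 := negbT (gt_eqF P0); have Q1 := negbT (gt_eqF Q0).
have PQ0 : 0 < P + Q by rewrite addr_gt0.
have PQ1 := negbT (gt_eqF PQ0).
set A := Num.sqrt (Q / (P + Q)); set B := Num.sqrt (P / (P + Q)).
set a := Num.sqrt (P / Q); set b := Num.sqrt (Q / P).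
have nF : \forall w \near u, polf true (w.1 * A) (a * w.2) (w.1 * B) (- (b * w.2)) = polar R p q w.
  by apply: filterE => w; rewrite polar_pol.
have g1 := gradM (grad_fst u) (grad_cst A u).
have g2 := gradM (grad_fst u) (grad_cst B u).
have [_ ->] := polf_near_partials nF g1 (gradZ a (grad_snd u)) g2 (gradN (gradZ b (grad_snd u))).
have A2 : A ^+ 2 = Q / (P + Q) by rewrite sqr_sqrtr // divr_ge0 // ltW.
have B2 : B ^+ 2 = P / (P + Q) by rewrite sqr_sqrtr // divr_ge0 // ltW.
have a2 : a ^+ 2 = P / Q by rewrite sqr_sqrtr // divr_ge0 // ltW.
have b2 : b ^+ 2 = Q / P by rewrite sqr_sqrtr // divr_ge0 // ltW.
rewrite -sqrtr_sqr; congr Num.sqrt; rewrite /Qform.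
transitivity (u.1 ^+ 2 * ((A ^+ 2 + B ^+ 2) * (A ^+ 2 * a ^+ 2 + B ^+ 2 * b ^+ 2))); first by ring.
by rewrite A2 B2 a2 b2; field; rewrite P1 Q1 PQ1.
Qed.

(** [gamma] is a unit speed curve on the unit sphere, so [polar] has density [|r|], and the sector
    over the length [2 pi sqrt (p q)] has half of that length as its area. A lower bound is enough,
    as the cone is to have the larger area. *)
Lemma cone_area_ge : ((pi * Num.sqrt (P * Q))%:E <= cone_area R p q)%E.
Proof.
have [P0 Q0] : 0 < P /\ 0 < Q by rewrite !ltr0n.
have p_0 := pi_ge0 R.
pose a (x : R) : R := x * \1_`[0, 1]%classic x.
pose L : R := 2 * pi * Num.sqrt (p * q)%:R.
have L0 : 0 <= L by rewrite !mulr_ge0 ?sqrtr_ge0.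
pose b (y : R) : R := \1_`[0, L]%classic y.
have mi (x y : R) : measurable_fun setT (\1_`[x, y]%classic : R -> R) by [].
have ma : measurable_fun setT a.
  by apply: measurable_funM => //; exact: measurable_id.
have a0 x : 0 <= a x.
  rewrite /a indicE; case: (boolP (x \in _)) => [|_]; last by rewrite mulr0.
  by move/set_mem; rewrite /= in_itv /= => /andP[x0 _]; rewrite mulr1.
have b0 y : 0 <= b y by rewrite /b indicE.
have ib : (\int[mu1]_y (b y)%:E = L%:E)%E by rewrite -[L]subr0; exact: integral_indic_itv.
have ia : (\int[mu1]_x (a x)%:E = (1 / 2)%:E)%E.
  apply: (etrans (integral_mul_indic id _)).
  rewrite (continuous_FTC2 (F := fun x : R => x ^+ 2 / 2)) //.
  - by rewrite -EFinB; congr (_%:E); rewrite expr1n expr0n /= mul0r subr0.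
  - by apply: continuous_subspaceT => x; exact: cvg_id.
  - have c2 : continuous (fun x : R => x ^+ 2 / 2).
      by move=> x; apply: cvgM; [exact: exprn_continuous | exact: cvg_cst].
    split=> [x _||].
    + by apply: derivableM => //; exact: derivable_cst.
    + exact: cvg_at_right_filter (c2 0).
    + exact: cvg_at_left_filter (c2 1).
  - move=> x _; rewrite derive1E.
    have -> : (fun x : R => x ^+ 2 / 2) = 2^-1 \*: ((id : R -> R) ^+ 2).
      by apply/funext => y; rewrite -[RHS]/(2^-1 * (y ^+ 2)) mulrC.
    have D : is_derive x (1 : R) (2^-1 \*: ((id : R -> R) ^+ 2)) x.
      by apply: is_derive_eq; rewrite /GRing.scale /= expr1; field.
    by have [_ ->] := D.
have -> : (pi * Num.sqrt (P * Q))%:E = (\int[lebesgue2]_u (a u.1 * b u.2)%:E)%E.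
  have mb : measurable_fun setT b by exact: mi.
  rewrite (integral_mul_coords ma mb a0 b0) ia ib.
  by rewrite -EFinM /L natrM -/P -/Q; congr (_%:E); field.
rewrite /cone_area /param_area [leRHS]integral_mkcond.
have ab0 u : (0 <= (a u.1 * b u.2)%:E)%E by rewrite lee_fin mulr_ge0.
apply: ge0_integral_le_nonmeasurable => // [u|u _].
  by rewrite patchE; case: ifP => // _; rewrite lee_fin sqrtr_ge0.
rewrite patchE; case: ifPn => [_|].
  rewrite lee_fin polar_density.
  rewrite /a -mulrA; apply: le_trans (ler_norm _) _; rewrite normrM.
  rewrite -[leRHS]mulr1; apply: ler_wpM2l => //.
  by rewrite /b !indicE; case: (_ \in _); case: (_ \in _); rewrite ?mulr1 ?mulr0 ?normr0 ?normr1.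
rewrite lee_fin notin_setE => nD; rewrite /a /b !indicE.
case: (boolP (u.1 \in _)) => [/set_mem h1|_]; last by rewrite mulr0 mul0r.
case: (boolP (u.2 \in _)) => [/set_mem h2|_]; last by rewrite mulr0.
exfalso; apply: nD; move: h1 h2; rewrite /= !in_itv /= => /andP[u0 u1] u2; split=> //.
rewrite /unit_ball /= polar_pol dot_pol !exprMn !sqr_sqrtr ?divr_ge0 ?addr_ge0 ?(ltW P0) ?(ltW Q0) //.
have -> : u.1 ^+ 2 * (Q / (P + Q)) + u.1 ^+ 2 * (P / (P + Q)) = u.1 ^+ 2.
  by field; rewrite gt_eqF // addr_gt0.
by rewrite expr_le1.
Qed.

End ConeArea.
End AreaBounds.

Lemma ge8_gt0 (N : nat) : (8 <= N)%N -> (0 < N)%N.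
Proof. exact: leq_trans. Qed.

(** * The map on the glued surface and its area *)

Section CrosscapMap.
Context {R : realType}.
Variables (f : bool) (p q N : nat).
Hypotheses (p0 : (0 < p)%N) (pq : (p < q)%N) (N8 : (8 <= N)%N).
Let N0 := ge8_gt0 N8.
Let n : R := N%:R.
Let c : R := n^-1.
Let P : R := p%:R.
Let Q : R := q%:R.

Local Notation a := (@crosscap_atlas R N N0).
Local Notation par := (gpar a).
Local Notation M := (@crosscap_surface R N N0).

Let prm : [/\ 8 <= n, 0 < c, c <= 1 / 8, 1 <= P & P + 1 <= Q] := @params R p q N p0 pq N8.

(** The value is chosen from any chart that contains the point; by [chart_map_eq] all of them give
    the same one. *)
Definition crosscap_map (x : M) : 'rV[R]_4 :=
  xget 0 [set z | exists i u, [/\ (i < ncharts N)%N, cdom N i u, x = par i u &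
    z = chart_map f p q N i u]].

Lemma crosscap_mapE i u : (i < ncharts N)%N -> cdom N i u ->
  crosscap_map (par i u) = chart_map f p q N i u.
Proof.
move=> iN du; rewrite /crosscap_map.
case: xgetP => [z _ [j [v [jN dv /(par_eq N0 iN jN du dv) e ->]]]|/(_ (chart_map f p q N i u))].
  by apply: (@chart_map_eq R) => //; exact: esym.
by case; exists i, u.
Qed.

Lemma crosscap_map_lipschitz : lipschitz_map crosscap_map.
Proof.
apply: (@glued_lipschitz R a crosscap_map (chart_map f p q N)).
- by move=> i u iN du; exact: crosscap_mapE.
- by move=> i u iN du; exact: chart_map_lipschitz.
Qed.

Lemma chart_pointsP (i : 'I_(nchart M)) (A : set M) u : chart_points i A u ->
  [/\ cdom N i u, A (par i u) & 0 < u.2].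
Proof.
move=> [[_ [[v dv <-] Av] <-] u0]; rewrite /= in u0 *.
by move: Av u0; rewrite /= (gchartK (a := a) (ltn_ord i) dv).
Qed.

Lemma crosscap_map_near i u : (i < ncharts N)%N -> cdom N i u -> 0 < u.2 ->
  \forall w \near u, crosscap_map (par i w) = chart_map f p q N i w.
Proof.
move=> iN [du _] u0.
have c2 : continuous (snd : R * R -> R) by move=> w; exact: cvg_snd.
have ck : continuous (fun w : R * R => 0 : R) by move=> w; exact: cvg_cst.
have o : \forall w \near u, dom_open_part N i w.
  by apply: open_nbhs_nbhs; split=> //; exact: dom_open_part_open.
apply: filterS2 o (near_ltf ck c2 u0) => w dw w0; apply: crosscap_mapE => //.
by split=> //; exact: ltW.
Qed.

Lemma crosscap_map_partials i u : (i < ncharts N)%N -> cdom N i u -> 0 < u.2 ->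
  partial1 (crosscap_map \o par i) u = partial1 (chart_map f p q N i) u /\
  partial2 (crosscap_map \o par i) u = partial2 (chart_map f p q N i) u.
Proof.
move=> iN du u0; have nf := crosscap_map_near iN du u0.
by split; exact: near_eq_derive.
Qed.

Lemma crosscap_map_isotropic : isotropic_ae crosscap_map.
Proof.
move=> i; apply: negligibleS (@grid_lines_negligible R) => u /= h.
apply: contrapT => nu; apply: h => /chart_pointsP[du _ u0].
have [-> ->] := crosscap_map_partials (ltn_ord i) du u0.
exact: chart_map_isotropic.
Qed.

Lemma crosscap_map_lagrangian : lagrangian_surface crosscap_map.
Proof.
split; [exact: crosscap_compact_connected | exact: crosscap_map_lipschitz |].
exact: crosscap_map_isotropic.
Qed.

Lemma outside_chart0 i u : (i < ncharts N)%N -> cdom N i u ->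
  ~ (exists2 v, cdom N 0 v & par i u = par 0 v) -> grid_lines u.
Proof.
have [n8 c0 c8 P1 PQ] := prm.
move=> iN du nv; case: (chart_cases N0 iN du) => [//|[h _ _]|[_ h]|[_ h]].
- by exists 0; exact: Or41.
- by exists 4; exact: Or42.
- by exists 1; exact: Or42.
Qed.

(** [area] counts a point in the first chart that contains it. By [outside_chart0] the points missed
    by chart 0 lie on grid lines of the other charts, so chart 0 carries the whole area. *)
Lemma crosscap_map_area : (area crosscap_map <= (strip_area_bound p q N)%:E)%E.
Proof.
have [n8 c0 c8 P1 PQ] := prm.
have N4 : (0 < ncharts N)%N by [].
pose i0 : 'I_(nchart M) := Ordinal N4.
rewrite /area (bigD1 i0) //= -[leRHS]adde0; apply: leeD.
  apply: (strip_area p0 pq N8) => u /chart_pointsP[du _ u0].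
    case: du => [[[s0 s1] [[y0 y4] _]] _]; move: s0 s1 y4; rewrite /lo /hi /yhi /= => s0 s1 y4.
    by rewrite !ltW.
  move=> nu; rewrite /area_density; have [-> ->] := crosscap_map_partials N4 du u0.
  have y4 : u.2 < 4 by case: du => [[_ [[_ +] _]] _].
  have -> : @chart_map R f p q N 0 = strip_map f p q N by apply/funext.
  have [|_ ->//] := strip_local f p0 pq N8 (u := u) _ nu.
  by rewrite u0 (lt_trans y4) //; lra.
rewrite big1 // => i ii0; apply/eqP; rewrite eq_le; apply/andP; split; last first.
  by apply: integral_ge0 => u _; rewrite lee_fin sqrtr_ge0.
have i_gt0 : (0 < i)%N by rewrite lt0n; apply: contra ii0 => /eqP i_0; apply/eqP; exact: val_inj.
have z : (\int[@lebesgue2 R]_u cst 0 u = 0)%E by exact: integral0.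
rewrite -z.
apply: (negligible_integral_le (@grid_lines_negligible R)) => //.
- by move=> u; rewrite lee_fin sqrtr_ge0.
- move=> u /chart_pointsP[du nD u0] nu; exfalso; apply: nu; apply: (outside_chart0 (ltn_ord i) du) => -[v dv e].
  by apply: nD; exists i0 => //; exists v => //; rewrite e.
Qed.

End CrosscapMap.

(** * The boundary curve *)

Section BoundaryCurve.
Context {R : realType}.
Variables (p q : nat).
Hypotheses (p0 : (0 < p)%N) (q0 : (0 < q)%N).
Let P : R := p%:R.
Let Q : R := q%:R.

(** The curve [gamma] in the parameter [t = s / sqrt (p q)], for which it has period [2 pi]: an
    orbit of the circle action of weights [(p, -q)]. *)
Definition torus_curve (t : R) : 'rV[R]_4 :=
  pol (Num.sqrt (Q / (P + Q))) (P * t) (Num.sqrt (P / (P + Q))) (- (Q * t) + pi / 2).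

Lemma torus_curve_int2pi (t : R) (k : int) :
  torus_curve (t + k%:~R * (2 * pi)) = torus_curve t.
Proof.
have -> : torus_curve (t + k%:~R * (2 * pi)) =
    polf true (Num.sqrt (Q / (P + Q))) (P * t + ((p : int) * k)%:~R * (2 * pi))
      (Num.sqrt (P / (P + Q))) (- (Q * t) + (- ((q : int) * k))%:~R * (2 * pi)).
  by rewrite /torus_curve /polf; congr pol; rewrite ?mulrNz ?intrM -?[(p : int)%:~R]/P -?[(q : int)%:~R]/Q; ring.
exact: polf_int2pi.
Qed.

Lemma reduce_angle (t : R) : exists2 s, 0 <= s < 2 * pi & exists k : int, t = s + k%:~R * (2 * pi).
Proof.
have pi2 : 0 < 2 * pi :> R by rewrite mulr_gt0 ?pi_gt0.
pose k := Num.floor (t / (2 * pi)).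
have /andP[h1 h2] : k%:~R <= t / (2 * pi) < (k + 1)%:~R by rewrite floor_le /= floorD1_gt.
exists (t - k%:~R * (2 * pi)); last by exists k; rewrite subrK.
move: h1 h2; rewrite ler_pdivlMr // ltr_pdivrMr // intrD => h1 h2.
by apply/andP; split; lra.
Qed.

Lemma cone_link : pq_cone R p q `&` unit_sphere = range torus_curve.
Proof.
have [P0 Q0] : 0 < P /\ 0 < Q by rewrite !ltr0n.
have PQ0 : 0 < P + Q by rewrite addr_gt0.
have sPQ : 0 < Num.sqrt (p * q)%:R :> R by rewrite sqrtr_gt0 natrM mulr_gt0.
have norm u : dot (polar R p q u) (polar R p q u) = u.1 ^+ 2.
  rewrite polar_pol // dot_pol !exprMn !sqr_sqrtr ?divr_ge0 ?(ltW P0) ?(ltW Q0) ?(ltW PQ0) //.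
  by rewrite -/P -/Q; field; rewrite gt_eqF.
have curve (t : R) : polar R p q (1, Num.sqrt (p * q)%:R * t) = torus_curve t.
  rewrite polar_pol //= !mul1r -/P -/Q.
  have h (x y : R) : 0 < x -> 0 < y -> Num.sqrt (x / y) * (Num.sqrt (x * y) * t) = x * t.
    move=> x0 y0; rewrite mulrA -sqrtrM ?divr_ge0 ?ltW //.
    have -> : x / y * (x * y) = x ^+ 2 by field; rewrite gt_eqF.
    by rewrite sqrtr_sqr gtr0_norm.
  by rewrite natrM -/P -/Q h // [P * Q]mulrC h.
apply/seteqP; split=> [_ [[[r s] [/= r0 _] <-]]|_ [t _ <-]].
  rewrite /unit_sphere /= norm /= => /eqP; rewrite sqrf_eq1 => /orP[/eqP ->|/eqP r1]; last first.
    by move: r0; rewrite r1; lra.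
  exists (s / Num.sqrt (p * q)%:R) => //; rewrite -curve; congr (polar R p q (1, _)).
  by rewrite mulrC divfK // gt_eqF.
have [s /andP[s0 s1] [k ->]] := reduce_angle t; rewrite torus_curve_int2pi -curve; split.
  exists (1, Num.sqrt (p * q)%:R * s) => //; split; rewrite /= ?ler01 //.
  by rewrite mulr_ge0 ?(ltW sPQ) //= mulrC ler_pM2r // ltW.
by rewrite /unit_sphere /= norm expr1n.
Qed.

Hypothesis pq : coprime p q.

(** Equal points make [p (t - s)] and [q (t - s)] multiples of [2 pi]; by a Bezout relation for the
    coprime [p] and [q], so is [t - s]. *)
Lemma torus_curve_inj (s t : R) : torus_curve s = torus_curve t ->
  exists k : int, t = s + k%:~R * (2 * pi).
Proof.
have [P0 Q0] : 0 < P /\ 0 < Q by rewrite !ltr0n.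
have PQ0 : 0 < P + Q by rewrite addr_gt0.
move=> e; have co k : torus_curve s 0 k = torus_curve t 0 k by rewrite e.
have sA : Num.sqrt (Q / (P + Q)) != 0 by rewrite gt_eqF // sqrtr_gt0 divr_gt0.
have sB : Num.sqrt (P / (P + Q)) != 0 by rewrite gt_eqF // sqrtr_gt0 divr_gt0.
move: (co 0) (co 1) (co 2) (co 3); rewrite !mxE /=.
move=> /(mulfI sA) c1 /(mulfI sA) s1 /(mulfI sB) c2 /(mulfI sB) s2.
have [k kE] := cos_sin_eq c1 s1; have [l lE] := cos_sin_eq c2 s2.
have [u v uv _] := egcdnP q p0.
move: uv; rewrite (eqP pq) => uv.
have uvR : u%:R * P = v%:R * Q + 1 :> R by rewrite -natrM uv natrD natrM.
exists ((u : int) * k + (v : int) * l).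
rewrite intrD !intrM -[(u : int)%:~R]/(u%:R : R) -[(v : int)%:~R]/(v%:R : R).
have h1 : P * (t - s) = k%:~R * (2 * pi) by rewrite mulrBr kE; ring.
have h2 : Q * (t - s) = - (l%:~R * (2 * pi)).
  have -> : Q * (t - s) = - (- (Q * t) + pi / 2) + (- (Q * s) + pi / 2) by ring.
  by rewrite lE; ring.
transitivity (s + (u%:R * P - v%:R * Q) * (t - s)); first by rewrite uvR; ring.
rewrite mulrBl -!mulrA h1 h2; ring.
Qed.

End BoundaryCurve.

Section CrosscapBoundary.
Context {R : realType}.
Variables (f : bool) (p q N : nat).
Hypotheses (p0 : (0 < p)%N) (pq : (p < q)%N) (N8 : (8 <= N)%N) (copq : coprime p q).
Let N0 := ge8_gt0 N8.
Let n : R := N%:R.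
Let c : R := n^-1.
Let P : R := p%:R.
Let Q : R := q%:R.

Local Notation a := (@crosscap_atlas R N N0).
Local Notation par := (gpar a).
Local Notation M := (@crosscap_surface R N N0).
Local Notation l := (@crosscap_map R f p q N N8).

Let prm : [/\ 8 <= n, 0 < c, c <= 1 / 8, 1 <= P & P + 1 <= Q] := @params R p q N p0 pq N8.

(** The cone has type [(p1, p2)], which reaches both orders of the weights from [p < q]. Exchanging
    the complex coordinates also reverses the direction of the link, recorded by the sign [e]. *)
Let p1 := if f then p else q.
Let p2 := if f then q else p.
Let e : int := if f then 1 else -1.

Let q0 : (0 < q)%N. Proof. exact: ltn_trans pq. Qed.
Let p10 : (0 < p1)%N. Proof. by rewrite /p1; case: f. Qed.
Let p20 : (0 < p2)%N. Proof. by rewrite /p2; case: f. Qed.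
Let co12 : coprime p1 p2. Proof. by rewrite /p1 /p2; case: f; rewrite // coprime_sym. Qed.

Lemma crosscap_map_edge i (s : R) : (i < 2)%N -> cdom N i (s, 0) ->
  l (par i (s, 0)) = torus_curve p1 p2 (e%:~R * (pi / n * s)).
Proof.
have [n8 c0 c8 P1 PQ] := prm.
move=> i2 ds; have i4 : (i < 4)%N by exact: ltn_trans i2 _.
rewrite crosscap_mapE //; last exact: small_ncharts.
rewrite /chart_map i4 /strip_map /half_strip_map /= !ler0n.
pose j : int := Num.floor (s / 2).
have /andP[j1 j2] : j%:~R <= s / 2 < (j + 1)%:~R by rewrite floor_le /= floorD1_gt.
rewrite intrD in j2.
rewrite (cell_center_floor (j := j)); last by apply/andP; split; lra.
set xi : R := 2 * j%:~R + 1.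
have sX : s = xi + (s - xi) by rewrite addrC subrK.
have o : (0 : R) = 1 + -1 by rewrite subrr.
have X1 : `|s - xi| <= 1 by rewrite ler_norml /xi; apply/andP; split; lra.
rewrite {1}sX {1}o cell_edge; last by rewrite normrN normr1 max_r.
rewrite -sX -/n -/c mulrN1 subrr /action_angle !addr0 subr0 -/P -/Q.
have half (x : R) : 2 * (x * (1 / 2)) / (P + Q) = x / (P + Q) by field; apply: contraTN isT => /eqP; lra.
rewrite !half /polf /torus_curve /p1 /p2 /e.
case: f; first by rewrite mul1r.
by rewrite -/P -/Q !mulrN1z !mulN1r !mulrN opprK [Q + P]addrC.
Qed.

Lemma crosscap_map_bounds : bounds l (pq_cone R p1 p2 `&` unit_sphere).
Proof.
have [n8 c0 c8 P1 PQ] := prm.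
have n0 : n != 0 by apply/eqP => h; lra.
have pi0 := pi_gt0 R; have w0 : 0 < pi / n :> R by rewrite divr_gt0 //; lra.
have wN := negbT (gt_eqF w0).
have ee : e%:~R * e%:~R = 1 :> R.
  by rewrite /e; case: f; rewrite ?mulr1 // mulrN1z mulN1r opprK.
rewrite cone_link //; split.
  apply/seteqP; split=> [_ [x /crosscap_boundary[i [s [i2 ds ->]]] <-]|_ [t _ <-]].
    by rewrite crosscap_map_edge //; exists (e%:~R * (pi / n * s)).
  have [s /andP[s0 s1] [k tE]] := reduce_angle (e%:~R * t).
  have {tE} tE : t = e%:~R * s + (e * k)%:~R * (2 * pi).
    by rewrite intrM -mulrA -mulrDr -tE mulrA ee mul1r.
  set S := (pi / n)^-1 * s.
  have sE : pi / n * S = s by rewrite mulVKf.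
  have s0' : 0 <= S by rewrite mulr_ge0 // invr_ge0 ltW.
  have s1' : S < 2 * n by rewrite ltr_pdivrMl // mulrCA divfK.
  have cd (y : R) : 0 < cdist (y, 0) by apply: cdist_far; rewrite eq_sym oner_eq0.
  rewrite tE torus_curve_int2pi // -sE.
  have [i [i2 di]] : exists i, (i < 2)%N /\ cdom N i (S, 0).
    (* The windows are open, so the abscissa 0 is missing from chart 0 and is taken from chart 1. *)
    have [z|z] := eqVneq (S) 0.
      exists 1%N; split=> //; apply: cdom1P => //; rewrite ?z ?lexx //=.
      by rewrite -/n oppr_lt0; lra.
    exists 0%N; split=> //; apply: cdom0P => //; rewrite ?lexx //=.
    by rewrite lt_def z s0'.
  exists (par i (S, 0)); last exact: crosscap_map_edge.
  by apply/crosscap_boundary; exists i, (S).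
move=> x y /set_mem/crosscap_boundary[i [s [i2 ds ->]]].
move=> /set_mem/crosscap_boundary[j [t [j2 dt ->]]].
rewrite !crosscap_map_edge // => /(torus_curve_inj p10 p20 co12)[k kE].
have i4 : (i < 4)%N by exact: ltn_trans i2 _.
have j4 : (j < 4)%N by exact: ltn_trans j2 _.
(* Equality on the torus curve means a translation by a multiple of [2 n], hence an even deck
   transformation, which fixes the edge [y = 0]. *)
have tE : t = s + 2 * (e * k)%:~R * n.
  have h : pi / n * t = pi / n * s + (e * k)%:~R * (2 * pi).
    transitivity (e%:~R * (e%:~R * (pi / n * t)) : R); first by rewrite mulrA ee mul1r.
    by rewrite kE mulrDr mulrA ee mul1r intrM mulrA.
  by apply: (mulfI wN); rewrite h [RHS]mulrDr; congr (_ + _); rewrite [RHS]mulrCA divfK // mulrA [_ * 2]mulrC.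
apply: (par_deck N0 (k := 2 * (e * k))) => //; try exact: small_ncharts.
- by rewrite /exc leqNgt i4.
- by rewrite /exc leqNgt j4.
- rewrite /lft i4 j4 /deck /= tE -/n.
  have dE : (2 * (e * k))%:~R = 2 * (e * k)%:~R :> R by rewrite (intrM _ 2 (e * k)).
  have aE : (2 * (e * k))%:~R * pi = 0 + (e * k)%:~R * (2 * pi) :> R by rewrite dE; ring.
  by rewrite aE cosDint2pi cos0 mul1r subrKC dE.
Qed.

Lemma crosscap_map_comparison :
  nonorientable_comparison (pq_cone R p1 p2 `&` unit_sphere) l.
Proof.
split; [exact: crosscap_map_lagrangian | exact: crosscap_nonorientable |].
exact: crosscap_map_bounds.
Qed.

End CrosscapBoundary.

(** * The choice of N and the conclusion *)

Lemma strip_area_bound_lt (R : realType) (p q : nat) : (0 < p)%N -> (p < q)%N ->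
  exists2 N, (8 <= N)%N &
    strip_area_bound p q N < pi * Num.sqrt (p%:R * q%:R) :> R.
Proof.
move=> p0 pq; have q0 : (0 < q)%N by exact: ltn_trans pq.
set s : R := Num.sqrt (p%:R * q%:R).
have s0 : 0 < s by rewrite sqrtr_gt0 mulr_gt0 ?ltr0n.
have pi0 := pi_gt0 R.
(* Divided by [c], the claim is [strip_const < pi / s * ln (N / 4)]. As [strip_const] does not
   depend on [N], any [N > 4 exp X] will do; the minimum 8 is what the estimates on the cells
   require. *)
pose X : R := @strip_const R p q / (pi / s).
pose N := maxn 8 (Num.bound (4 * expR X)).
have N8 : (8 <= N)%N by exact: leq_maxl.
exists N => //.
have N0 : 0 < N%:R :> R by rewrite ltr0n; exact: leq_trans N8.
have hN : 4 * expR X < N%:R.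
  apply: (@lt_le_trans _ _ (Num.bound (4 * expR X))%:R).
    by apply: archi_boundP; rewrite mulr_ge0 // expR_ge0.
  by rewrite ler_nat leq_maxr.
have hX : X < ln (N%:R / 4).
  rewrite -[X]expRK ltr_ln ?posrE ?expR_gt0 ?divr_gt0 //.
  by rewrite ltr_pdivlMr // mulrC.
have key : @strip_const R p q < pi / s * ln (N%:R / 4).
  by rewrite mulrC -ltr_pdivrMr // divr_gt0.
rewrite /strip_area_bound -/s.
have := ltr_pM2r (_ : 0 < (N%:R)^-1 :> R); rewrite invr_gt0 => /(_ N0) h.
by move: key; rewrite -h => key; lra.
Qed.

Lemma crosscap_beats_cone (R : realType) (f : bool) (p q : nat) :
  (0 < p)%N -> (p < q)%N -> coprime p q ->
  let p1 := if f then p else q in let p2 := if f then q else p in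
  exists (M : surface R) (l : M -> 'rV[R]_4),
    nonorientable_comparison (pq_cone R p1 p2 `&` unit_sphere) l /\
    (area l < cone_area R p1 p2)%E.
Proof.
move=> p0 pq co p1 p2; have q0 : (0 < q)%N by exact: ltn_trans pq.
have [N N8 lt] := strip_area_bound_lt R p0 pq.
exists (crosscap_surface (ge8_gt0 N8)), (@crosscap_map R f p q N N8); split.
  exact: crosscap_map_comparison.
apply: le_lt_trans (crosscap_map_area f p0 pq N8) _.
have p10 : (0 < p1)%N by rewrite /p1; case: (f).
have p20 : (0 < p2)%N by rewrite /p2; case: (f).
apply: lt_le_trans (cone_area_ge p10 p20); rewrite lte_fin.
by have -> : p1%:R * p2%:R = p%:R * q%:R :> R by rewrite /p1 /p2; case: (f) => //; rewrite mulrC.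
Qed.

Theorem proposition7p8 (R : realType) (p q : nat)
    (hp : (0 < p)%N) (hq : (0 < q)%N) (hpq : coprime p q)
    (hne : (p, q) <> (1%N, 1%N)) :
  ~ minimizes_among_nonorientable R p q /\
  exists (M : surface R) (l : M -> 'rV[R]_4),
    nonorientable_comparison (pq_cone R p q `&` unit_sphere) l /\
    (area l < cone_area R p q)%E.
Proof.
suff [M [l [h lt]]] : exists (M : surface R) (l : M -> 'rV[R]_4),
    nonorientable_comparison (pq_cone R p q `&` unit_sphere) l /\
    (area l < cone_area R p q)%E.
  split; last by exists M, l.
  by move=> /(_ M l h); rewrite leNgt lt.
have [lt|lt|pE] := ltngtP p q.
- exact: (crosscap_beats_cone R true hp lt hpq).
- by apply: (crosscap_beats_cone R false hq lt); rewrite coprime_sym.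
(* Equal coprime integers are both 1, the case without logarithmic gain. *)
- by case: hne; move: hpq; rewrite pE /coprime gcdnn => /eqP ->.
Qed.
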